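(* Consider the orthogonal regression model with known $\sigma$ described in the context. Let Assumptions (B) and (C) below hold and let $mp\to s\in(0,\infty]$. In the denser case, i.e. if $p>\frac{(\log m)^{\gamma_1}}{m}$ for some constant $\gamma_1>1$, assume additionally that $n\le m^{\gamma_2}$ for some $\gamma_2>0$ and that $\frac{\log\log m}{\log(p\,n^{-1/2})}\to0$. Let $d_1,d_2,d_3\in\mathbb R$ be fixed constants. Then each of the following rules, which select the model $M$ minimizing the respective criterion (with $k=k(M)$), is ABOS: mBIC1: $\ \frac{RSS_M}{\sigma^2}+k(\log(nm^2)+d_1)-2\log(k!)-\sum_{i=1}^k\log\log(nm^2/i^2)$; mBIC2: $\ \frac{RSS_M}{\sigma^2}+k(\log(nm^2)+d_2)-2\log(k!)$; mBIC3: $\ \frac{RSS_M}{\sigma^2}+k(\log(nm^2)+d_3)-2k\log k$. If in addition $mp\sqrt{\frac{\log n}{n}}\to0$, then these rules are consistent.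
   Context: Setting. All quantities are indexed by $m$, all limits are for $m\to\infty$, and the index $m$ is suppressed. $n=n_m\in\mathbb N$, $p=p_m\in(0,1)$, $\delta_0,\delta_A>0$ may depend on $m$; $\sigma>0$ and $\nu$ are fixed, $\nu$ being a probability measure on $\mathbb R$ with $\nu(\{0\})=0$, $\nu(-\infty,0)>0$, $\nu(0,\infty)>0$. The model is $Y=X\beta+\epsilon$ with $Y\in\mathbb R^n$, a deterministic $n\times(m+1)$ design matrix $X$ whose first column consists of ones and which satisfies $X'X=nI_{(m+1)\times(m+1)}$ (so $m<n$), and $\epsilon\sim N(0,\sigma^2I_{n\times n})$. The regression coefficients $\beta_1,\dots,\beta_m$ are i.i.d. with law $(1-p)d_0+p\nu$ ($d_0$ = Dirac measure at $0$), independent of $\epsilon$. The intercept is always included; a model $M$ is a subset of the $m$ regressors, $k(M)$ is the number of its regressors (intercept not counted), and $RSS_M$ is the residual sum of squares of the least squares fit. $\hat\beta_i$ is the least squares estimate of $\beta_i$. Convention: $0\log0=0$. Put $\delta=\delta_0/\delta_A$, $f=(1-p)/p$. The risk $R$ of a selection rule is $\delta_0$ times the expected number of selected regressors with $\beta_i=0$ plus $\delta_A$ times the expected number of non-selected regressors with $\beta_i\neq0$. The Bayes oracle (for large $n$) selects regressor $i$ iff $\hat\beta_i\notin(a_n,b_n)$, where $a_n<0<b_n$ are the unique solutions $a$ of $(1-p)\delta_0=p\,\delta_A\int_{\mathbb R}\exp\left(n\left(a\frac{\mu}{\sigma^2}-\frac{\mu^2}{2\sigma^2}\right)\right)d\nu(\mu)$;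 its risk is $R^B$. A rule with risk $R$ is ABOS (asymptotically Bayes optimal under sparsity) if $R/R^B\to1$. A rule is consistent if the probability of selecting the true model $\{i:\beta_i\ne0\}$ converges to $1$ as $m\to\infty$. Assumption (B): $n\to\infty$, $p\to0$, $\log\delta=o(\log p)$, and $\delta$ is bounded from above. Assumption (C) (with $C=0$): there is $\epsilon_0>0$ such that $\nu$ has a positive bounded density $\rho$ w.r.t. Lebesgue measure on $[-\epsilon_0,\epsilon_0]$, and $\rho(0^-)=\lim_{\mu\uparrow0}\rho(\mu)$, $\rho(0^+)=\lim_{\mu\downarrow0}\rho(\mu)$ exist and are finite and positive. *)

(* Defs.v *)
From HB Require Import structures.
From mathcomp Require Import all_boot all_order all_algebra.
From mathcomp Require Import all_classical all_reals all_analysis.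

Set Implicit Arguments.
Unset Strict Implicit.
Unset Printing Implicit Defensive.

Import Order.TTheory GRing.Theory Num.Theory.
Import numFieldNormedType.Exports.

Local Open Scope classical_set_scope.
Local Open Scope ring_scope.

(* In a design matrix with m.+1 columns, column ord0 is the intercept and
   column [lift ord0 i] is the regressor i : 'I_m.  A model is the set of its
   regressors; the intercept is always included and never counted. *)

Definition sqnorm (R : realType) (n : nat) (v : 'cV[R]_n) : R :=
  \sum_(i < n) v i ord0 ^+ 2.

Definition model_coeffs (R : realType) (m : nat) (M : {set 'I_m}) :
    set 'cV[R]_m.+1 :=
  [set b | forall i : 'I_m, i \notin M -> b (lift ord0 i) ord0 = 0].

Definition RSS (R : realType) (n m : nat) (X : 'M[R]_(n, m.+1)) (y : 'cV[R]_n)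
    (M : {set 'I_m}) : R :=
  inf [set sqnorm (y - X *m b) | b in model_coeffs M].

Definition least_squares (R : realType) (n m : nat) (X : 'M[R]_(n, m.+1))
    (y : 'cV[R]_n) : 'cV[R]_m.+1 :=
  invmx (X^T *m X) *m (X^T *m y).

Definition mbic1 (R : realType) (sigma d : R) (n m : nat)
    (X : 'M[R]_(n, m.+1)) (y : 'cV[R]_n) (M : {set 'I_m}) : R :=
  RSS X y M / sigma ^+ 2
  + #|M|%:R * (ln (n%:R * m%:R ^+ 2) + d)
  - 2 * ln ((#|M|)`!)%:R
  - \sum_(1 <= i < #|M|.+1) ln (ln (n%:R * m%:R ^+ 2 / i%:R ^+ 2)).

Definition mbic2 (R : realType) (sigma d : R) (n m : nat)
    (X : 'M[R]_(n, m.+1)) (y : 'cV[R]_n) (M : {set 'I_m}) : R :=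
  RSS X y M / sigma ^+ 2
  + #|M|%:R * (ln (n%:R * m%:R ^+ 2) + d)
  - 2 * ln ((#|M|)`!)%:R.

(* The convention 0 log 0 = 0 holds because [ln 0 = 0]. *)
Definition mbic3 (R : realType) (sigma d : R) (n m : nat)
    (X : 'M[R]_(n, m.+1)) (y : 'cV[R]_n) (M : {set 'I_m}) : R :=
  RSS X y M / sigma ^+ 2
  + #|M|%:R * (ln (n%:R * m%:R ^+ 2) + d)
  - 2 * #|M|%:R * ln #|M|%:R.

(* Ties may be broken in any way. *)
Definition minimizes (R : realType) (n m : nat)
    (crit : 'cV[R]_n -> {set 'I_m} -> R) (S : 'cV[R]_n -> {set 'I_m}) : Prop :=
  forall y M, crit y (S y) <= crit y M.

Definition mutually_independent (d : measure_display) (T : measurableType d)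
    (R : realType) (P : probability T R) (I : finType)
    (Z : I -> {RV P >-> R}) : Prop :=
  forall (J : {set I}) (A : I -> set R), (forall i, measurable (A i)) ->
    P (\bigcap_(i in [set` J]) (Z i @^-1` A i)) =
    (\prod_(i in J) P (Z i @^-1` A i))%E.

Definition sum_family (A : Type) (I J : Type) (u : I -> A) (v : J -> A)
    (k : I + J) : A :=
  match k with inl i => u i | inr j => v j end.

Definition spike_slab (R : realType) (p : R) (nu : set R -> \bar R)
    (A : set R) : \bar R :=
  ((1 - p)%:E * \d_(0%R : R) A + p%:E * nu A)%E.

Definition coeff_vector (R : realType) (T : Type) (m : nat) (beta0 : T -> R)
    (beta : 'I_m -> T -> R) (w : T) : 'cV[R]_m.+1 :=
  \col_j oapp (fun i => beta i w) (beta0 w) (unlift ord0 j).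

Definition response (R : realType) (T : Type) (n m : nat)
    (X : 'M[R]_(n, m.+1)) (beta0 : T -> R) (beta : 'I_m -> T -> R)
    (eps : 'I_n -> T -> R) (w : T) : 'cV[R]_n :=
  X *m coeff_vector beta0 beta w + \col_j eps j w.

Definition true_model (R : realType) (T : Type) (m : nat)
    (beta : 'I_m -> T -> R) (w : T) : {set 'I_m} :=
  [set i | beta i w != 0]%SET.

Definition risk (d : measure_display) (T : measurableType d) (R : realType)
    (P : probability T R) (m : nat) (delta0 deltaA : R)
    (truth selected : T -> {set 'I_m}) : \bar R :=
  (delta0%:E * 'E_P[fun w => #|selected w :\: truth w|%:R]
   + deltaA%:E * 'E_P[fun w => #|truth w :\: selected w|%:R])%E.

Definition oracle_threshold (R : realType) (sigma : R)
    (nu : probability (measurableTypeR R) R) (n : nat) (p delta0 deltaA : R) :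
    set R :=
  [set a | ((1 - p) * delta0)%:E =
    ((p * deltaA)%:E * \int[nu]_u
      (expR (n%:R * (a * (u / sigma ^+ 2) - u ^+ 2 / (2 * sigma ^+ 2))))%:E)%E].

(* [get] picks the unique solution of the given sign once n is large; it
   returns an irrelevant default value for the n for which there is none. *)
Definition oracle_lower (R : realType) (sigma : R)
    (nu : probability (measurableTypeR R) R) (n : nat) (p delta0 deltaA : R) :
    R :=
  get [set a | a < 0 /\ oracle_threshold sigma nu n p delta0 deltaA a].

Definition oracle_upper (R : realType) (sigma : R)
    (nu : probability (measurableTypeR R) R) (n : nat) (p delta0 deltaA : R) :
    R :=
  get [set b | 0 < b /\ oracle_threshold sigma nu n p delta0 deltaA b].

Definition bayes_oracle (R : realType) (sigma : R)
    (nu : probability (measurableTypeR R) R) (n m : nat) (p delta0 deltaA : R)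
    (X : 'M[R]_(n, m.+1)) (y : 'cV[R]_n) : {set 'I_m} :=
  [set i | ~~ ((oracle_lower sigma nu n p delta0 deltaA
                  < least_squares X y (lift ord0 i) ord0)
            && (least_squares X y (lift ord0 i) ord0
                  < oracle_upper sigma nu n p delta0 deltaA))]%SET.

Definition ABOS (R : realType) (rho rhoB : nat -> \bar R) : Prop :=
  fine (rho m) / fine (rhoB m) @[m --> \oo] --> (1 : R).

Definition consistent (R : realType) (d : nat -> measure_display)
    (T : forall m, measurableType (d m)) (P : forall m, probability (T m) R)
    (truth selected : forall m, T m -> {set 'I_m}) : Prop :=
  P m [set w | selected m w = truth m w] @[m --> \oo] --> 1%E.

Definition assumption_B (R : realType) (n : nat -> nat) (p delta : nat -> R) :
    Prop :=
  [/\ n m @[m --> \oo] --> \oo,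
      p m @[m --> \oo] --> (0 : R),
      (fun m => ln (delta m) : R^o) =o_\oo (fun m => ln (p m) : R^o) &
      exists K : R, forall m, delta m <= K].

Definition assumption_C (R : realType)
    (nu : probability (measurableTypeR R) R) : Prop :=
  exists (e0 : R) (rho : R -> R),
    [/\ 0 < e0,
        measurable_fun `[- e0, e0] rho,
        forall A : set R, measurable A -> A `<=` `[- e0, e0] ->
          nu A = (\int[lebesgue_measure]_(x in A) (rho x)%:E)%E,
        exists K : R, forall x, x \in `[- e0, e0] -> 0 < rho x <= K &
        exists l r : R, [/\ 0 < l, 0 < r,
          rho x @[x --> 0^'-] --> l & rho x @[x --> 0^'+] --> r]].

(* The additional assumption for the denser case, required of those indices m
   that are in this case: nothing is asked if p <= (log m)^g / m eventually for
   every g > 1, and everything is asked if p > (log m)^g / m eventually for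
   some g > 1. *)
Definition denser_index (R : realType) (p : nat -> R) (g : R) : set nat :=
  [set m | (ln m%:R) `^ g / m%:R < p m].

Definition denser_case_assumption (R : realType) (n : nat -> nat)
    (p : nat -> R) : Prop :=
  forall g1 : R, 1 < g1 ->
    (exists2 g2 : R, 0 < g2 &
       \forall m \near \oo, denser_index p g1 m -> (n m)%:R <= m%:R `^ g2) /\
    ln (ln m%:R) / ln (p m / Num.sqrt (n m)%:R)
      @[m --> within (denser_index p g1) \oo] --> (0 : R).

(* Main.v *)
From HB Require Import structures.
Require Import Defs.
From mathcomp Require Import all_boot all_order all_algebra.
From mathcomp Require Import all_classical all_reals all_analysis.
From mathcomp Require Import measurable_realfun.
From mathcomp Require Import ring lra zify.

Set Implicit Arguments.
Unset Strict Implicit.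
Unset Printing Implicit Defensive.

Import Order.TTheory GRing.Theory Num.Theory.
Import numFieldNormedType.Exports.

Local Open Scope classical_set_scope.
Local Open Scope ring_scope.

(* The estimates are bhat_i = beta_i + zeta_i / sqrt n, where, the design being
   orthogonal, the zeta_i are i.i.d. N(0, sigma^2) and independent of the
   coefficients.  Comparing a minimizer of one of the criteria with the models
   that have one regressor more or less shows that it thresholds
   n bhat_i^2 / sigma^2 at ln(n m^2 / k^2) up to a lower order term, k being the
   size of the selected model, whereas the oracle thresholds it at
   L = ln(n / p^2) up to a factor 1 + o(1).  In both cases the risk is
   asymptotically that of the missed signals: those are the signals lying in a
   strip of width of order sigma sqrt(L / n) around 0, and their expected number
   is equivalent to D = m p kappa sigma sqrt(L / n), with kappa the sum of the
   one-sided limits of the density of nu at 0.  The false positives only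
   contribute o(D).
   The random size k is decoupled from the i-th pair (beta_i, zeta_i) by
   replacing it with the largest k such that at least k of the regressors,
   i included, are signals or exceed the k-th threshold: this number dominates k
   when i is selected, is independent of the i-th pair, and has mean at most
   2 (1 + m p). *)

(** * Rotation invariance of the Gaussian product measure *)

(** The k-th level is L + 2 ln(m p / k), so a size k within a factor L of m p moves the threshold by
    O(ln L) = o(L) only, and crude control of k suffices. From above it is Markov's inequality for
    the step-up number, cut at (1 + m p) L; from below, when m p is bounded, k = 1 already gives the
    right level, and when m p tends to infinity an exponential lower tail is used. False positives
    are O((1 + m p) / sqrt n), so the factor sqrt L in D is the whole margin. For mBIC1, subtracting
    ln of the level raises the null tail by the square root of the level; the factor 1 / sqrt x of
    the Gaussian tail bound is kept because it cancels exactly this loss. Events about the model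
    size involve finitely many comparisons per regressor, so each pair is replaced by a finite label
    and the i.i.d. arguments become finite sums. For the oracle, completing the square in the
    threshold equation turns its integral into exp(x^2 / 2) times the integral under nu of a
    Gaussian bump of width sigma / sqrt n. *)

Lemma ge0_integral_affine (R : realType) (a b : R) (f : R -> \bar R) :
  a != 0 -> measurable_fun [set: R] f -> (forall x, (0 <= f x)%E) ->
  (\int[lebesgue_measure]_x f (a * x + b)%R =
   `|a|^-1%:E * \int[lebesgue_measure]_x f x)%E.
Proof.
move=> a0 mf f0.
have ma : measurable_fun [set: R] (fun x : R => a * x + b).
  by apply: measurable_funD => //; exact: measurable_funM.
pose phi (x : measurableTypeR R) : measurableTypeR R := a * x + b.
have mphi : measurable_fun setT phi by [].
have na : 0 <= `|a| by [].
pose lam : {measure set (measurableTypeR R) -> \bar R} :=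
  mscale (NngNum na) (measure_function_pushforward__canonical__measure_function_Measure lebesgue_measure mphi).
(* Lebesgue measure is determined by half-open intervals, and [|a|] times the pushforward under
   [phi] gives each of them its length. A negative a reverses the interval, hence the two cases of
   the preimage. *)
have lamE A : measurable A -> lebesgue_measure A = lam A.
  apply: lebesgue_measure_unique => _ [[x y] _ <-] /=.
  rewrite /lam /= /mscale /= /pushforward.
  have [xy|yx] := ltP x y; last first.
    rewrite set_itv_ge ?bnd_simp -?leNgt//.
    by rewrite preimage_set0 !(measure0 (@lebesgue_measure R)) mule0.
  have -> : phi @^-1` `]x, y] =
     if 0 < a then [set` `](x - b) / a, (y - b) / a]] else [set` `[(y - b) / a, (x - b) / a[].
    apply/seteqP; split => z; case: ltP => ha; rewrite /= !in_itv/= /phi.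
    - by rewrite ltr_pdivrMr// ler_pdivlMr// => /andP[? ?]; apply/andP; split; lra.
    - have {}ha : a < 0 by rewrite lt_neqAle a0.
      by rewrite ler_ndivrMr// ltr_ndivlMr// => /andP[? ?]; apply/andP; split; lra.
    - by rewrite ltr_pdivrMr// ler_pdivlMr// => /andP[? ?]; apply/andP; split; lra.
    - have {}ha : a < 0 by rewrite lt_neqAle a0.
      by rewrite ler_ndivrMr// ltr_ndivlMr// => /andP[? ?]; apply/andP; split; lra.
  case: ltP => ha.
    rewrite !lebesgue_measure_itv/= !lte_fin xy ltr_pM2r ?invr_gt0// ltrD2r xy.
    rewrite -!EFinD -EFinM gtr0_norm//; congr EFin; field.
    by rewrite gt_eqF.
  have {}ha : a < 0 by rewrite lt_neqAle a0.
  rewrite !lebesgue_measure_itv/= !lte_fin xy ltr_nM2r ?invr_lt0// ltrD2r xy.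
  rewrite -!EFinD -EFinM ltr0_norm//; congr EFin; field.
  by rewrite lt_eqF.
have -> : (\int[lebesgue_measure]_x f x = \int[lam]_x f x)%E.
  by apply: eq_measure_integral => A mA _; rewrite -lamE.
rewrite ge0_integral_mscale//= ge0_integral_pushforward//.
by rewrite muleA -EFinM mulVf ?normr_eq0// mul1e.
Qed.

(** Restricted to E, m is dominated by Lebesgue measure, and its Radon-Nikodym derivative has the
    same integrals as g over measurable subsets of E, so the two agree almost everywhere there. *)
Lemma ge0_integral_density (R : realType) (m : {finite_measure set (measurableTypeR R) -> \bar R})
    (E : set R) (g : R -> R) (f : R -> \bar R) :
  measurable E -> measurable_fun E g -> (forall x, E x -> 0 <= g x) ->
  (forall A : set R, measurable A -> A `<=` E ->
     m A = (\int[lebesgue_measure]_(x in A) (g x)%:E)%E) ->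
  measurable_fun E f -> (forall x, (0 <= f x)%E) ->
  (\int[m]_(x in E) f x = \int[lebesgue_measure]_(x in E) (f x * (g x)%:E))%E.
Proof.
move=> mE mg g0 mE' mf f0.
pose m' : {finite_measure set (measurableTypeR R) -> \bar R} := mrestr m mE.
have m'mu : m' `<< @lebesgue_measure R.
  apply/null_content_dominatesP => A mA A0.
  have mAE : measurable (A `&` E) by exact: measurableI.
  rewrite /m' /= /mrestr mE'//.
  apply: null_set_integral => //.
    by apply/measurable_EFinP; apply: measurable_funS mg.
  by apply/eqP; rewrite eq_le measure_ge0 andbT -A0 le_measure// inE.
have -> : (\int[m]_(x in E) f x = \int[m']_(x in E) f x)%E.
  by apply: eq_measure_integral => A mA AE; rewrite /m' /= /mrestr (setIidl AE).
rewrite -(Radon_Nikodym_SigmaFinite.change_of_variables m'mu)//.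
have mEg : measurable_fun E (EFin \o g) by exact/measurable_EFinP.
have RNi : (@lebesgue_measure R).-integrable E (Radon_Nikodym_SigmaFinite.f m' (@lebesgue_measure R)).
  by apply: (integrableS measurableT) => //; exact: Radon_Nikodym_SigmaFinite.f_integrable.
apply: ae_eq_integral => //.
- by apply: emeasurable_funM => //; exact: (measurable_int _ RNi).
- by apply: emeasurable_funM.
apply: ae_eqe_mul2l; apply: integral_ae_eq => // A AE mA.
rewrite -(Radon_Nikodym_SigmaFinite.f_integral m'mu)// -mE'//.
by rewrite /m' /= /mrestr (setIidl AE).
Qed.

(* A rotation with c <> 0 is a product of two shears and a scaling, so that it
   reduces to one-dimensional affine substitutions. *)
Lemma ge0_integral_rotation (R : realType) (c s : R) (w : R * R -> \bar R) :
  c != 0 -> c ^+ 2 + s ^+ 2 = 1 ->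
  measurable_fun [set: R * R] w -> (forall v, (0 <= w v)%E) ->
  (\int[lebesgue_measure]_x \int[lebesgue_measure]_y w (x, y) =
   \int[lebesgue_measure]_x \int[lebesgue_measure]_y
     w (c * x + s * y, c * y - s * x)%R)%E.
Proof.
move=> c0 cs1 mw w0.
rewrite (@fubini_tonelli _ _ _ _ R lebesgue_measure lebesgue_measure w)//=.
transitivity (\int[lebesgue_measure]_y
    (`|c|^-1%:E * \int[lebesgue_measure]_u w (c^-1 * u + s * y / c, y)%R))%E.
  apply: eq_integral => y _.
  rewrite (@ge0_integral_affine R c^-1 (s * y / c) (fun x => w (x, y)))//.
  - by rewrite normfV muleA -EFinM invrK mulVf ?normr_eq0// mul1e.
  - by rewrite invr_eq0.
  - by apply: measurableT_comp => //; exact: measurable_pair2.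
pose w1 v := w (c^-1 * v.1 + s * v.2 / c, v.2).
have mw1 : measurable_fun [set: R * R] w1.
  apply: measurableT_comp => //; apply: measurable_fun_pair => //.
  by apply: measurable_funD; do ?apply: measurable_funM => //.
have w10 v : (0 <= w1 v)%E by exact: w0.
rewrite ge0_integralZl//; last 2 first.
- exact: (@measurable_fun_fubini_tonelli_G _ _ _ _ R lebesgue_measure w1).
- by move=> y _; exact: integral_ge0.
rewrite -(@fubini_tonelli _ _ _ _ R lebesgue_measure lebesgue_measure w1)//=.
have mw2 x : measurable_fun [set: R] (fun y => w1 (x, y)).
  by apply: measurableT_comp => //; exact: measurable_pair1.
rewrite -ge0_integralZl//; last 2 first.
- exact: (@measurable_fun_fubini_tonelli_F _ _ _ _ R lebesgue_measure w1).
- by move=> y _; exact: integral_ge0.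
apply: eq_integral => x _.
rewrite -(@ge0_integral_affine R c (- (s * x)) (fun y => w1 (x, y)))//.
apply: eq_integral => y _; rewrite /w1 /=; congr (w (_, _)).
(* The factor [|c|^-1] of the first substitution has been absorbed by the second; the two compose to
   the rotation because 1 - s^2 = c^2. *)
have -> : c^-1 * x + s * (c * y - s * x) / c = (x * (1 - s ^+ 2)) / c + s * y.
  by field.
by rewrite -cs1 addrK; field.
Qed.

Lemma normal_prob_productE (R : realType) (sigma : R) (D : set (R * R)) :
  measurable D ->
  ((normal_prob 0 sigma \x normal_prob 0 sigma) D =
   \int[lebesgue_measure]_x \int[lebesgue_measure]_y
     (\1_D (x, y) * (normal_pdf 0 sigma x * normal_pdf 0 sigma y))%:E)%E.
Proof.
move=> mD; rewrite /product_measure1/=.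
rewrite (@ge0_integral_density R (normal_prob 0 sigma) setT (normal_pdf 0 sigma))//; last 3 first.
- exact: measurable_normal_pdf.
- by move=> x _; exact: normal_pdf_ge0.
- exact: measurable_fun_xsection.
apply: eq_integral => x _ /=.
rewrite /normal_prob integral_mkcond/= -ge0_integralZr//=; last 3 first.
- apply/(measurable_restrictT _ (measurable_xsection x mD)).
  by apply/measurable_EFinP/measurable_funTS; exact: measurable_normal_pdf.
- by move=> y _; apply: erestrict_ge0 => z _; rewrite lee_fin normal_pdf_ge0.
- by rewrite lee_fin normal_pdf_ge0.
apply: eq_integral => y _; rewrite patchE indicE mem_xsection.
by case: ifP => _ /=; rewrite ?mul0e ?mul0r// mul1r -EFinM mulrC.
Qed.

Lemma measurable_rotation_preimage (R : realType) (c s : R) (A B : set R) :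
  measurable A -> measurable B ->
  measurable [set v : R * R | A (c * v.1 - s * v.2) /\ B (s * v.1 + c * v.2)].
Proof.
move=> mA mB; apply: measurableI.
  rewrite -[X in measurable X]setTI; apply: measurable_funB => //; exact: measurable_funM.
rewrite -[X in measurable X]setTI; apply: measurable_funD => //; exact: measurable_funM.
Qed.

(** The joint density depends only on x^2 + y^2, so the rotation that straightens the set into a
    rectangle leaves it unchanged. *)
Lemma normal_prob_rotation (R : realType) (sigma c s : R) (A B : set R) :
  sigma != 0 -> c != 0 -> c ^+ 2 + s ^+ 2 = 1 -> measurable A -> measurable B ->
  ((normal_prob 0 sigma \x normal_prob 0 sigma)
     [set v | A (c * v.1 - s * v.2)%R /\ B (s * v.1 + c * v.2)%R] =
   normal_prob 0 sigma A * normal_prob 0 sigma B)%E.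
Proof.
move=> sigma0 c0 cs1 mA mB.
have mD := measurable_rotation_preimage c s mA mB.
rewrite normal_prob_productE//.
rewrite (@ge0_integral_rotation R c s (fun v => (\1_[set v : R * R | A (c * v.1 - s * v.2)%R /\ B (s * v.1 + c * v.2)%R] v * (normal_pdf 0 sigma v.1 * normal_pdf 0 sigma v.2))%:E))//; last 2 first.
- apply/measurable_EFinP; apply: measurable_funM => //.
  by apply: measurable_funM; apply: measurableT_comp => //; exact: measurable_normal_pdf.
- by move=> v; rewrite lee_fin mulr_ge0// mulr_ge0// normal_pdf_ge0.
rewrite -product_measure1E// normal_prob_productE; last exact: measurableX.
apply: eq_integral => x _; apply: eq_integral => y _ /=; congr EFin.
congr (_ * _).
  rewrite !indicE; congr (_ %:R); congr nat_of_bool; apply/idP/idP; rewrite !inE/=.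
    have -> : c * (c * x + s * y) - s * (c * y - s * x) = (c ^+ 2 + s ^+ 2) * x by ring.
    have -> : s * (c * x + s * y) + c * (c * y - s * x) = (c ^+ 2 + s ^+ 2) * y by ring.
    by rewrite cs1 !mul1r.
  have -> : c * (c * x + s * y) - s * (c * y - s * x) = (c ^+ 2 + s ^+ 2) * x by ring.
  have -> : s * (c * x + s * y) + c * (c * y - s * x) = (c ^+ 2 + s ^+ 2) * y by ring.
  by rewrite cs1 !mul1r.
rewrite !normal_pdfE// /normal_fun !subr0 mulrACA [RHS]mulrACA -!expRD; congr (_ * expR _).
have e : (c * x + s * y) ^+ 2 + (c * y - s * x) ^+ 2 = x ^+ 2 + y ^+ 2.
  have -> : (c * x + s * y) ^+ 2 + (c * y - s * x) ^+ 2 = (c ^+ 2 + s ^+ 2) * (x ^+ 2 + y ^+ 2) by ring.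
  by rewrite cs1 mul1r.
by rewrite -!mulrDl -!opprD e.
Qed.

(** * Independence of an orthonormal transform of the noise *)

Lemma measure_rect_unique d1 d2 (T1 : measurableType d1) (T2 : measurableType d2)
    (R : realType) (m1 m2 : {measure set (T1 * T2) -> \bar R}) :
  (m1 setT < +oo)%E ->
  (forall A B, measurable A -> measurable B -> m1 (A `*` B) = m2 (A `*` B)) ->
  forall D, measurable D -> m1 D = m2 D.
Proof.
move=> m1T m12 D mD.
pose C : set (set (T1 * T2)) :=
  [set C | exists A, measurable A /\ exists B, measurable B /\ C = A `*` B].
apply: (measure_unique C (fun=> setT)) => //.
- rewrite measurable_prod_measurableType //; congr (<<s _ >>).
  rewrite predeqE => X; split => [[A mA [B mB <-]]|[A [mA [B [mB ->]]]]].
    by exists A; split => //; exists B.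
  by exists A => //; exists B.
- move=> /= _ _ [X1 [mX1 [X2 [mX2 ->]]]] [Y1 [mY1 [Y2 [mY2 ->]]]].
  rewrite -setXI; exists (X1 `&` Y1); split; first exact: measurableI.
  by exists (X2 `&` Y2); split => //; exact: measurableI.
- by move=> _; exists setT; split => //; exists setT; split => //; rewrite setXTT.
- by rewrite bigcup_const.
- by move=> _ [A [mA [B [mB ->]]]]; exact: m12.
Qed.

(** Both sides are finite measures in D, so rectangles determine them. In the uses E constrains the
    other coordinates, k is its probability and J the joint law of V. *)
Lemma probability_rect_extend d d1 d2 (T : measurableType d)
    (T1 : measurableType d1) (T2 : measurableType d2) (R : realType)
    (P : probability T R) (E : set T) (V : T -> T1 * T2) (k : R)
    (J : {measure set (T1 * T2) -> \bar R}) :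
  measurable E -> measurable_fun setT V -> 0 <= k ->
  (forall A B, measurable A -> measurable B ->
     P (E `&` V @^-1` (A `*` B)) = (k%:E * J (A `*` B))%E) ->
  forall D, measurable D -> P (E `&` V @^-1` D) = (k%:E * J D)%E.
Proof.
move=> mE mV k0 H D mD.
pose m1 : {measure set (T1 * T2) -> \bar R} :=
  measure_function_pushforward__canonical__measure_function_Measure (mrestr P mE) mV.
pose m2 : {measure set (T1 * T2) -> \bar R} := mscale (NngNum k0) J.
have := @measure_rect_unique _ _ _ _ R m1 m2.
rewrite /m1 /m2 /= /mscale /mrestr /pushforward /= => /(_ _ _ D mD).
move=> h; rewrite (setIC E) h//.
- apply: le_lt_trans (ltry 1); rewrite probability_le1//; apply: measurableI => //.
  by rewrite preimage_setT; exact: measurableT.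
- by move=> A B mA mB; rewrite setIC H.
Qed.

(** Independence and marginal laws in one product formula: taking A i to be the whole space discards
    coordinate i. The laws are plain set functions so that they may be given by a formula. *)
Definition indep_laws d (T : measurableType d) (R : realType) (P : probability T R)
    (I : finType) d' (U : measurableType d') (V : I -> T -> U)
    (mu : I -> set U -> \bar R) : Prop :=
  (forall i, measurable_fun setT (V i)) /\
  forall A : I -> set U, (forall i, measurable (A i)) ->
    P [set w | forall i, A i (V i w)] = (\prod_i mu i (A i))%E.

Lemma measurable_forall_fin d (T : measurableType d) (I : finType)
    (F : I -> set T) (Q : pred I) :
  (forall i, Q i -> measurable (F i)) -> measurable [set w | forall i, Q i -> F i w].
Proof.
move=> mF; rewrite (_ : [set w | _] = \bigcap_(i in [set i | Q i]) F i); last first.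
  by apply/seteqP; split => w h i /=; exact: h.
by apply: fin_bigcap_measurable => //; exact: finite_finset.
Qed.

Lemma normal_prob_opp (R : realType) (sigma : R) (A : set R) :
  measurable A -> sigma != 0 ->
  normal_prob 0 sigma [set x | A (- x)] = normal_prob 0 sigma A.
Proof.
move=> mA sigma0; rewrite /normal_prob.
have mA' : measurable [set x : R | A (- x)].
  by rewrite -[X in measurable X]setTI; exact: (measurable_funN (@measurable_id _ R setT)).
rewrite [LHS]integral_mkcond [RHS]integral_mkcond.
have := @ge0_integral_affine R (-1) 0 ((fun x => (normal_pdf 0 sigma x)%:E) \_ A).
rewrite oppr_eq0 oner_eq0 normrN1 invr1 mul1e => <- //.
- apply: eq_integral => x _; rewrite !patchE addr0 mulN1r.
  rewrite (_ : (x \in [set x0 | A (- x0)]) = (- x \in A)); last first.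
    by apply/idP/idP; rewrite !inE.
  by rewrite !normal_pdfE// /normal_fun !subr0 sqrrN.
- by apply/(measurable_restrictT _ mA)/measurable_EFinP/measurable_funTS; exact: measurable_normal_pdf.
- by move=> x; apply: erestrict_ge0 => z _; rewrite lee_fin normal_pdf_ge0.
Qed.

Definition rotate_family (R : realType) (T : Type) (I : eqType) (a b : I) (c s : R)
    (W : I -> T -> R) (k : I) (w : T) : R :=
  if k == a then c * W a w - s * W b w
  else if k == b then s * W a w + c * W b w else W k w.

(** For fixed constraints on the other coordinates, the law of (W a, W b) is a multiple of a product
    of two centred normal laws, which the rotation preserves. *)
Lemma indep_laws_rotate d (T : measurableType d) (R : realType)
    (P : probability T R) (I : finType) (W : I -> T -> measurableTypeR R)
    (mu : I -> probability (measurableTypeR R) R) (sigma c s : R) (a b : I) :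
  sigma != 0 -> c != 0 -> c ^+ 2 + s ^+ 2 = 1 -> a != b ->
  (forall A, mu a A = normal_prob 0 sigma A) ->
  (forall A, mu b A = normal_prob 0 sigma A) ->
  indep_laws P W mu ->
  indep_laws P (rotate_family a b c s W : I -> T -> measurableTypeR R) mu.
Proof.
move=> sigma0 c0 cs1 ab mua mub [mW iW]; split.
  move=> i; case: (eqVneq i a) => [->|ia].
    rewrite (_ : rotate_family _ _ _ _ _ _ = (fun w => c * W a w - s * W b w)).
      by apply: (@measurable_funB _ T R) => //; apply: measurable_funM => //; exact: mW.
    by apply/funext => w; rewrite /rotate_family eqxx.
  case: (eqVneq i b) => [->|ib].
    rewrite (_ : rotate_family _ _ _ _ _ _ = (fun w => s * W a w + c * W b w)).
      by apply: (@measurable_funD _ T R) => //; apply: measurable_funM => //; exact: mW.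
    by apply/funext => w; rewrite /rotate_family eqxx eq_sym (negPf ab).
  rewrite (_ : rotate_family _ _ _ _ _ _ = W i)//; apply/funext => w.
  by rewrite /rotate_family (negPf ia) (negPf ib).
move=> A mA.
pose V w := (W a w, W b w).
have mV : measurable_fun setT V by apply: measurable_fun_pair; exact: mW.
pose Q := [pred i | (i != a) && (i != b)].
pose E := [set w | forall i, Q i -> A i (W i w)].
have mE : measurable E.
  apply: measurable_forall_fin => i _.
  by rewrite -[X in measurable X]setTI; exact: mW.
pose D := [set v : R * R | A a (c * v.1 - s * v.2)%R /\ A b (s * v.1 + c * v.2)%R].
have mD : measurable D by apply: measurable_rotation_preimage; exact: mA.
have prodE (F : I -> \bar R) : (\prod_i F i = (\prod_(i | Q i) F i) * (F a * F b))%E.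
  rewrite (bigD1 a)//= (bigD1 b)/=; last by rewrite eq_sym.
  by rewrite muleA muleC; congr (_ * _)%E; apply: eq_bigl => i; rewrite /Q.
pose k := fine (\prod_(i | Q i) mu i (A i))%E.
have kE : k%:E = (\prod_(i | Q i) mu i (A i))%E.
  rewrite fineK// prode_fin_num// => i _; exact: fin_num_measure.
have k0 : 0 <= k by rewrite -lee_fin kE; apply: prode_ge0.
have -> : [set w | forall i, A i (rotate_family a b c s W i w)] = E `&` V @^-1` D.
  apply/seteqP; split => w /=.
    move=> h; split; last split.
    - move=> i /andP[/negPf ia /negPf ib]; have := h i.
      by rewrite /rotate_family ia ib.
    - by have := h a; rewrite /rotate_family eqxx.
    - by have := h b; rewrite /rotate_family eqxx eq_sym (negPf ab).
  move=> [h [ha hb]] i; rewrite /rotate_family; case: eqVneq => [->//|ia].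
  by case: eqVneq => [->//|ib]; apply: h; rewrite /Q/= ia ib.
rewrite prodE -kE mua mub -(@normal_prob_rotation R sigma c s)//; [|exact: mA|exact: mA].
apply: (@probability_rect_extend _ _ _ _ _ _ R P E V k (normal_prob 0 sigma \x normal_prob 0 sigma)%E) => //.
move=> A1 B1 mA1 mB1.
transitivity (k%:E * (normal_prob 0 sigma A1 * normal_prob 0 sigma B1))%E; last first.
  by congr (_ * _)%E; exact/esym/product_measure1E.
rewrite kE.
pose A' i := if i == a then A1 else if i == b then B1 else A i.
have mA' i : measurable (A' i) by rewrite /A'; case: ifP => // _; case: ifP.
have := iW A' mA'; rewrite prodE.
have -> : A' a = A1 by rewrite /A' eqxx.
have -> : A' b = B1 by rewrite /A' eqxx eq_sym (negPf ab).
rewrite mua mub.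
have -> : (\prod_(i | Q i) mu i (A' i) = \prod_(i | Q i) mu i (A i))%E.
  by apply: eq_bigr => i /andP[/negPf ia /negPf ib]; rewrite /A' ia ib.
move=> <-; congr (P _); apply/seteqP; split => w /=.
  move=> [h [h1 h2]] i; rewrite /A'; case: eqVneq => [->//|ia].
  by case: eqVneq => [->//|ib]; apply: h; rewrite /Q/= ia ib.
move=> h; split; last split.
- move=> i /andP[/negPf ia /negPf ib]; have := h i.
  by rewrite /A' ia ib.
- by have := h a; rewrite /A' eqxx.
- by have := h b; rewrite /A' eqxx eq_sym (negPf ab).
Qed.

(** Used twice: for two rows, which stay orthonormal, and for a row against the noise vector, whose
    linear form is unchanged when both are rotated. *)
Lemma big_rotate (R : comRingType) (I : finType) (a b : I) (c s : R) (u v : I -> R) :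
  a != b -> c ^+ 2 + s ^+ 2 = 1 ->
  let r w (i : I) := if i == a then c * w a - s * w b
             else if i == b then s * w a + c * w b else w i in
  \sum_i r u i * r v i = \sum_i u i * v i.
Proof.
move=> ab cs1 r; rewrite (bigD1 a)//= (bigD1 b)/=; last by rewrite eq_sym.
rewrite [RHS](bigD1 a)//= [in RHS](bigD1 b)/=; last by rewrite eq_sym.
rewrite !addrA; congr (_ + _); last first.
  by apply: eq_bigr => i /andP[/negPf ia /negPf ib]; rewrite /r ia ib.
rewrite /r !eqxx eq_sym (negPf ab).
transitivity ((c ^+ 2 + s ^+ 2) * (u a * v a + u b * v b)); first by ring.
by rewrite cs1 mul1r.
Qed.

Definition orthonormal_rows (R : ringType) (m n : nat) (U : 'M[R]_(m, n)) :=
  forall i k, \sum_j U i j * U k j = (i == k)%:R.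

Definition rotate_cols (R : ringType) (m n : nat) (a b : 'I_n) (c s : R)
    (U : 'M[R]_(m, n)) : 'M[R]_(m, n) :=
  \matrix_(i, j) if j == a then c * U i a - s * U i b
                 else if j == b then s * U i a + c * U i b else U i j.

Lemma rotate_cols_orthonormal (R : comRingType) (m n : nat) (a b : 'I_n) (c s : R)
    (U : 'M[R]_(m, n)) :
  a != b -> c ^+ 2 + s ^+ 2 = 1 -> orthonormal_rows U ->
  orthonormal_rows (rotate_cols a b c s U).
Proof.
move=> ab cs1 oU i k; rewrite -(oU i k) -(big_rotate (U i) (U k) ab cs1).
by apply: eq_bigr => j _; rewrite !mxE.
Qed.

Lemma indep_laws_signed_injection d (T : measurableType d) (R : realType)
    (P : probability T R) (I : finType) (m n : nat)
    (W : I + 'I_n -> T -> measurableTypeR R)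
    (mu : I -> probability (measurableTypeR R) R) (sigma : R)
    (f : 'I_m -> 'I_n) (u : 'I_m -> R) :
  sigma != 0 -> injective f -> (forall i, u i ^+ 2 = 1) ->
  indep_laws P W (sum_family mu (fun=> normal_prob 0 sigma)) ->
  indep_laws P (sum_family (fun i => W (inl i)) (fun i w => u i * W (inr (f i)) w)
                : I + 'I_m -> T -> measurableTypeR R)
    (sum_family mu (fun=> normal_prob 0 sigma)).
Proof.
move=> sigma0 finj u1 [mW iW]; split.
  move=> [i|i] /=; first exact: mW.
  by apply: (@measurable_funM _ T R) => //; exact: mW.
move=> A mA.
have u1' i : u i = 1 \/ u i = -1.
  by move/eqP: (u1 i); rewrite sqrf_eq1 => /orP[] /eqP; [left|right].
pose B i := [set x : R | A (inr i) (u i * x)].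
have mB i : measurable (B i).
  by rewrite -[X in measurable X]setTI; apply: (measurable_funM (@measurable_cst _ _ _ _ setT (u i)) (@measurable_id _ R setT)) => //; exact: mA.
have BE i : normal_prob 0 sigma (B i) = normal_prob 0 sigma (A (inr i)).
  rewrite /B; have [->|->] := u1' i.
    by congr (normal_prob 0 sigma _); apply/seteqP; split => x /=; rewrite mul1r.
  rewrite -(@normal_prob_opp R sigma (A (inr i)))//; last exact: mA.
  by congr (normal_prob 0 sigma _); apply/seteqP; split => x /=; rewrite mulN1r.
(* Noise coordinates outside the image of f are left free, so that they contribute the factor 1. *)
pose A' (k : I + 'I_n) : set R := match k with
  | inl i => A (inl i)
  | inr j => if [pick i | f i == j] is Some i then B i else setT end.
have mA' k : measurable (A' k).
  by case: k => [i|j] /=; [exact: mA|case: pickP => // i _; exact: mB].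
have A'f i : A' (inr (f i)) = B i.
  rewrite /A'; case: pickP => [k /eqP/finj ->//|/(_ i)]; by rewrite eqxx.
rewrite (_ : [set w | _] = [set w | forall k, A' k (W k w)]); last first.
  apply/seteqP; split => w /= h.
    move=> [i|j] /=; first exact: (h (inl i)).
    case: pickP => [i /eqP <-|//]; exact: (h (inr i)).
  move=> [i|i] /=; first exact: (h (inl i)).
  by have := h (inr (f i)); rewrite A'f.
rewrite (iW _ mA') !big_sumType/=; congr (_ * _)%E.
transitivity (\prod_(j in [set f i | i in [set: 'I_m]]%SET) normal_prob 0 sigma (A' (inr j)))%E.
  rewrite [RHS]big_mkcond/=; apply: eq_bigr => j _; case: ifPn => // jf.
  rewrite /A'; case: pickP => [i /eqP fij|_]; last exact: probability_setT.
  by move: jf; rewrite -fij imset_f.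
rewrite big_imset; last by move=> x y _ _; exact: finj.
rewrite big_mkcond; apply: eq_bigr => i _; rewrite finset.in_setT -BE.
by congr (normal_prob 0 sigma _); exact: A'f.
Qed.

Definition row_support (R : nzRingType) (m n : nat) (U : 'M[R]_(m, n)) (i : 'I_m) : {set 'I_n} :=
  [set j | U i j != 0]%SET.

Lemma orthonormal_row_support_gt0 (R : nzRingType) (m n : nat) (U : 'M[R]_(m, n)) i :
  orthonormal_rows U -> (0 < #|row_support U i|)%N.
Proof.
move=> oU; rewrite card_gt0; apply/negP => /eqP U0.
have := oU i i; rewrite big1 ?eqxx => [/eqP|j _].
  by rewrite eq_sym oner_eq0.
have : j \notin row_support U i by rewrite U0 finset.inE.
by rewrite finset.inE negbK => /eqP ->; rewrite mul0r.
Qed.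

(** A row with a single nonzero entry owns its column. Columns on which another row is nonzero
    therefore avoid it, and rotating them leaves it clean. *)
Lemma orthonormal_single_support (R : idomainType) (m n : nat) (U : 'M[R]_(m, n)) i k j :
  orthonormal_rows U -> #|row_support U i| = 1%N -> i != k ->
  U k j != 0 -> U i j = 0.
Proof.
move=> oU /eqP/cards1P[j0 Uij0] ik Ukj; apply/eqP/negPn/negP => Uij.
have : j \in row_support U i by rewrite finset.inE.
rewrite Uij0 finset.in_set1 => /eqP jj0.
have := oU i k; rewrite (negPf ik) (bigD1 j)//= big1 ?addr0.
  by move/eqP; rewrite mulf_eq0 (negPf Uij) (negPf Ukj).
move=> j' j'j; have : j' \notin row_support U i by rewrite Uij0 finset.in_set1 -jj0.
by rewrite finset.inE negbK => /eqP ->; rewrite mul0r.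
Qed.

(* Givens rotations of pairs of noise coordinates make all but one entry of each
   row of U vanish, row after row; they preserve the joint law of the noise, and
   a matrix with orthonormal rows of that form is a signed injection. *)
Lemma indep_laws_orthonormal d (T : measurableType d) (R : realType)
    (P : probability T R) (I : finType) (m n : nat)
    (b : I -> T -> measurableTypeR R) (e : 'I_n -> T -> measurableTypeR R)
    (mu : I -> probability (measurableTypeR R) R) (sigma : R) (U : 'M[R]_(m, n)) :
  sigma != 0 -> orthonormal_rows U ->
  indep_laws P (sum_family b e) (sum_family mu (fun=> normal_prob 0 sigma)) ->
  indep_laws P (sum_family b (fun i w => \sum_j U i j * e j w))
    (sum_family mu (fun=> normal_prob 0 sigma)).
Proof.
move=> sigma0.
pose unclean (V : 'M[R]_(m, n)) : {set 'I_m} := [set i | #|row_support V i| != 1%N]%SET.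
(* Double induction: on the number of rows with several nonzero entries, and within it on the
   support of one such row, which each rotation shortens. *)
have [k] := ubnP #|unclean U|; elim: k => // k IHk in U e *.
rewrite ltnS => Uk oU.
case: (set_0Vmem (unclean U)) => [U0|[i iU]].
  have UP i : {j | row_support U i = [set j]%SET}.
    apply: cid; apply/cards1P; have := finset.in_set0 i; rewrite -U0 finset.inE => /negbFE; exact.
  pose f i := sval (UP i).
  have Uf i j : j != f i -> U i j = 0.
    rewrite /f; case: (UP i) => j0 /= Ui jj0; apply/eqP; rewrite -[_ == _]negbK.
    have : j \notin row_support U i by rewrite Ui finset.in_set1.
    by rewrite finset.inE.
  have Uff i : U i (f i) ^+ 2 = 1.
    have := oU i i; rewrite (bigD1 (f i))//= big1 ?addr0 ?eqxx// => j jf.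
    by rewrite Uf// mul0r.
  have finj : injective f.
    move=> i k' fik; apply/eqP; rewrite -[_ == _]negbK; apply/negP => ik.
    have := oU i k'; rewrite (bigD1 (f i))//= big1 ?addr0 ?(negPf ik).
      move/eqP; rewrite mulf_eq0 -[U i _ == 0]sqrf_eq0 Uff fik -[U k' _ == 0]sqrf_eq0 Uff.
      by rewrite oner_eq0.
    by move=> j jf; rewrite Uf// mul0r.
  move=> /(indep_laws_signed_injection sigma0 finj Uff).
  congr (indep_laws P _ _); apply/funext => -[i|i] //=; apply/funext => w.
  rewrite [RHS](bigD1 (f i))//= [X in _ = _ + X]big1 ?addr0// => j jf.
  by rewrite Uf// mul0r.
have [l] := ubnP #|row_support U i|; elim: l => // l IHl in U e oU Uk iU *.
rewrite ltnS => Ul ind.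
have : (1 < #|row_support U i|)%N.
  have := orthonormal_row_support_gt0 i oU.
  by move: iU; rewrite finset.inE; case: #|_| => [|[]].
case/card_gt1P => a [c [aU cU ac]].
have Ua : U i a != 0 by move: aU; rewrite finset.inE.
have Uc : U i c != 0 by move: cU; rewrite finset.inE.
pose h := Num.sqrt (U i a ^+ 2 + U i c ^+ 2).
have h2 : h ^+ 2 = U i a ^+ 2 + U i c ^+ 2.
  by rewrite sqr_sqrtr// addr_ge0// sqr_ge0.
have h2n0 : U i a ^+ 2 + U i c ^+ 2 != 0.
  by rewrite paddr_eq0 ?sqr_ge0// !sqrf_eq0 negb_and Ua.
have h0 : h != 0 by rewrite -sqrf_eq0 h2.
(* The angle is chosen so that [S * U i a + C * U i c = 0], which kills entry c of row i. C is
   nonzero, as the rotation lemma requires, since a lies in the support. *)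
pose C := U i a / h; pose S := - U i c / h.
have C0 : C != 0 by rewrite mulf_neq0// invr_eq0.
have CS : C ^+ 2 + S ^+ 2 = 1.
  by rewrite /C /S !expr_div_n sqrrN -mulrDl h2 divff.
pose V := rotate_cols a c C S U.
have oV : orthonormal_rows V by exact: rotate_cols_orthonormal.
pose e' (j : 'I_n) w := if j == a then C * e a w - S * e c w
                  else if j == c then S * e a w + C * e c w else e j w.
have indV : indep_laws P (sum_family b (e' : _ -> _ -> measurableTypeR R)) (sum_family mu (fun=> normal_prob 0 sigma)).
  have := @indep_laws_rotate _ T R P _ _ _ sigma C S (inr a) (inr c) sigma0 C0 CS _ _ _ ind.
  move=> /(_ ac (fun=> erefl) (fun=> erefl)).
  congr (indep_laws P _ _); apply/funext => -[j|j]; apply/funext => w //=.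
suff : indep_laws P (sum_family b (fun i w => \sum_j V i j * e' j w))
    (sum_family mu (fun=> normal_prob 0 sigma)).
  congr (indep_laws P _ _); apply/funext => -[j|j] //=; apply/funext => w.
  rewrite -(big_rotate (U j) (e^~ w) ac CS); apply: eq_bigr => j' _.
  by rewrite mxE.
have cleanV r : r \notin unclean U -> row_support V r = row_support U r.
  rewrite finset.inE negbK => /eqP r1.
  have ri : r != i by apply: contraTneq iU => <-; rewrite finset.inE r1.
  have ra := orthonormal_single_support oU r1 ri Ua.
  have rc := orthonormal_single_support oU r1 ri Uc.
  apply/setP => j; rewrite !finset.inE mxE ra rc !mulr0 subr0 addr0.
  by case: (eqVneq j a) => [->|_]; rewrite ?ra//; case: (eqVneq j c) => [->|]; rewrite ?rc.
have uVU : unclean V \subset unclean U.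
  apply/fintype.subsetP => r; apply: contraTT => rU.
  by rewrite finset.inE (cleanV _ rU); move: rU; rewrite finset.inE.
have Vic : V i c = 0.
  by rewrite mxE eq_sym (negPf ac) eqxx /C /S; field.
have supV : row_support V i \subset row_support U i :\ c.
  apply/fintype.subsetP => j; rewrite !finset.inE => Vj; apply/andP; split.
    by apply: contraNneq Vj => ->; rewrite Vic.
  move: Vj; rewrite mxE; case: (eqVneq j a) => [->//|ja].
  by case: (eqVneq j c) => [->//|jc].
have cV : (#|row_support V i| < l)%N.
  apply: leq_trans Ul; rewrite (cardsD1 c (row_support U i)) cU add1n ltnS.
  exact: subset_leq_card.
case: (boolP (i \in unclean V)) => iV.
  by apply: IHl => //; apply: leq_trans Uk; exact: subset_leq_card.
apply: (IHk V e') => //; apply: leq_trans Uk; apply: proper_card; rewrite properE uVU.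
by apply/fintype.subsetPn; exists i.
Qed.

Lemma indep_laws_pairs d (T : measurableType d) (R : realType)
    (P : probability T R) (m : nat)
    (b e : 'I_m -> T -> measurableTypeR R)
    (mu g : 'I_m -> probability (measurableTypeR R) R) :
  indep_laws P (sum_family b e) (sum_family mu g) ->
  indep_laws P (fun i w => (b i w, e i w)) (fun i => mu i \x g i)%E.
Proof.
move=> [mbe ibe]; split=> [i|].
  by apply: measurable_fun_pair; [exact: (mbe (inl i))|exact: (mbe (inr i))].
(* The first k indices may carry arbitrary measurable sets, the later ones rectangles. Each step
   frees one more index, because rectangles determine the measure. *)
suff H k : (k <= m)%N -> forall D : 'I_m -> set (measurableTypeR R * measurableTypeR R),
    (forall i, measurable (D i)) ->
    (forall i : 'I_m, (k <= i)%N -> exists A B, [/\ measurable A, measurable B & D i = A `*` B]) ->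
    P [set w | forall i, D i (b i w, e i w)] = (\prod_i (mu i \x g i)%E (D i))%E.
  by move=> D mD; apply: (H m) => // i; rewrite leqNgt ltn_ord.
elim: k => [_ D mD rD|k IHk km D mD rD].
  have [A HA] := choice (fun i => rD i isT).
  have [B HB] := choice HA.
  rewrite (_ : [set w | _] = [set w | forall k, (sum_family A B) k (sum_family b e k w)]); last first.
    apply/seteqP; split => w /= h.
      by move=> [i|i] /=; have := h i; have [_ _ ->] := HB i => -[].
    by move=> i; have [_ _ ->] := HB i; split; [exact: (h (inl i))|exact: (h (inr i))].
  rewrite ibe; last by move=> [i|i] /=; have [? ?] := HB i.
  rewrite big_sumType/= -big_split/=; apply: eq_bigr => i _.
  by have [mA mB ->] := HB i; rewrite product_measure1E.
pose i0 := Ordinal km.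
pose E := [set w | forall i, i != i0 -> D i (b i w, e i w)].
have mV i : measurable_fun setT (fun w => (b i w, e i w)).
  by apply: measurable_fun_pair; [exact: (mbe (inl i))|exact: (mbe (inr i))].
have mE : measurable E.
  apply: (measurable_forall_fin (Q := fun i => i != i0)) => i _.
  by rewrite -[X in measurable X]setTI; exact: mV.
pose k' := fine (\prod_(i | i != i0) (mu i \x g i)%E (D i))%E.
have k'E : k'%:E = (\prod_(i | i != i0) (mu i \x g i)%E (D i))%E.
  rewrite fineK// prode_fin_num// => i _.
  rewrite ge0_fin_numE; last exact: (measure_ge0 (mu i \x g i)%E).
  apply: le_lt_trans (ltry 1); exact: (@probability_le1 _ _ _ (mu i \x g i)%E).
have k'0 : 0 <= k' by rewrite -lee_fin k'E; apply: prode_ge0 => i _; exact: (measure_ge0 (mu i \x g i)%E).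
have PE D0 : [set w | forall i, (if i == i0 then D0 else D i) (b i w, e i w)] =
    E `&` (fun w => (b i0 w, e i0 w)) @^-1` D0.
  apply/seteqP; split => w /=.
    move=> h; split; last by have := h i0; rewrite eqxx.
    by move=> i /negPf ii0; have := h i; rewrite ii0.
  by move=> [h1 h2] i; case: eqVneq => [->|ii0]//; exact: h1.
rewrite (_ : [set w | _] = E `&` (fun w => (b i0 w, e i0 w)) @^-1` (D i0)); last first.
  rewrite -PE; apply/seteqP; split => w /= h i; have := h i; case: eqVneq => [->|]//.
rewrite (bigD1 i0)//= muleC -k'E.
apply: (@probability_rect_extend _ _ _ _ _ _ R P E _ k' (mu i0 \x g i0)%E) => //.
move=> A B mA mB; rewrite -PE.
rewrite (IHk (ltnW km) (fun i => if i == i0 then A `*` B else D i)); last 2 first.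
- by move=> i; case: ifP => // _; exact: measurableX.
- move=> i; rewrite leq_eqVlt => /orP[/eqP ki|ki].
    by exists A, B; rewrite -val_eqE/= -ki eqxx.
  have -> : (i == i0) = false by apply/negbTE; rewrite -val_eqE/= gt_eqF.
  exact: rD.
rewrite (bigD1 i0)//= eqxx muleC k'E; congr (_ * _)%E.
by apply: eq_bigr => i /negPf ->.
Qed.

Lemma indep_laws_mutually_independent d (T : measurableType d) (R : realType)
    (P : probability T R) (I : finType) (n : nat)
    (b : I -> {RV P >-> R}) (e : 'I_n -> {RV P >-> R}) (sigma : R) :
  (forall j (A : set R), measurable A -> distribution P (e j) A = normal_prob 0 sigma A) ->
  mutually_independent (sum_family b e) ->
  indep_laws P (sum_family (fun i => b i : T -> measurableTypeR R) (fun j => e j : T -> measurableTypeR R))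
    (sum_family (fun i => distribution P (b i)) (fun=> normal_prob 0 sigma)).
Proof.
move=> elaw ind; split; first by move=> [i|j] /=; [exact: (measurable_funPT (b i))|exact: (measurable_funPT (e j))].
move=> A mA; have := ind [set: I + 'I_n]%SET A mA.
rewrite (_ : \bigcap_(i in _) _ = [set w | forall i, A i
  (sum_family (fun i => b i : T -> measurableTypeR R) (fun j => e j : T -> measurableTypeR R) i w)]); last first.
  apply/seteqP; split => w /= h.
    by move=> [i|j]; [apply: (h (inl i))|apply: (h (inr j))]; rewrite /= finset.in_setT.
  by move=> [i|j] _; [exact: (h (inl i))|exact: (h (inr j))].
move=> ->; apply: eq_big => [i|[i|j] _]; rewrite ?finset.in_setT//=.
exact: (elaw j _ (mA (inr j))).
Qed.

(** * Finite labels and the step-up number *)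

Section iid.
Variables (R : realFieldType) (I F : finType) (q : F -> R).
Hypotheses (q_ge0 : forall f, 0 <= q f) (q_sum1 : \sum_f q f = 1).
Implicit Types (x : {ffun I -> F}).

Definition iid_mean (h : {ffun I -> F} -> R) : R :=
  \sum_x h x * \prod_i q (x i).

Definition update_coord x (i : I) (f : F) : {ffun I -> F} :=
  [ffun k => if k == i then f else x k].

Lemma iid_meanD h1 h2 : iid_mean (fun x => h1 x + h2 x) = iid_mean h1 + iid_mean h2.
Proof. by rewrite /iid_mean -big_split; apply: eq_bigr => x _; rewrite mulrDl. Qed.

Lemma iid_meanZ a h : iid_mean (fun x => a * h x) = a * iid_mean h.
Proof. by rewrite /iid_mean mulr_sumr; apply: eq_bigr => x _; rewrite mulrA. Qed.

Lemma iid_mean_sum (J : Type) (r : seq J) (Q : pred J) (h : J -> {ffun I -> F} -> R) :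
  iid_mean (fun x => \sum_(j <- r | Q j) h j x) = \sum_(j <- r | Q j) iid_mean (h j).
Proof.
by rewrite /iid_mean exchange_big/=; apply: eq_bigr => x _; rewrite mulr_suml.
Qed.

Lemma ler_iid_mean h1 h2 : (forall x, h1 x <= h2 x) -> iid_mean h1 <= iid_mean h2.
Proof.
move=> h12; apply: ler_sum => x _; apply: ler_wpM2r => //.
by apply: prodr_ge0 => i _.
Qed.

Lemma iid_mean_prod (g : I -> F -> R) :
  iid_mean (fun x => \prod_i g i (x i)) = \prod_i \sum_f g i f * q f.
Proof.
rewrite /iid_mean bigA_distr_bigA/=; apply: eq_bigr => x _.
by rewrite big_split.
Qed.

Lemma iid_mean1 : iid_mean (fun=> 1) = 1.
Proof.
have := iid_mean_prod (fun _ _ => 1); rewrite [RHS]big1 => [h|i _].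
  by apply: etrans h; apply: eq_bigr => x _; congr (_ * _); rewrite big1.
by rewrite (eq_bigr q)// => f _; rewrite mul1r.
Qed.

Lemma iid_mean_coord i (phi : F -> R) h :
  (forall x f, h (update_coord x i f) = h x) ->
  iid_mean (fun x => phi (x i) * h x) = (\sum_f phi f * q f) * iid_mean h.
Proof.
move=> hi.
have [f0 _|F0] := pickP (@predT F); last first.
  by have := q_sum1; rewrite big_pred0// => /eqP; rewrite eq_sym oner_eq0.
(* A configuration is split into its value at i and a configuration y with the reference label f0 at
   i; as h ignores coordinate i, the sum factors. *)
have E phi' : iid_mean (fun x => phi' (x i) * h x) =
   (\sum_f phi' f * q f) * \sum_(y : {ffun I -> F} | y i == f0) h y * \prod_(j | j != i) q (y j).
  transitivity (\sum_(y : {ffun I -> F} | y i == f0) \sum_f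
      phi' f * q f * (h y * \prod_(j | j != i) q (y j))); last first.
    by rewrite exchange_big/= mulr_suml; apply: eq_bigr => f _; rewrite mulr_sumr.
  rewrite pair_big_dep/= (reindex (fun x => (update_coord x i f0, x i)))/=; last first.
    exists (fun v => update_coord v.1 i v.2) => [x _|[y f] /=].
      by apply/ffunP => k; rewrite !ffunE; case: eqP => [->|].
    rewrite inE/= andbT => /eqP yi; congr (_, _); last by rewrite ffunE eqxx.
    by apply/ffunP => k; rewrite !ffunE; case: eqP => [->|].
  apply: eq_big => [x|x _]; first by rewrite ffunE !eqxx.
  rewrite hi (bigD1 i)//= -!mulrA; congr (_ * _); rewrite mulrCA; congr (_ * (_ * _)).
  by apply: eq_bigr => j /negPf ji; rewrite ffunE ji.
rewrite E; congr (_ * _).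
(* The constant function 1 identifies the second factor with the mean of h. *)
have := E (fun=> 1).
under [in X in _ = X * _]eq_bigr do rewrite mul1r.
by rewrite q_sum1 mul1r => <-; congr iid_mean; apply/funext => x; rewrite mul1r.
Qed.

(** Given K = k the i-th label keeps its law, because K ignores coordinate i. A bound valid for each
    fixed k may therefore be used at the random K. *)
Lemma iid_mean_rule i (N : nat) (phi : F -> nat -> R) (B : nat -> R)
    (K : {ffun I -> F} -> nat) :
  (forall x f, K (update_coord x i f) = K x) -> (forall x, (0 < K x <= N)%N) ->
  (forall k, (0 < k <= N)%N -> \sum_f phi f k * q f <= B k) ->
  iid_mean (fun x => phi (x i) (K x)) <= iid_mean (fun x => B (K x)).
Proof.
move=> Ki KN phiB.
have E (psi : {ffun I -> F} -> nat -> R) :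
    iid_mean (fun x => psi x (K x)) = \sum_(k < N.+1 | (0 < k)%N) iid_mean (fun x => psi x k * (K x == k)%:R).
  rewrite -iid_mean_sum; congr iid_mean; apply/funext => x.
  have /andP[K0 Kx] := KN x.
  rewrite (bigD1 (Ordinal (Kx : (K x < N.+1)%N)))//= eqxx mulr1 big1 ?addr0// => k /andP[_ kK].
  by rewrite (_ : (K x == k) = false) ?mulr0//; apply: contraNF kK => /eqP Kk; apply/eqP/val_inj.
rewrite (E (fun x => phi (x i))) (E (fun _ => B)); apply: ler_sum => k k0.
rewrite (@iid_mean_coord i (phi^~ k) (fun x => (K x == k)%:R)); last by move=> x f; rewrite Ki.
rewrite iid_meanZ; apply: ler_wpM2r.
  by rewrite /iid_mean; apply: sumr_ge0 => x _; rewrite mulr_ge0// prodr_ge0.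
by apply: phiB; rewrite k0 -ltnS ltn_ord.
Qed.

Section stepup.
Variable hit : F -> nat -> bool.
Hypothesis hit_mono : forall f k k', (0 < k <= k')%N -> hit f k -> hit f k'.

(** Members of J count as hits whatever their labels, so everything built on this set is blind to
    the coordinates in J. *)
Definition hit_set (J : {set I}) x k : {set I} := (J :|: [set j | hit (x j) k])%SET.

(* For a selected i, the number of selected regressors is at most
   [stepup [set i]], and the latter does not depend on the i-th coordinate. *)
Definition stepup (J : {set I}) x : nat :=
  \max_(k < #|I|.+1 | (k <= #|hit_set J x k|)%N) k.

Lemma stepup_le_card J x : (stepup J x <= #|I|)%N.
Proof. by apply/bigmax_leqP => k _; rewrite -ltnS. Qed.

Lemma stepup_hit J x : (stepup J x <= #|hit_set J x (stepup J x)|)%N.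
Proof.
have [k kP kE] : {k : 'I_#|I|.+1 | (k <= #|hit_set J x k|)%N & stepup J x = k}.
  by apply: eq_bigmax_cond; apply/card_gt0P; exists ord0; rewrite unfold_in.
by rewrite {1}kE kE.
Qed.

Lemma stepup_max J x k : (k <= #|hit_set J x k|)%N -> (k <= stepup J x)%N.
Proof.
move=> h; have kI : (k < #|I|.+1)%N by rewrite ltnS (leq_trans h)// max_card.
exact: (@leq_bigmax_cond _ (fun k : 'I_#|I|.+1 => (k <= #|hit_set J x k|)%N) (fun k => k : nat) (Ordinal kI)).
Qed.

Lemma stepup_gt0 J x : J != finset.set0 -> (0 < stepup J x)%N.
Proof.
move=> J0; apply: stepup_max; rewrite card_gt0; apply: contraNneq J0 => h.
by rewrite -finset.subset0 -h finset.subsetUl.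
Qed.

Lemma stepup_subset (J J' : {set I}) x : J \subset J' -> (stepup J x <= stepup J' x)%N.
Proof.
move=> JJ'; apply: stepup_max; apply: leq_trans (stepup_hit J x) _.
by apply: subset_leq_card; apply: finset.setSU.
Qed.

Lemma stepup_upd (J : {set I}) x i f : i \in J -> stepup J (update_coord x i f) = stepup J x.
Proof.
move=> iJ; apply: eq_bigl => k.
rewrite (_ : hit_set J (update_coord x i f) k = hit_set J x k)//.
apply/setP => j; rewrite !finset.inE ffunE; case: eqVneq => [->|//].
by rewrite iJ.
Qed.

(* By downward induction on J: the number exceeds #|J| by the number of j
   outside J that are hit at the level [stepup J], hence also at the level
   [stepup (j |: J)], which is independent of the j-th coordinate. *)
Lemma stepup_mean (p alpha : R) :
  0 <= p -> 0 <= alpha <= 4^-1 ->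
  (forall k, (0 < k <= #|I|)%N ->
     \sum_f (hit f k)%:R * q f <= p + alpha * k%:R / #|I|%:R) ->
  forall J : {set I}, J != finset.set0 ->
  iid_mean (fun x => (stepup J x)%:R) <= 2 * (#|J|%:R + #|I|%:R * p).
Proof.
move=> p0 /andP[a0 a4] hitq J J0.
have [k] := ubnP (#|I| - #|J|); elim: k => // k IHk in J J0 *; rewrite ltnS => kJ.
have I0 : (0 < #|I|)%N.
  by move: J0; rewrite -card_gt0 => /leq_trans; apply; exact: max_card.
have I0R : 0 < #|I|%:R :> R by rewrite ltr0n.
have step j : j \notin J ->
    iid_mean (fun x => (hit (x j) (stepup (j |: J)%SET x))%:R) <=
    p + 2 * alpha * (#|J|%:R + 1 + #|I|%:R * p) / #|I|%:R.
  move=> jJ.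
  have jJ0 : (j |: J)%SET != finset.set0.
    by apply/negP => /eqP h; have := finset.in_set0 j; rewrite -h finset.setU11.
  apply: le_trans.
    apply: (@iid_mean_rule j #|I| (fun f k => (hit f k)%:R) (fun k => p + alpha * k%:R / #|I|%:R)
      (fun x => stepup (j |: J)%SET x)) => //.
    - by move=> x f; rewrite stepup_upd// finset.setU11.
    - by move=> x; rewrite stepup_gt0// stepup_le_card.
  rewrite (_ : (fun x => _) = (fun x => p * 1 + alpha / #|I|%:R * (stepup (j |: J)%SET x)%:R)); last first.
    by apply/funext => x; rewrite mulr1 mulrAC.
  rewrite iid_meanD !iid_meanZ iid_mean1 mulr1 lerD2l.
  have IH : iid_mean (fun x => (stepup (j |: J)%SET x)%:R) <= 2 * (#|J|%:R + 1 + #|I|%:R * p).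
    have -> : #|J|%:R + 1 = #|(j |: J)%SET|%:R :> R by rewrite cardsU1 jJ natrD addrC.
    apply: IHk => //; apply: leq_trans kJ; rewrite cardsU1 jJ add1n.
    have : (#|(j |: J)%SET| <= #|I|)%N by exact: max_card.
    by rewrite cardsU1 jJ add1n; lia.
  rewrite [leRHS](_ : _ = alpha / #|I|%:R * (2 * (#|J|%:R + 1 + #|I|%:R * p))); last by ring.
  by apply: ler_wpM2l => //; rewrite divr_ge0.
have main : iid_mean (fun x => (stepup J x)%:R) <=
    iid_mean (fun x => #|J|%:R * 1 + \sum_(j | j \notin J) (hit (x j) (stepup (j |: J)%SET x))%:R).
  apply: ler_iid_mean => x; rewrite mulr1 -natr_sum -natrD ler_nat.
  apply: leq_trans (stepup_hit J x) _.
  set H := ([set j | hit (x j) (stepup J x)] :\: J)%SET.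
  apply: (@leq_trans #|(J :|: H)%SET|).
    apply: subset_leq_card; apply/fintype.subsetP => j; rewrite !finset.inE.
    by case: (j \in J).
  apply: leq_trans (leq_card_setU _ _) _; rewrite leq_add2l -sum1_card big_mkcond [leqRHS]big_mkcond/=.
  apply: leq_sum => j _; rewrite !finset.inE; case: (j \in J) => //=.
  case: ifP => // h; rewrite (_ : hit _ _ = true)//.
  apply: hit_mono h; rewrite stepup_gt0//=; apply: stepup_subset.
  exact: finset.subsetUr.
apply: le_trans main _; rewrite iid_meanD iid_meanZ iid_mean1 mulr1 iid_mean_sum.
have J1 : 1 <= #|J|%:R :> R by rewrite ler1n card_gt0.
set X := #|J|%:R + 1 + #|I|%:R * p in step.
have mp0 : 0 <= #|I|%:R * p by rewrite mulr_ge0.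
have X0 : 0 <= X by rewrite !addr_ge0.
have : \sum_(j | j \notin J) iid_mean (fun x => (hit (x j) (stepup (j |: J)%SET x))%:R) <=
    #|I|%:R * (p + 2 * alpha * X / #|I|%:R).
  apply: (@le_trans _ _ (\sum_(j | j \notin J) (p + 2 * alpha * X / #|I|%:R))).
    by apply: ler_sum => j; exact: step.
  rewrite sumr_const -[leLHS]mulr_natl; apply: ler_wpM2r.
    by rewrite addr_ge0// divr_ge0// !mulr_ge0.
  by rewrite ler_nat max_card.
rewrite mulrDr [X in _ + X](_ : _ = 2 * alpha * X); last by field; rewrite gt_eqF.
(* Here alpha <= 1/4 closes the induction: the excess is at most X / 2, and its constant term 1/2 is
   absorbed because #|J| >= 1. *)
have : 2 * alpha * X <= 2 * 4^-1 * X by apply: ler_wpM2r => //; apply: ler_wpM2l.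
by rewrite /X => h1 h2; lra.
Qed.

End stepup.

(* Markov's inequality for 2^-N, N being the number of j <> i with B (x j). *)
Lemma iid_lower_tail i (B : pred F) (y : nat) :
  iid_mean (fun x => (#|[set j | (j != i) && B (x j)]%SET| < y)%N%:R) <=
  2 ^+ y * (1 - 2^-1 * \sum_(f | B f) q f) ^+ #|I|.-1.
Proof.
pose g j f : R := if (j != i) && B f then 2^-1 else 1.
apply: (@le_trans _ _ (iid_mean (fun x => 2 ^+ y * \prod_j g j (x j)))).
  apply: ler_iid_mean => x; rewrite /g -big_mkcond/=.
  rewrite prodr_const (_ : #|_| = #|[set j | (j != i) && B (x j)]%SET|); last first.
    by apply: eq_card => j; rewrite !finset.inE.
  set c := #|_|; case: ltnP => cy; last by rewrite mulr_ge0// exprn_ge0// invr_ge0.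
  rewrite -(subnK (ltnW cy)) exprD -mulrA -exprMn divff ?pnatr_eq0// expr1n mulr1.
  by rewrite exprn_ege1// ler1n.
rewrite iid_meanZ iid_mean_prod; apply: ler_wpM2l; first exact: exprn_ge0.
rewrite (bigD1 i)//= [X in X * _](_ : _ = 1) ?mul1r; last first.
  by rewrite -q_sum1; apply: eq_bigr => f _; rewrite /g eqxx mul1r.
rewrite (eq_bigr (fun=> 1 - 2^-1 * \sum_(f | B f) q f)); last first.
  move=> j ji.
  have qB : \sum_(f | ~~ B f) q f = 1 - \sum_(f | B f) q f.
    by rewrite -q_sum1 [X in _ = X - _](bigID B)/= addrAC subrr add0r.
  rewrite (bigID B)/= (eq_bigr (fun f => 2^-1 * q f)); last by move=> f Bf; rewrite /g ji Bf.
  rewrite -mulr_sumr [X in _ + X](eq_bigr q); last first.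
    by move=> f /negPf Bf; rewrite /g Bf andbF mul1r.
  by rewrite qB; field.
rewrite prodr_const (_ : #|_| = #|I|.-1)//.
by rewrite (cardC1 i).
Qed.

End iid.

(** * From random pairs to finite labels; the spike-and-slab law of a pair *)

Lemma indep_laws_label d (T : measurableType d) (R : realType)
    (P : probability T R) (I F : finType) d' (U : measurableType d')
    (V : I -> T -> U) (mu : I -> set U -> \bar R) (g : U -> F) (q : F -> R) :
  indep_laws P V mu -> (forall f, measurable (g @^-1` [set f])) ->
  (forall i f, mu i (g @^-1` [set f]) = (q f)%:E) ->
  forall Q : pred {ffun I -> F},
  measurable [set w | Q [ffun i => g (V i w)]] /\
  P [set w | Q [ffun i => g (V i w)]] = (iid_mean q (fun x => (Q x)%:R))%:E.
Proof.
move=> [mV iV] mg mug Q.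
have Ex (x : {ffun I -> F}) : [set w | [ffun i => g (V i w)] = x] =
    [set w | forall i, (g @^-1` [set x i]) (V i w)].
  apply/seteqP; split => w /= h; first by move=> i; rewrite -h ffunE.
  by apply/ffunP => i; rewrite ffunE h.
have mx x : measurable [set w | [ffun i => g (V i w)] = x].
  rewrite Ex; have := @measurable_forall_fin _ T I (fun i w => (g @^-1` [set x i]) (V i w)) xpredT.
  rewrite (_ : [set w | _] = [set w | forall i, (g @^-1` [set x i]) (V i w)]); last first.
    by apply/seteqP; split => w /= h i //; exact: h.
  apply=> i _; rewrite -[X in measurable X]setTI; apply: mV => //; exact: mg.
have Px x : P [set w | [ffun i => g (V i w)] = x] = (\prod_i q (x i))%:E.
  rewrite Ex (iV (fun i => g @^-1` [set x i]))//.
  rewrite -prodEFin; apply: eq_bigr => i _; exact: mug.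
pose r := [seq x <- enum {ffun I -> F} | Q x].
(* There are finitely many label vectors, so an event on labels is a finite disjoint union of
   product events. *)
have QE : [set w | Q [ffun i => g (V i w)]] =
    \bigcup_(x in [set` r]) [set w | [ffun i => g (V i w)] = x].
  apply/seteqP; split => w /=.
    by move=> Qw; exists [ffun i => g (V i w)] => //=; rewrite mem_filter Qw mem_enum.
  by move=> [x /=]; rewrite mem_filter => /andP[Qx _] ->.
rewrite QE; split; first by apply: fin_bigcup_measurable => // x _; exact: mx.
rewrite measure_fin_bigcup//; last by move=> x y _ _ [w [/= <- <-]].
have r_uniq : uniq r by rewrite filter_uniq// enum_uniq.
rewrite -(fsbig_seq _ _ r_uniq) big_filter big_enum_cond/=.
rewrite /iid_mean -sumEFin [RHS](bigID Q)/= [X in (_ + X)%E]big1 ?adde0; last first.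
  by move=> x /negPf ->; rewrite mul0r.
by apply: eq_bigr => x ->; rewrite mul1r; exact: Px.
Qed.

Lemma expectation_card d (T : measurableType d) (R : realType) (P : probability T R)
    (m : nat) (S : T -> {set 'I_m}) :
  (forall i, measurable [set w | i \in S w]) ->
  ('E_P[fun w => #|S w|%:R] = \sum_i P [set w | i \in S w])%E.
Proof.
move=> mS; rewrite unlock.
transitivity (\int[P]_w (\sum_i (\1_[set w | i \in S w] w)%:E))%E.
  apply: eq_integral => w _; rewrite sumEFin; congr EFin.
  rewrite -sum1_card natr_sum big_mkcond/=; apply: eq_bigr => i _.
  rewrite indicE; case: ifPn => h; first by rewrite mem_set.
  by rewrite memNset//; exact/negP.
rewrite ge0_integral_sum//; last first.
  by move=> i; apply/measurable_EFinP; exact: measurable_indic.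
by apply: eq_bigr => i _; rewrite integral_indic ?setIT.
Qed.

(** The law of a pair is a mixture of the noise law carried by the axis of zero coefficients and the
    law of a signal with independent noise. *)
Lemma slab_law_exists (R : realType) (p : R) (nu g : probability (measurableTypeR R) R) :
  0 <= p <= 1 ->
  exists J : {measure set (measurableTypeR R * measurableTypeR R) -> \bar R},
    forall D, measurable D ->
    J D = ((1 - p)%:E * g [set z | D (0%R, z)] + p%:E * (nu \x g) D)%E.
Proof.
move=> /andP[p0 p1]; have q0 : 0 <= 1 - p by rewrite subr_ge0.
have mz : measurable_fun setT (fun z : measurableTypeR R => (0 : measurableTypeR R, z)).
  exact: measurable_fun_pair.
exists (measure_add (mscale (NngNum q0) (measure_function_pushforward__canonical__measure_function_Measure g mz))
  (mscale (NngNum p0) (nu \x g)%E)) => D mD.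
exact: (measure_addE (mscale (NngNum q0) (measure_function_pushforward__canonical__measure_function_Measure g mz)) (mscale (NngNum p0) (nu \x g)%E) D).
Qed.

Lemma spike_slab_productE (R : realType) (p : R) (nu mu g : probability (measurableTypeR R) R)
   (J : {measure set (measurableTypeR R * measurableTypeR R) -> \bar R}) :
  0 <= p <= 1 -> (forall A, measurable A -> mu A = spike_slab p nu A) ->
  (forall D, measurable D ->
    J D = ((1 - p)%:E * g [set z | D (0%R, z)] + p%:E * (nu \x g) D)%E) ->
  forall D, measurable D -> (mu \x g)%E D = J D.
Proof.
move=> /andP[p0 p1] mus JE D mD.
apply: (@measure_rect_unique _ _ _ _ R (mu \x g)%E J) => //.
  by apply: le_lt_trans (ltry 1); exact: (@probability_le1 _ _ _ (mu \x g)%E).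
move=> A B mA mB; rewrite JE; last exact: measurableX.
transitivity (mu A * g B)%E; first exact: product_measure1E.
have -> : ((nu \x g) (A `*` B) = nu A * g B)%E by exact: product_measure1E.
rewrite mus// /spike_slab muleDl//; last first.
  exact: fin_num_measure.
rewrite -!muleA; congr (_ * _ + _)%E.
rewrite diracE; case: (boolP (0 \in A)) => /= A0.
  rewrite mul1e; congr (g _); apply/seteqP; split => z /=; first by split => //; exact: set_mem.
  by move=> [].
rewrite mul0e (_ : [set z | _] = set0) ?measure0//.
by apply/seteqP; split => z //= [/mem_set]; rewrite (negPf A0).
Qed.

Lemma indep_laws_eq d (T : measurableType d) (R : realType) (P : probability T R)
    (I : finType) d' (U : measurableType d') (V : I -> T -> U)
    (mu mu' : I -> set U -> \bar R) :
  (forall i A, measurable A -> mu i A = mu' i A) ->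
  indep_laws P V mu -> indep_laws P V mu'.
Proof.
by move=> mm [mV iV]; split => // A mA; rewrite iV//; apply: eq_bigr => i _; exact: mm.
Qed.

Lemma label_sum d (U : measurableType d) (R : realType) (J : {measure set U -> \bar R})
    (F : finType) (g : U -> F) :
  (J setT < +oo)%E ->
  (forall f, measurable (g @^-1` [set f])) ->
  forall Q : pred F, measurable [set v | Q (g v)] /\
    \sum_f (Q f)%:R * fine (J (g @^-1` [set f])) = fine (J [set v | Q (g v)]).
Proof.
move=> JT mg Q.
have Jfin A : measurable A -> J A \is a fin_num.
  move=> mA; rewrite ge0_fin_numE//; apply: le_lt_trans JT.
  by apply: le_measure; rewrite ?inE//; exact: measurableT.
pose r := [seq x <- enum F | Q x].
have QE : [set v | Q (g v)] = \bigcup_(f in [set` r]) (g @^-1` [set f]).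
  apply/seteqP; split => w /=.
    by move=> Qw; exists (g w) => //=; rewrite mem_filter Qw mem_enum.
  by move=> [x /=]; rewrite mem_filter => /andP[Qx _] ->.
rewrite QE; split; first by apply: fin_bigcup_measurable => // x _; exact: mg.
rewrite measure_fin_bigcup//; last by move=> x y _ _ [w [/= <- <-]].
have r_uniq : uniq r by rewrite filter_uniq// enum_uniq.
rewrite -(fsbig_seq _ _ r_uniq) big_filter big_enum_cond/=.
rewrite -sum_fine; last by move=> f _; exact: Jfin.
rewrite (bigID Q)/= [X in _ + X]big1 ?addr0; last first.
  by move=> x /negPf ->; rewrite mul0r.
by apply: eq_bigr => x ->; rewrite mul1r.
Qed.

(** * Error probabilities of a thresholding rule *)

Lemma mulnb_natr (R : pzSemiRingType) (b c : bool) : (b && c)%:R = b%:R * c%:R :> R.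
Proof. by case: b; case: c; rewrite ?mul0r ?mul1r. Qed.

Lemma measurable_bool_eq d (U : measurableType d) (B : U -> bool) (b : bool) :
  measurable [set v | B v] -> measurable [set v | B v = b].
Proof.
move=> mB; case: b => //; rewrite (_ : [set v | B v = false] = ~` [set v | B v]).
  exact: measurableC.
by apply/seteqP; split => v /=; [move=> ->|move/negP/negPf].
Qed.

(** Markov's inequality for the event N > K. *)
Lemma sum_mean_le (R : realFieldType) (I F : finType) (q : F -> R) (K : R)
    (N : {ffun I -> F} -> nat) :
  (forall f, 0 <= q f) -> \sum_f q f = 1 -> 0 < K ->
  1 - iid_mean q (fun x => (N x)%:R) / K <= iid_mean q (fun x => ((N x)%:R <= K)%R%:R).
Proof.
move=> q0 q1 K0; rewrite lerBlDr -[leLHS](iid_mean1 I q1).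
rewrite mulrC -iid_meanZ -iid_meanD; apply: ler_iid_mean => // x.
case: (lerP (N x)%:R K) => h /=; first by rewrite lerDl mulr_ge0// invr_ge0 ltW.
by rewrite add0r mulrC ler_pdivlMr// mul1r ltW.
Qed.

Lemma measurable_fst_preimage (R : realType) (A : set R) : measurable A ->
  measurable [set v : measurableTypeR R * measurableTypeR R | A v.1].
Proof.
move=> mA; rewrite -[X in measurable X]setTI.
exact: (@measurable_fst _ _ (measurableTypeR R) (measurableTypeR R) measurableT A mA).
Qed.

Lemma measurable_section0 (R : realType) (B : set (measurableTypeR R * measurableTypeR R)) :
  measurable B -> measurable [set z : measurableTypeR R | B (0%R, z)].
Proof.
move=> mB; rewrite -[X in measurable X]setTI.
exact: (@measurable_pair1 _ _ (measurableTypeR R) (measurableTypeR R) 0).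
Qed.

Section rule.
Variables (R : realType) (d : measure_display) (T : measurableType d)
  (P : probability T R) (m : nat)
  (V : 'I_m -> T -> measurableTypeR R * measurableTypeR R)
  (nu g : probability (measurableTypeR R) R) (p : R)
  (J : {measure set (measurableTypeR R * measurableTypeR R) -> \bar R})
  (stat : R * R -> R).
Local Notation U2 := (measurableTypeR R * measurableTypeR R)%type.
Hypotheses (p01 : 0 < p < 1) (nu0 : nu [set 0] = 0%E)
  (JE : forall D, measurable D ->
    J D = ((1 - p)%:E * g [set z | D (0%R, z)] + p%:E * (nu \x g) D)%E)
  (indepV : indep_laws P V (fun=> J))
  (mstat : measurable_fun [set: measurableTypeR R * measurableTypeR R] stat).

(* Throughout the section, V i = (beta_i, zeta_i), J is its law and g the law of
   the noise; [signal_prob D] is the conditional probability of D given that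
   beta_i is nonzero. *)
Definition signal_prob (D : set (measurableTypeR R * measurableTypeR R)) : R :=
  fine ((nu \x g)%E D).

Lemma signal_probE D : measurable D -> ((nu \x g) D)%E = (signal_prob D)%:E.
Proof.
move=> mD; rewrite fineK// ge0_fin_numE; last exact: (measure_ge0 (nu \x g)%E).
apply: le_lt_trans (ltry 1); exact: (@probability_le1 _ _ _ (nu \x g)%E).
Qed.

Lemma signal_prob_ge0 D : 0 <= signal_prob D.
Proof. by apply: fine_ge0; exact: (measure_ge0 (nu \x g)%E). Qed.

Lemma signal_prob_le1 D : measurable D -> signal_prob D <= 1.
Proof. by move=> mD; rewrite -lee_fin -signal_probE//; exact: (@probability_le1 _ _ _ (nu \x g)%E). Qed.

Lemma signal_probC D : measurable D -> signal_prob (~` D) = 1 - signal_prob D.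
Proof.
move=> mD; apply: EFin_inj; rewrite -signal_probE; last exact: measurableC.
have -> := @probability_setC _ _ _ (nu \x g)%E D mD.
by rewrite EFinB -signal_probE.
Qed.

Lemma le_signal_prob D D' : measurable D -> measurable D' -> D `<=` D' ->
  signal_prob D <= signal_prob D'.
Proof.
move=> mD mD' DD'; rewrite -lee_fin -!signal_probE//.
by apply: (@le_measure _ _ _ (nu \x g)%E); rewrite ?inE.
Qed.

Let p0 : 0 <= p. Proof. by case/andP: p01 => /ltW. Qed.
Let p1 : 0 <= 1 - p. Proof. by rewrite subr_ge0; case/andP: p01 => _ /ltW. Qed.

(** As nu has no atom at 0, the product of nu and g does not charge the axis of zero coefficients,
    which thus carries exactly the null part of J. *)
Lemma slab_null (D : set U2) : measurable D ->
  J (D `&` [set v | v.1 = 0]) = ((1 - p)%:E * g [set z | D (0%R, z)])%E.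
Proof.
move=> mD; have m0 := measurable_fst_preimage (measurable_set1 0).
rewrite JE; last exact: measurableI.
rewrite (_ : (nu \x g)%E _ = 0%E).
  rewrite mule0 adde0; congr (_ * g _)%E; apply/seteqP; split => z /=; first by case.
  by split.
apply/eqP; rewrite eq_le; apply/andP; split; last exact: (measure_ge0 (nu \x g)%E).
have <- : (nu \x g)%E ([set 0] `*` setT) = 0%E.
  transitivity (nu [set 0%R] * g setT)%E; last by rewrite nu0 mul0e.
  by apply: product_measure1E => //; exact: measurableT.
apply: (@le_measure _ _ _ (nu \x g)%E); rewrite ?inE.
- exact: measurableI.
- exact: measurableX.
- by move=> v /= [].
Qed.

Lemma slab_signal (D : set U2) : measurable D ->
  J (D `&` [set v | v.1 != 0]) = (p * signal_prob D)%:E.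
Proof.
move=> mD; have m0 : measurable [set v : measurableTypeR R * measurableTypeR R | v.1 != 0].
  by rewrite (_ : mkset _ = [set v | (~` [set 0]) v.1]); [exact: measurable_fst_preimage (measurableC _)|
    apply/seteqP; split => v /= /eqP].
have e : J D = (J (D `&` [set v | v.1 = 0%R]) + J (D `&` [set v | v.1 != 0%R]))%E.
  rewrite -measureU; [|exact: measurableI (measurable_fst_preimage (measurable_set1 0))|exact: measurableI|].
    congr (J _); rewrite -setIUr; apply/seteqP; split => v /=; last by case.
    by move=> Dv; split => //; case: (eqVneq v.1 0) => [->|]; [left|right].
  apply/seteqP; split => v //= [[_ ->]] []; by rewrite eqxx.
have fin : ((1 - p)%:E * g [set z | D (0%R, z)])%E \is a fin_num.
  by rewrite fin_numM// fin_num_measure//; exact: measurable_section0.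
move: e; rewrite slab_null// JE// => /eqP.
rewrite -[in X in X -> _](fineK fin) signal_probE// -EFinM.
rewrite addeC [X in _ == X]addeC.
case: (J _) => [r| |] //=; rewrite -!EFinD eqe => /eqP/addIr -> //.
Qed.

Lemma slab_law_setT : J setT = 1%E.
Proof.
have mT : measurable [set: U2] by exact: measurableT.
rewrite JE// -setXTT.
have -> : (nu \x g)%E ([set: measurableTypeR R] `*` [set: measurableTypeR R]) = 1%E.
  transitivity (nu setT * g setT)%E; first by apply: product_measure1E.
  by rewrite !probability_setT mule1.
rewrite (_ : [set z | _] = setT); last by apply/seteqP; split.
by rewrite probability_setT !mule1 -EFinD subrK.
Qed.

Let JT : (J setT < +oo)%E.
Proof. by rewrite slab_law_setT ltry. Qed.

Let Jfin D : measurable D -> J D \is a fin_num.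
Proof.
move=> mD; rewrite ge0_fin_numE//; apply: le_lt_trans JT.
by apply: le_measure; rewrite ?inE//; exact: measurableT.
Qed.

Lemma measurable_pairs_preimage i (D : set U2) : measurable D -> measurable (V i @^-1` D).
Proof.
by move=> mD; rewrite -[X in measurable X]setTI; apply: (indepV.1 i).
Qed.

Lemma pair_law i (D : set U2) : measurable D -> P (V i @^-1` D) = J D.
Proof.
move=> mD; pose A k := if k == i then D else setT.
have mA k : measurable (A k) by rewrite /A; case: ifP => // _; exact: measurableT.
have := indepV.2 A mA.
rewrite (bigD1 i)//= big1 ?mule1; last first.
  by move=> k /negPf ki; rewrite /A ki; exact: slab_law_setT.
rewrite /A eqxx => <-; congr (P _).
apply/seteqP; split => w /= h; last by have := h i; rewrite eqxx.
by move=> k; case: eqVneq => [->|].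
Qed.

Section labels.
Variables (F : finType) (lab : measurableTypeR R * measurableTypeR R -> F).
Hypothesis mlab : forall f, measurable (lab @^-1` [set f]).
Definition label_pmf f := fine (J (lab @^-1` [set f])).

Lemma label_pmf_ge0 f : 0 <= label_pmf f.
Proof. by apply: fine_ge0. Qed.

Lemma label_pmf_sum (Q : pred F) (D : set U2) : (forall v, Q (lab v) <-> D v) ->
  \sum_f (Q f)%:R * label_pmf f = fine (J D).
Proof.
move=> QD; have [_ ->] := label_sum JT mlab Q.
by congr (fine (J _)); apply/seteqP; split => v /QD.
Qed.

Lemma label_pmf_sum1 : \sum_f label_pmf f = 1.
Proof.
have := @label_pmf_sum predT setT (fun=> conj (fun=> Logic.I) (fun=> isT)).
rewrite slab_law_setT/= => h; apply: etrans h.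
by apply: eq_bigr => f _; rewrite mul1r.
Qed.

Lemma label_prob (Q : pred {ffun 'I_m -> F}) :
  measurable [set w | Q [ffun i => lab (V i w)]] /\
  fine (P [set w | Q [ffun i => lab (V i w)]]) = iid_mean label_pmf (fun x => (Q x)%:R).
Proof.
have [|mQ ->] := @indep_laws_label _ _ _ P _ F _ _ V _ lab label_pmf indepV mlab _ Q; last by [].
by move=> i f; rewrite fineK//; exact: Jfin.
Qed.

End labels.

(** * Rules whose threshold depends on the number of selected regressors *)

Variables (S : T -> {set 'I_m}) (lo up : nat -> R).
Hypotheses (mS : forall M, measurable [set w | S w = M])
  (S_in : forall w i, i \in S w -> lo #|S w| <= stat (V i w))
  (S_out : forall w i, i \notin S w -> stat (V i w) <= up #|S w|.+1).

Lemma measurable_in_selected i : measurable [set w | i \in S w].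
Proof.
rewrite (_ : [set w | _] = \bigcup_(M in [set M : {set 'I_m} | i \in M]) [set w | S w = M]).
  by apply: fin_bigcup_measurable => // M _; exact: mS.
apply/seteqP; split => w /=; first by move=> iS; exists (S w).
by move=> [M /= iM ->].
Qed.

Definition false_positive i := [set w | i \in S w] `&` [set w | (V i w).1 = 0].
Definition false_negative i := [set w | i \notin S w] `&` [set w | (V i w).1 != 0].

Let mnull i : measurable [set w | (V i w).1 = 0].
Proof. exact: (measurable_pairs_preimage i (measurable_fst_preimage (measurable_set1 0))). Qed.

Lemma measurable_false_positive i : measurable (false_positive i).
Proof. apply: measurableI => //; exact: measurable_in_selected. Qed.

Lemma measurable_false_negative i : measurable (false_negative i).
Proof.
apply: measurableI.
  rewrite (_ : mkset _ = ~` [set w | i \in S w]); last by apply/seteqP; split => w /= /negP.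
  by apply: measurableC; exact: measurable_in_selected.
rewrite (_ : mkset _ = ~` [set w | (V i w).1 = 0]); last by apply/seteqP; split => w /= /eqP.
by apply: measurableC.
Qed.

Let pr (A : set T) := fine (P A).

Let le_pr A B : measurable A -> measurable B -> A `<=` B -> pr A <= pr B.
Proof.
by move=> mA mB AB; rewrite fine_le ?fin_num_measure// le_measure ?inE.
Qed.

Let pr_setU A B : measurable A -> measurable B -> pr (A `|` B) <= pr A + pr B.
Proof.
move=> mA mB; rewrite /pr -fineD ?fin_num_measure//.
rewrite fine_le ?fin_numD ?fin_num_measure//; first exact: measurableU.
exact: measureU2.
Qed.

Let mstat_lt T0 : measurable [set v : U2 | stat v < T0].
Proof.
rewrite -[X in measurable X]setTI (_ : mkset _ = stat @^-1` `]-oo, T0[).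
  by apply: mstat => //; exact: measurableT.
by apply/seteqP; split => v; rewrite /= in_itv.
Qed.

Let mstat_le T0 : measurable [set v : U2 | stat v <= T0].
Proof.
rewrite -[X in measurable X]setTI (_ : mkset _ = stat @^-1` `]-oo, T0]).
  by apply: mstat => //; exact: measurableT.
by apply/seteqP; split => v; rewrite /= in_itv.
Qed.

Let mstat0_ge T0 : measurable [set v : U2 | T0 <= stat (0, v.2)].
Proof.
rewrite (_ : mkset _ = (fun v : U2 => (0 : measurableTypeR R, v.2) : U2) @^-1` (~` [set v : U2 | stat v < T0])); last first.
  by apply/seteqP; split => v /=; rewrite leNgt => /negP.
rewrite -[X in measurable X]setTI; apply: measurable_fun_pair => //; try exact: measurableT.
by apply: measurableC.
Qed.

Let mnz : measurable [set v : U2 | v.1 != 0].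
Proof.
by rewrite (_ : mkset _ = [set v : U2 | (~` [set 0]) v.1]); [exact: measurable_fst_preimage (measurableC _)|
  apply/seteqP; split => v /= /eqP].
Qed.

(** The threshold at size 1 is the largest. This crude bound is sharp when m p stays bounded, since
    that threshold is then still L up to lower order. *)
Lemma false_negative_le_up1 i :
  (forall k, (0 < k <= m)%N -> up k <= up 1%N) ->
  pr (false_negative i) <= p * signal_prob [set v | stat v <= up 1%N].
Proof.
move=> upm; have D := measurableI _ _ (mstat_le (up 1%N)) mnz.
rewrite -[leRHS]/(fine (p * _)%:E) -slab_signal// -(pair_law i)//.
apply: le_pr; [exact: measurable_false_negative|exact: measurable_pairs_preimage|].
move=> w [/= iS ib]; split => //=; apply: le_trans (S_out iS) _; apply: upm => /=.
rewrite -[X in (_ < X)%N](card_ord m) -cardsT; apply: proper_card.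
by rewrite finset.properT; apply: contraNneq iS => ->; rewrite finset.inE.
Qed.

Let mbool (B : U2 -> bool) b : measurable [set v | B v] -> measurable [set v | B v = b].
Proof. exact: measurable_bool_eq. Qed.

(* Up to an event of small probability the rule selects more than y regressors,
   since more than y other signals exceed even the largest threshold. *)
Lemma false_negative_le_dense i y T0 :
  (forall k, (0 < k <= m)%N -> up k <= up 1%N) ->
  (forall k, (y < k <= m)%N -> up k <= T0) ->
  pr (false_negative i) <= p * signal_prob [set v | stat v <= T0] +
    p * signal_prob [set v | stat v <= up 1%N] *
    (2 ^+ y * (1 - 2^-1 * (p * (1 - signal_prob [set v | stat v <= up 1%N]))) ^+ m.-1).
Proof.
move=> up1 upy.
pose lab (v : U2) := ((v.1 != 0) && (stat v <= up 1%N), (v.1 != 0) && (up 1%N < stat v)).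
have mgt : measurable [set v : U2 | up 1%N < stat v].
  rewrite (_ : mkset _ = ~` [set v : U2 | stat v <= up 1%N]); first exact: measurableC.
  by apply/seteqP; split => v /=; rewrite ltNge => /negP.
have mlab f : measurable (lab @^-1` [set f]).
  rewrite (_ : _ @^-1` _ = [set v | (v.1 != 0) && (stat v <= up 1%N) = f.1] `&`
      [set v | (v.1 != 0) && (up 1%N < stat v) = f.2]); last first.
    by case: f => f1 f2; rewrite /lab; apply/seteqP; split => v /= [-> ->].
  apply: measurableI; apply: mbool.
    rewrite (_ : mkset _ = [set v : U2 | v.1 != 0] `&` [set v | stat v <= up 1%N]).
      exact: measurableI.
    by apply/seteqP; split => v /= => [/andP[]//|[-> ->]].
  rewrite (_ : mkset _ = [set v : U2 | v.1 != 0] `&` [set v | up 1%N < stat v]).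
    exact: measurableI.
  by apply/seteqP; split => v /= => [/andP[]//|[-> ->]].
pose Q (x : {ffun 'I_m -> bool * bool}) :=
  (x i).1 && (#|[set j | (j != i) && (x j).2]%SET| < y)%N.
have [mQ PQ] := label_prob mlab Q.
have mD := measurableI _ _ (mstat_le T0) mnz.
apply: (@le_trans _ _ (pr ((V i @^-1` ([set v | stat v <= T0] `&` [set v | v.1 != 0])) `|`
    [set w | Q [ffun i => lab (V i w)]]))).
  apply: le_pr; [exact: measurable_false_negative|apply: measurableU => //; exact: measurable_pairs_preimage|].
  move=> w [/= iS ib].
  have Sm : (#|S w| < m)%N.
    rewrite -[X in (_ < X)%N](card_ord m) -cardsT; apply: proper_card.
    by rewrite finset.properT; apply: contraNneq iS => ->; rewrite finset.inE.
  (* Either the threshold at size [#|S w|.+1] is at most T0, or fewer than y regressors are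
     selected. In the latter case every signal above [up 1] is selected, so there are fewer than y
     of them. *)
  case: (leqP y #|S w|) => ySw; [left|right].
    by split => //=; apply: le_trans (S_out iS) _; apply: upy; rewrite ltnS ySw.
  rewrite /Q ffunE /lab /= ib (le_trans (S_out iS)) ?up1//=.
  apply: leq_ltn_trans ySw; apply: subset_leq_card; apply/fintype.subsetP => j.
  rewrite finset.inE ffunE /= => /andP[_ /andP[_]]; apply: contraTT => jS.
  by rewrite -leNgt (le_trans (S_out jS))// up1.
apply: le_trans (pr_setU _ mQ) _; first exact: measurable_pairs_preimage.
apply: lerD; first by rewrite /pr pair_law// slab_signal.
rewrite /pr PQ.
rewrite (_ : (fun x => _) = (fun x : {ffun 'I_m -> bool * bool} => (x i).1%:R *
    (#|[set j | (j != i) && (x j).2]%SET| < y)%N%:R)); last first.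
  by apply/funext => x; rewrite /Q mulnb_natr.
rewrite (@iid_mean_coord _ _ _ _ (label_pmf_sum1 mlab) i (fun f => f.1%:R)
   (fun x => (#|[set j | (j != i) && (x j).2]%SET| < y)%N%:R)); last first.
  move=> x f; congr (_ %:R); congr nat_of_bool; congr (_ < _)%N.
  apply: eq_card => j; rewrite !finset.inE ffunE.
  by case: eqVneq.
apply: ler_pM.
- by apply: sumr_ge0 => f _; rewrite mulr_ge0// label_pmf_ge0.
- by apply: sumr_ge0 => x _; rewrite mulr_ge0// prodr_ge0// => k _; rewrite label_pmf_ge0.
- have e1 := @label_pmf_sum _ _ mlab (fun f => f.1) ([set v | stat v <= up 1%N] `&` [set v | v.1 != 0]).
  rewrite e1 ?slab_signal// => v; rewrite /lab /=; split => [/andP[]//|[-> ->]//].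
apply: le_trans.
  exact: (@iid_lower_tail _ _ _ _ (label_pmf_ge0 lab) (label_pmf_sum1 mlab) i (fun f => f.2) y).
rewrite card_ord; apply: ler_wpM2l; first exact: exprn_ge0.
have -> : \sum_(f | f.2) label_pmf lab f = p * (1 - signal_prob [set v | stat v <= up 1%N]).
  have -> : 1 - signal_prob [set v | stat v <= up 1%N] = signal_prob [set v | up 1%N < stat v].
    rewrite -signal_probC//; congr signal_prob.
    by apply/seteqP; split => v /=; rewrite ltNge => /negP.
  have : p * signal_prob [set v | up 1%N < stat v] = fine (p * signal_prob [set v | up 1%N < stat v])%:E by [].
  rewrite -slab_signal// => ->.
  rewrite -(@label_pmf_sum _ _ mlab (fun f => f.2)); last first.
    by move=> v; rewrite /lab /=; split => [/andP[]//|[-> ->]//].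
  rewrite [RHS](bigID (fun f => f.2))/= [X in _ = _ + X]big1 ?addr0; last first.
    by move=> f /negPf ->; rewrite mul0r.
  by apply: eq_bigr => f ->; rewrite mul1r.
by [].
Qed.

(** * Decoupling by the step-up number *)

Section stepup_label.
Variables (T0 alpha : R).
Hypotheses (lo_mono : forall k k', (0 < k <= k')%N -> (k' <= m)%N -> lo k' <= lo k)
  (alpha4 : 0 <= alpha <= 4^-1)
  (tail : forall k, (0 < k <= m)%N ->
     (g [set z | (lo k <= stat (0, z))%R] <= (alpha * k%:R / m%:R)%:E)%E).

Let F : finType := (bool * bool * {ffun 'I_m.+1 -> bool})%type.

(** The second component serves the lower bound on false negatives. The third tests the noise alone
    against every threshold, which for a null regressor is its actual statistic. *)
Let lab (v : U2) : F := (v.1 != 0, stat v < T0, [ffun k : 'I_m.+1 => lo k <= stat (0, v.2)]).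

(** Asking for all later thresholds as well makes hits monotone in k for arbitrary labels. For the
    label of a pair this is the same as passing [lo k], because [lo] decreases. *)
Let hit0 (f : F) (k : nat) : bool := [forall k' : 'I_m.+1, (k <= k')%N ==> f.2 k'].
Let hit (f : F) (k : nat) : bool := f.1.1 || hit0 f k.

Let hit_mono f k k' : (0 < k <= k')%N -> hit f k -> hit f k'.
Proof.
move=> /andP[_ kk']; rewrite /hit; case: (f.1.1) => //=.
by move=> /forallP h; apply/forallP => j; apply/implyP => k'j; exact: (implyP (h j) (leq_trans kk' k'j)).
Qed.

Let hit0E v k : (0 < k <= m)%N -> hit0 (lab v) k = (lo k <= stat (0, v.2)).
Proof.
move=> /andP[k0 km]; apply/idP/idP.
  have km' : (k < m.+1)%N by rewrite ltnS.
  by move=> /forallP /(_ (Ordinal km')); rewrite ffunE leqnn.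
move=> h; apply/forallP => j; apply/implyP => kj; rewrite ffunE.
by apply: le_trans h; apply: lo_mono; rewrite ?k0// -ltnS.
Qed.

Let mlab f : measurable (lab @^-1` [set f]).
Proof.
rewrite (_ : _ @^-1` _ = [set v : U2 | (v.1 != 0) = f.1.1] `&` [set v | (stat v < T0) = f.1.2] `&`
   [set v | forall k : 'I_m.+1, predT k -> (lo k <= stat (0, v.2)) = f.2 k]); last first.
  apply/seteqP; split => v /=.
    by move=> <- /=; split => // k _; rewrite ffunE.
  case: f => -[f1 f2] f3 /= [[h1 h2] h3]; rewrite /lab h1 h2; congr (_, _).
  by apply/ffunP => k; rewrite ffunE h3.
apply: measurableI; first by apply: measurableI; apply: mbool.
apply: (@measurable_forall_fin _ _ _ (fun (k : 'I_m.+1) (v : U2) => (lo k <= stat (0, v.2)) = f.2 k)) => k _.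
by apply: mbool.
Qed.

Let q := label_pmf lab.
Let q0 : forall f, 0 <= q f := label_pmf_ge0 lab.
Let q1 : \sum_f q f = 1 := label_pmf_sum1 mlab.

Let null_tail k : (0 < k <= m)%N ->
  fine (J ([set v | lo k <= stat (0, v.2)] `&` [set v | v.1 = 0])) <= alpha * k%:R / m%:R.
Proof.
move=> km; rewrite slab_null// -lee_fin fineK; last first.
  by rewrite fin_numM// fin_num_measure//; exact: measurable_section0 (mstat0_ge _).
apply: le_trans (tail km); rewrite -[leRHS]mul1e; apply: lee_wpmul2r => //.
by rewrite lee_fin lerBlDr lerDl.
Qed.

Let hit_prob k : (0 < k <= m)%N -> \sum_f (hit f k)%:R * q f <= p + alpha * k%:R / m%:R.
Proof.
move=> km.
pose D1 := setT `&` [set v : U2 | v.1 != 0].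
pose D2 := [set v : U2 | lo k <= stat (0, v.2)] `&` [set v : U2 | v.1 = 0].
have mD1 : measurable D1 by apply: measurableI => //; exact: measurableT.
have mD2 : measurable D2 by apply: measurableI => //; exact: (measurable_fst_preimage (measurable_set1 0)).
have -> : \sum_f (hit f k)%:R * q f = fine (J (D1 `|` D2)).
  apply: label_pmf_sum => // v; rewrite /hit hit0E//= /D1 /D2; split => /=.
    by move: (eqVneq v.1 0) => [v0|v0] /=; [right|left].
  by move=> [[_ ->]//|[-> _]]; rewrite orbT.
have -> : fine (J (D1 `|` D2)) = fine (J D1) + fine (J D2).
  rewrite -fineD ?Jfin// -measureU//.
  by apply/seteqP; split => v //; rewrite /D1 /D2 /= => -[[_ /eqP vn0] [_ v0]].
apply: lerD; last exact: null_tail.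
rewrite slab_signal; last exact: measurableT.
by rewrite /= ler_piMr// signal_prob_le1//; exact: measurableT.
Qed.

Let R_ (i : 'I_m) (x : {ffun 'I_m -> F}) := stepup hit [set i]%SET x.

Let R_mean (i : 'I_m) : iid_mean q (fun x => (R_ i x)%:R) <= 2 * (1 + m%:R * p).
Proof.
have := @stepup_mean R 'I_m F q q0 q1 hit hit_mono p alpha p0 alpha4.
rewrite card_ord => /(_ hit_prob [set i]%SET); rewrite cards1; apply.
by apply/negP => /eqP h; have := finset.in_set0 i; rewrite -h finset.in_set1 eqxx.
Qed.

Let R_upd i x f : R_ i (update_coord x i f) = R_ i x.
Proof. by apply: stepup_upd; rewrite finset.in_set1. Qed.

Let R_bound i x : (0 < R_ i x <= m)%N.
Proof.
rewrite stepup_gt0//=; first by have := stepup_le_card hit [set i]%SET x; rewrite card_ord.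
by apply/negP => /eqP h; have := finset.in_set0 i; rewrite -h finset.in_set1 eqxx.
Qed.

(** At level [#|S w|] every selected regressor is a hit: the signals by definition, the nulls
    because they pass [lo #|S w|]. So [#|S w|] is admissible in the maximum. *)
Let size_le_R i w : i \in S w -> (0 < #|S w| <= R_ i [ffun j => lab (V j w)])%N.
Proof.
move=> iS; have S0 : (0 < #|S w|)%N by apply/card_gt0P; exists i.
rewrite S0 /=; apply: stepup_max; apply: subset_leq_card; apply/fintype.subsetP => j jS.
rewrite !finset.inE ffunE /hit hit0E; last first.
  by rewrite S0/= -[leqRHS]card_ord max_card.
rewrite /lab/=; case: (eqVneq (V j w).1 0) => [j0|]/=; rewrite ?orbT//.
by have := S_in jS; rewrite {1}(surjective_pairing (V j w)) j0 => ->; rewrite orbT.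
Qed.

Let lo_R i w : i \in S w -> lo (R_ i [ffun j => lab (V j w)]) <= stat (V i w).
Proof.
move=> iS; apply: le_trans (S_in iS); apply: lo_mono; first exact: size_le_R.
by have /andP[] := R_bound i [ffun j => lab (V j w)].
Qed.

(** A selected null passes the smaller threshold at its step-up number, which is independent of it.
    If that number is r this has probability at most alpha r / m, and the mean of r is at most 2 (1
    + m p). *)
Lemma false_positive_le i : pr (false_positive i) <= alpha / m%:R * (2 * (1 + m%:R * p)).
Proof.
pose phi (f : F) k := (~~ f.1.1 && hit0 f k)%:R : R.
pose Q (x : {ffun 'I_m -> F}) := ~~ (x i).1.1 && hit0 (x i) (R_ i x).
have [mQ PQ] := label_prob mlab Q.
apply: (@le_trans _ _ (pr [set w | Q [ffun j => lab (V j w)]])).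
  apply: le_pr => //; first exact: measurable_false_positive.
  move=> w [/= iS i0]; rewrite /Q ffunE hit0E; last exact: R_bound.
  rewrite /lab/= i0 eqxx/=; have := lo_R iS.
  by rewrite {1}(surjective_pairing (V i w)) i0.
rewrite /pr PQ; apply: le_trans.
  apply: (@iid_mean_rule _ _ _ q q0 q1 i m phi (fun k => alpha * k%:R / m%:R) (R_ i)) => //.
  move=> k km; apply: le_trans (null_tail km).
  rewrite /phi (@label_pmf_sum _ _ mlab (fun f : F => ~~ f.1.1 && hit0 f k)
    ([set v | lo k <= stat (0, v.2)] `&` [set v : U2 | v.1 = 0]))// => v.
  rewrite hit0E// /lab/= negbK; split => [/andP[/eqP ->]//|[-> ->]]; by rewrite eqxx.
rewrite (_ : (fun x => _) = (fun x : {ffun 'I_m -> F} => alpha / m%:R * (R_ i x)%:R)); last first.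
  by apply/funext => x; rewrite mulrAC.
rewrite iid_meanZ; apply: ler_wpM2l; last exact: R_mean.
by rewrite divr_ge0//; case/andP: alpha4.
Qed.

(** A signal below T0 is missed as soon as its step-up number is at most K. The two events are
    independent, and Markov's inequality bounds the second from below. *)
Lemma false_negative_ge i K : 0 < K ->
  (forall k, (0 < k <= m)%N -> k%:R <= K -> T0 <= lo k) ->
  p * signal_prob [set v | stat v < T0] * (1 - 2 * (1 + m%:R * p) / K) <= pr (false_negative i).
Proof.
move=> K0 loT.
pose Q (x : {ffun 'I_m -> F}) := ((x i).1.1 && (x i).1.2) && ((R_ i x)%:R <= K).
have [mQ PQ] := label_prob mlab Q.
apply: (@le_trans _ _ (pr [set w | Q [ffun j => lab (V j w)]])); last first.
  apply: le_pr => //; first exact: measurable_false_negative.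
  move=> w; rewrite /Q /= ffunE => /andP[/andP[ib iT] RK]; split => //=.
  apply/negP => /lo_R; apply/negP; rewrite -ltNge; apply: lt_le_trans iT _.
  by apply: loT => //; exact: R_bound.
rewrite /pr PQ (_ : (fun x => _) = (fun x : {ffun 'I_m -> F} => ((x i).1.1 && (x i).1.2)%:R * ((R_ i x)%:R <= K)%R%:R)); last first.
  by apply/funext => x; rewrite /Q mulnb_natr.
rewrite (@iid_mean_coord _ _ _ _ q1 i (fun f : F => (f.1.1 && f.1.2)%:R) (fun x : {ffun 'I_m -> F} => ((R_ i x)%:R <= K)%R%:R)); last first.
  by move=> x f; rewrite R_upd.
rewrite (@label_pmf_sum _ _ mlab (fun f : F => f.1.1 && f.1.2) ([set v | stat v < T0] `&` [set v | v.1 != 0])); last first.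
  by move=> v; rewrite /lab /=; split => [/andP[]//|[-> ->]].
rewrite slab_signal//; apply: ler_wpM2l; first by rewrite mulr_ge0// signal_prob_ge0.
apply: le_trans (sum_mean_le _ q0 q1 K0); by rewrite lerD2l lerN2 ler_pM2r ?invr_gt0.
Qed.

End stepup_label.

End rule.

(** * Least squares and penalties in the orthogonal design *)

Section least_squares.
Variables (R : realType) (n m : nat) (X : 'M[R]_(n, m.+1)).
Hypotheses (n0 : (0 < n)%N) (XX : X^T *m X = n%:R%:M).

Let nR : n%:R != 0 :> R. Proof. by rewrite pnatr_eq0 -lt0n. Qed.

Lemma least_squaresE (y : 'cV[R]_n) : least_squares X y = n%:R^-1 *: (X^T *m y).
Proof. by rewrite /least_squares XX invmx_scalar mul_scalar_mx. Qed.

Lemma least_squares_response (b : 'cV[R]_m.+1) (e : 'cV[R]_n) j :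
  least_squares X (X *m b + e) j ord0 = b j ord0 + n%:R^-1 * \sum_k X k j * e k ord0.
Proof.
rewrite least_squaresE mulmxDr mulmxA XX mul_scalar_mx scalerDr scalerA mulVf// scale1r.
rewrite !mxE; congr (_ + _ * _); apply: eq_bigr => k _; by rewrite mxE.
Qed.

Lemma sqnormE k (v : 'cV[R]_k) : sqnorm v = (v^T *m v) ord0 ord0.
Proof. by rewrite mxE; apply: eq_bigr => i _; rewrite mxE expr2. Qed.

Lemma sqnormB k (u v : 'cV[R]_k) :
  sqnorm (u - v) = sqnorm u - 2 * (u^T *m v) ord0 ord0 + sqnorm v.
Proof.
rewrite /sqnorm mxE mulr_sumr -sumrB -big_split; apply: eq_bigr => i _.
by rewrite [(u - v) i ord0]mxE [(- v) i ord0]mxE mxE /=; ring.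
Qed.

(** Pythagoras: the full least squares residual is orthogonal to the columns, and X multiplies
    squared norms by n. *)
Lemma sqnorm_residual (y : 'cV[R]_n) b : sqnorm (y - X *m b) =
  sqnorm y - n%:R * sqnorm (least_squares X y) + n%:R * sqnorm (b - least_squares X y).
Proof.
have Xy : X^T *m y = n%:R *: least_squares X y by rewrite least_squaresE scalerA divff// scale1r.
set h := least_squares X y in Xy *.
have yX : y^T *m X = n%:R *: h^T by rewrite -[X]trmxK -trmx_mul Xy linearZ.
have hb : (h^T *m b) ord0 ord0 = (b^T *m h) ord0 ord0.
  by rewrite !mxE; apply: eq_bigr => i _; rewrite !mxE mulrC.
have yXb : (y^T *m (X *m b)) ord0 ord0 = n%:R * (b^T *m h) ord0 ord0.
  by rewrite mulmxA yX -scalemxAl mxE hb.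
have XbXb : sqnorm (X *m b) = n%:R * sqnorm b.
  rewrite !sqnormE trmx_mul mulmxA -(mulmxA b^T X^T X) XX mul_mx_scalar -scalemxAl mxE//.
by rewrite !sqnormB yXb XbXb; ring.
Qed.

Lemma RSSE (y : 'cV[R]_n) (M : {set 'I_m}) : RSS X y M =
  sqnorm y - n%:R * sqnorm (least_squares X y)
  + n%:R * \sum_(i | i \notin M) least_squares X y (lift ord0 i) ord0 ^+ 2.
Proof.
set h := least_squares X y.
(* In an orthogonal design the best fit in M keeps the estimates of the full fit on M and sets the
   others to zero. *)
pose b : 'cV[R]_m.+1 := \col_j oapp (fun i => if i \in M then h j ord0 else 0) (h j ord0) (unlift ord0 j).
have E (c : 'cV[R]_m.+1) : sqnorm (c - h) = (c ord0 ord0 - h ord0 ord0) ^+ 2 +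
   \sum_(i < m) (c (lift ord0 i) ord0 - h (lift ord0 i) ord0) ^+ 2.
  by rewrite /sqnorm big_ord_recl !mxE; congr (_ + _); apply: eq_bigr => i _; rewrite !mxE.
have bM : model_coeffs M b by move=> i iM; rewrite mxE liftK/= (negPf iM).
have bE : sqnorm (b - h) = \sum_(i | i \notin M) h (lift ord0 i) ord0 ^+ 2.
  rewrite E mxE unlift_none/= subrr expr0n/= add0r [RHS]big_mkcond/=.
  by apply: eq_bigr => i _; rewrite mxE liftK/=; case: (i \in M) => /=;
    rewrite ?subrr ?expr0n// sub0r sqrrN.
have lb c : model_coeffs M c -> sqnorm (b - h) <= sqnorm (c - h).
  move=> cM; rewrite bE E -[leLHS]add0r lerD ?sqr_ge0// big_mkcond/=.
  by apply: ler_sum => i _; case: ifPn => iM; rewrite ?sqr_ge0// cM// sub0r sqrrN.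
rewrite /RSS -bE -sqnorm_residual; apply/eqP; rewrite eq_le; apply/andP; split.
  apply: ge_inf; last by exists b.
  exists 0 => _ [c _ <-]; by apply: sumr_ge0 => i _; exact: sqr_ge0.
apply: lb_le_inf; first by exists (sqnorm (y - X *m b)), b.
move=> _ [c cM <-]; rewrite !sqnorm_residual lerD2l ler_wpM2l//; exact: lb.
Qed.

Lemma RSS_setU1 (y : 'cV[R]_n) (M : {set 'I_m}) i : i \notin M ->
  RSS X y M = RSS X y (i |: M)%SET + n%:R * least_squares X y (lift ord0 i) ord0 ^+ 2.
Proof.
move=> iM; rewrite !RSSE -!addrA; congr (_ + (_ + _)); rewrite -mulrDr; congr (_ * _).
rewrite (bigD1 i)//= addrC; congr (_ + _); apply: eq_bigl => j.
by rewrite finset.in_setU1 negb_or andbC.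
Qed.

Section penalized.
Variables (sigma : R) (pen : nat -> R) (S : 'cV[R]_n -> {set 'I_m}).
Hypotheses (sigma0 : 0 < sigma)
  (minS : minimizes (fun y M => RSS X y M / sigma ^+ 2 + pen #|M|) S).

Lemma selected_stat_ge y i : i \in S y ->
  pen #|S y| - pen #|S y|.-1 <= n%:R * least_squares X y (lift ord0 i) ord0 ^+ 2 / sigma ^+ 2.
Proof.
move=> iS; have := minS y (S y :\ i)%SET.
rewrite (@RSS_setU1 y (S y :\ i)%SET i); last by rewrite finset.setD11.
rewrite finset.setD1K// (cardsD1 i (S y)) iS add1n/= mulrDl; lra.
Qed.

Lemma unselected_stat_le y i : i \notin S y ->
  n%:R * least_squares X y (lift ord0 i) ord0 ^+ 2 / sigma ^+ 2 <= pen #|S y|.+1 - pen #|S y|.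
Proof.
move=> iS; have := minS y (i |: S y)%SET.
rewrite (RSS_setU1 y iS) cardsU1 iS add1n mulrDl; lra.
Qed.

End penalized.

End least_squares.

(** * Increments of the three penalties *)

Section penalties.
Variable R : realType.
Implicit Types (n m k : nat) (d : R).

(* The threshold at which the penalties switch from k - 1 to k regressors. *)
Definition log_level n m k : R := ln (n%:R * m%:R ^+ 2 / k%:R ^+ 2).

Definition pen1 d n m k : R := k%:R * (ln (n%:R * m%:R ^+ 2) + d) - 2 * ln (k`!)%:R
  - \sum_(1 <= i < k.+1) ln (ln (n%:R * m%:R ^+ 2 / i%:R ^+ 2)).
Definition pen2 d n m k : R := k%:R * (ln (n%:R * m%:R ^+ 2) + d) - 2 * ln (k`!)%:R.
Definition pen3 d n m k : R := k%:R * (ln (n%:R * m%:R ^+ 2) + d) - 2 * k%:R * ln k%:R.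

Lemma mbic1E sigma d n m (X : 'M[R]_(n, m.+1)) y M :
  mbic1 sigma d X y M = RSS X y M / sigma ^+ 2 + pen1 d n m #|M|.
Proof. by rewrite /mbic1 /pen1 !addrA. Qed.

Lemma mbic2E sigma d n m (X : 'M[R]_(n, m.+1)) y M :
  mbic2 sigma d X y M = RSS X y M / sigma ^+ 2 + pen2 d n m #|M|.
Proof. by rewrite /mbic2 /pen2 !addrA. Qed.

Lemma mbic3E sigma d n m (X : 'M[R]_(n, m.+1)) y M :
  mbic3 sigma d X y M = RSS X y M / sigma ^+ 2 + pen3 d n m #|M|.
Proof. by rewrite /mbic3 /pen3 !addrA. Qed.

Lemma log_levelE n m k : (0 < n)%N -> (0 < m)%N -> (0 < k)%N ->
  log_level n m k = ln (n%:R * m%:R ^+ 2) - 2 * ln k%:R.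
Proof.
move=> n0 m0 k0; rewrite /log_level ln_div ?posrE ?mulr_gt0 ?exprn_gt0 ?ltr0n//.
by congr (_ - _); rewrite lnXn ?ltr0n// mulr_natl.
Qed.

Lemma ln_fact_S k : (0 < k)%N -> ln (k`!)%:R = ln k%:R + ln (k.-1`!)%:R :> R.
Proof.
case: k => // k _ /=; rewrite factS natrM lnM ?posrE ?ltr0n ?fact_gt0//.
Qed.

Lemma pen2_incr d n m k : (0 < n)%N -> (0 < m)%N -> (0 < k)%N ->
  pen2 d n m k - pen2 d n m k.-1 = log_level n m k + d.
Proof.
move=> n0 m0 k0; rewrite log_levelE// /pen2 ln_fact_S//; case: k k0 => // k _ /=.
by rewrite -natr1; ring.
Qed.

Lemma pen1_incr d n m k : (0 < n)%N -> (0 < m)%N -> (0 < k)%N ->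
  pen1 d n m k - pen1 d n m k.-1 = log_level n m k + d - ln (log_level n m k).
Proof.
move=> n0 m0 k0; rewrite -pen2_incr//; case: k k0 => // k _ /=.
rewrite /pen1 /pen2 [in LHS]big_nat_recr//= /log_level; ring.
Qed.

(** A discrete form of (x ln x)' = ln x + 1. It puts the increments of mBIC3 at most 2 below those
    of mBIC2 with the same constant. *)
Lemma xlnx_incr k : (0 < k)%N ->
  let x : R := k%:R in let y : R := k.-1%:R in
  ln x <= x * ln x - y * ln y <= ln x + 1.
Proof.
case: k => // -[|k] _ /=; cbv zeta; first by rewrite mul0r subr0 ln1 mulr0; apply/andP; split; lra.
set a : R := k.+1%:R; have a0 : 0 < a by rewrite ltr0n.
have -> : k.+2%:R = a + 1 :> R by rewrite -natr1.
have a1 : 0 < a + 1 by rewrite addr_gt0.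
have l1 : ln a <= ln (a + 1) by rewrite ler_ln ?posrE// lerDl.
have l2 : ln (a + 1) - ln a <= a^-1.
  rewrite -ln_div ?posrE//.
  have -> : (a + 1) / a = 1 + a^-1 by rewrite mulrDl divff ?gt_eqF// mul1r.
  by apply: le_ln1Dx; apply: lt_trans (_ : 0 < _); rewrite ?invr_gt0.
have l3 : a * (ln (a + 1) - ln a) <= 1.
  by rewrite -ler_pdivlMl// mulr1.
have l4 : 0 <= a * (ln (a + 1) - ln a) by rewrite mulr_ge0 ?subr_ge0// ltW.
by apply/andP; split; lra.
Qed.

Lemma pen3_incr d n m k : (0 < n)%N -> (0 < m)%N -> (0 < k)%N ->
  log_level n m k + d - 2 <= pen3 d n m k - pen3 d n m k.-1 <= log_level n m k + d.
Proof.
move=> n0 m0 k0; rewrite log_levelE//; have := xlnx_incr k0.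
rewrite /pen3; case: k k0 => // k _ /=; set u := _ * ln k.+1%:R; set v := k%:R * _ => h.
have -> : k.+1%:R * (ln (n%:R * m%:R ^+ 2) + d) - 2 * k.+1%:R * ln k.+1%:R -
  (k%:R * (ln (n%:R * m%:R ^+ 2) + d) - 2 * k%:R * ln k%:R) =
   (ln (n%:R * m%:R ^+ 2) + d) - 2 * (u - v) by rewrite /u /v -natr1; ring.
by move: h => /andP[? ?]; apply/andP; split; lra.
Qed.

(** At k = m the level is ln n, so all levels tend to infinity together. *)
Lemma log_level_ge n m k : (0 < n)%N -> (0 < k <= m)%N -> ln n%:R <= log_level n m k.
Proof.
move=> n0 /andP[k0 km]; have m0 := leq_trans k0 km; rewrite log_levelE//.
rewrite lnM ?posrE ?exprn_gt0 ?ltr0n// lnXn ?ltr0n// -addrA lerDl mulr_natl -mulrnBl.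
by rewrite mulrn_wge0// subr_ge0 ler_ln ?posrE ?ltr0n// ler_nat.
Qed.

Lemma le_log_level n m k k' : (0 < n)%N -> (0 < m)%N -> (0 < k <= k')%N ->
  log_level n m k' <= log_level n m k.
Proof.
move=> n0 m0 /andP[k0 kk']; have k'0 := leq_trans k0 kk'; rewrite !log_levelE//.
by rewrite lerD2l lerN2 ler_pM2l// ler_ln ?posrE ?ltr0n// ler_nat.
Qed.

(** The lower thresholds contain the level minus its logarithm; this makes them decrease in k. *)
Lemma le_x_sub_ln (x y : R) : 1 <= x -> x <= y -> x - ln x <= y - ln y.
Proof.
move=> x1 xy; have x0 : 0 < x by apply: lt_le_trans x1.
have y0 : 0 < y by apply: lt_le_trans xy.
have : ln y - ln x <= (y - x) / x.
  rewrite -ln_div ?posrE//; have -> : y / x = 1 + (y - x) / x.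
    by rewrite mulrBl divff ?gt_eqF// addrC subrK.
  apply: le_ln1Dx; apply: lt_le_trans (_ : 0 <= _); first by [].
  by rewrite divr_ge0 ?subr_ge0// ltW.
have : (y - x) / x <= y - x by rewrite ler_pdivrMr// ler_peMr// subr_ge0.
lra.
Qed.

End penalties.

(** * Gaussian tails and strips *)

(** Mills' ratio: after the shift by a the density is at most its value at a times exp(- lam x), lam
    = a / sigma^2, and is compared with the exponential density of rate lam. *)
Lemma normal_prob_upper_tail (R : realType) (sigma a : R) : 0 < sigma -> 0 < a ->
  (normal_prob 0 sigma `[a, +oo[ <= (normal_pdf 0 sigma a * (sigma ^+ 2 / a))%:E)%E.
Proof.
move=> s0 a0; have sn0 : sigma != 0 by rewrite gt_eqF.
pose lam := a / sigma ^+ 2; have lam0 : 0 < lam by rewrite divr_gt0// exprn_gt0.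
rewrite /normal_prob integral_mkcond.
rewrite -[leLHS]mul1e -[X in (X * _)%E](_ : `|1|^-1%:E = 1%E); last by rewrite normr1 invr1.
rewrite -(@ge0_integral_affine R 1 a); last 3 first.
- exact: oner_neq0.
- apply/(measurable_restrictT _ (measurable_itv _))/measurable_EFinP/measurable_funTS.
  exact: measurable_normal_pdf.
- by move=> x; apply: erestrict_ge0 => z _; rewrite lee_fin normal_pdf_ge0.
apply: (@le_trans _ _ (\int[lebesgue_measure]_x ((normal_pdf 0 sigma a * (sigma ^+ 2 / a))%:E *
   (exponential_pdf lam x)%:E))%E).
  apply: ge0_le_integral => //.
  - by move=> x _; apply: erestrict_ge0 => z _; rewrite lee_fin normal_pdf_ge0.
  - apply: measurableT_comp.
      apply/(measurable_restrictT _ (measurable_itv _))/measurable_EFinP/measurable_funTS.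
      exact: measurable_normal_pdf.
    by apply: measurable_funD => //; exact: measurable_funM.
  - by apply: measurable_funeM; apply/measurable_EFinP; exact: measurable_exponential_pdf.
  move=> x _; rewrite mul1r patchE; case: ifPn => [|_]; last first.
    apply: mule_ge0; rewrite lee_fin; last by rewrite exponential_pdf_ge0// ltW.
    by rewrite mulr_ge0 ?normal_pdf_ge0// divr_ge0 ?sqr_ge0 ?ltW.
  rewrite inE/= in_itv/= andbT lerDr => x0; rewrite -EFinM lee_fin exponential_pdfE//.
  rewrite !normal_pdfE// /normal_fun !subr0.
  set pk := normal_peak sigma; have pk0 : 0 <= pk by exact: normal_peak_ge0.
  set E1 := expR (- lam * x); set E2 := expR (- a ^+ 2 / _).
  rewrite [leRHS](_ : _ = pk * (E2 * E1)); last by rewrite /lam; field; rewrite sn0 gt_eqF.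
  rewrite ler_wpM2l// -expRD ler_expR.
  have -> : - a ^+ 2 / (sigma ^+ 2 *+ 2) + - lam * x =
     - (x + a) ^+ 2 / (sigma ^+ 2 *+ 2) + x ^+ 2 / (sigma ^+ 2 *+ 2).
    by rewrite /lam; field.
  by rewrite lerDl divr_ge0 ?mulrn_wge0 ?sqr_ge0.
rewrite ge0_integralZl//; last 3 first.
- by apply/measurable_EFinP; exact: measurable_exponential_pdf.
- by move=> x _; rewrite lee_fin exponential_pdf_ge0// ltW.
- by rewrite lee_fin mulr_ge0 ?normal_pdf_ge0 ?divr_ge0 ?ltW ?exprn_gt0.
by rewrite integral_exponential_pdf// mule1.
Qed.

(** Two one-sided tails at sigma sqrt x; the remaining constant 2 / sqrt(2 pi) is at most 1. *)
Lemma normal_prob_sq_tail (R : realType) (sigma x : R) : 0 < sigma -> 0 < x ->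
  (normal_prob 0 sigma [set z | (x <= z ^+ 2 / sigma ^+ 2)%R] <=
     (expR (- x / 2) / Num.sqrt x)%:E)%E.
Proof.
move=> s0 x0; have sn0 : sigma != 0 by rewrite gt_eqF.
pose a := sigma * Num.sqrt x; have a0 : 0 < a by rewrite mulr_gt0 ?sqrtr_gt0.
have a2 : a ^+ 2 = sigma ^+ 2 * x by rewrite exprMn sqr_sqrtr// ltW.
have mI : measurable (`[a, +oo[%classic : set R) by exact: measurable_itv.
have mN : measurable [set z : R | `[a, +oo[%classic (- z)].
  by rewrite -[X in measurable X]setTI; exact: (measurable_funN (@measurable_id _ R setT)).
have -> : [set z | x <= z ^+ 2 / sigma ^+ 2] = `[a, +oo[%classic `|` [set z : R | `[a, +oo[%classic (- z)].
  have e z : (x <= z ^+ 2 / sigma ^+ 2) = (a <= `|z|).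
    rewrite ler_pdivlMr ?exprn_gt0// mulrC -a2 -(real_normK (num_real z)).
    by rewrite ler_pXn2r ?nnegrE// ltW.
  by apply/seteqP; split => z /=; rewrite e !in_itv/= !andbT ler_normr => /orP.
apply: le_trans.
  by apply: measureU2.
apply: (@le_trans _ _ ((normal_pdf 0 sigma a * (sigma ^+ 2 / a))%:E + (normal_pdf 0 sigma a * (sigma ^+ 2 / a))%:E)%E).
  apply: leeD; first exact: normal_prob_upper_tail.
  by have h := normal_prob_upper_tail s0 a0; rewrite -(normal_prob_opp mI sn0) in h; exact: h.
rewrite -EFinD lee_fin normal_pdfE// /normal_fun subr0 a2.
have -> : - (sigma ^+ 2 * x) / (sigma ^+ 2 *+ 2) = - x / 2 by field.
have -> : normal_peak sigma = (sigma * Num.sqrt (pi *+ 2))^-1.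
  rewrite /normal_peak -mulrnAr sqrtrM ?sqr_ge0// sqrtr_sqr gtr0_norm//.
have pi2 : 2 <= Num.sqrt (pi *+ 2) :> R.
  have pi2 := @pi_ge2 R.
  rewrite -(@ler_pXn2r _ 2) ?nnegrE ?sqrtr_ge0// sqr_sqrtr; last by rewrite mulrn_wge0// (le_trans _ pi2).
  by rewrite expr2 -mulr_natr; lra.
have sx : 0 < Num.sqrt x by rewrite sqrtr_gt0.
set e := expR _; have e0 : 0 < e by exact: expR_gt0.
set S := Num.sqrt (pi *+ 2) in pi2 *; have S0 : 0 < S by apply: lt_le_trans pi2.
have -> : (sigma * S)^-1 * e * (sigma ^+ 2 / a) + (sigma * S)^-1 * e * (sigma ^+ 2 / a) =
   e / Num.sqrt x * (2 / S).
  by rewrite /a; field; rewrite !gt_eqF.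
have X0 : 0 <= e / Num.sqrt x by apply: divr_ge0; exact: ltW.
by rewrite ler_piMr// ler_pdivrMr// mul1r.
Qed.

(** * The density of nu near 0 *)

Section density.
Variables (R : realType) (nu : probability (measurableTypeR R) R).
Variables (e0 : R) (rho : R -> R).
Hypotheses (mrho : measurable_fun `[- e0, e0] rho)
 (nuE : forall A : set R, measurable A -> A `<=` `[- e0, e0] ->
          nu A = (\int[lebesgue_measure]_(x in A) (rho x)%:E)%E)
 (rho0 : forall x, x \in `[- e0, e0] -> 0 < rho x).

Lemma density_le (A : set R) (b : R) : measurable A -> A `<=` `[- e0, e0] -> 0 <= b ->
  (forall x, A x -> rho x <= b) -> (nu A <= b%:E * lebesgue_measure A)%E.
Proof.
move=> mA Ae b0 rb; rewrite nuE// -integral_cst//.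
apply: ge0_le_integral => //.
- by move=> x Ax; rewrite lee_fin ltW// rho0//; exact: Ae.
- by apply/measurable_EFinP; exact: measurable_funS mrho.
Qed.

Lemma density_ge (A : set R) (b : R) : measurable A -> A `<=` `[- e0, e0] -> 0 <= b ->
  (forall x, A x -> b <= rho x) -> (b%:E * lebesgue_measure A <= nu A)%E.
Proof.
move=> mA Ae b0 rb; rewrite nuE// -integral_cst//.
apply: ge0_le_integral => //.
- by apply/measurable_EFinP; exact: measurable_funS mrho.
Qed.

End density.

(** Later arguments use Assumption (C) through these bounds on measures: K bounds the density on the
    whole window, and l and r are its one-sided limits, approximated up to eta close to 0. *)
Lemma density_near (R : realType) (nu : probability (measurableTypeR R) R) :
  assumption_C nu ->
  exists (e0 K l r : R), [/\ 0 < e0, 0 < K, 0 < l /\ 0 < r,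
   (forall c s, 0 <= s -> `|c| + s <= e0 ->
     (nu [set x : R | `|x - c| < s]%R <= (2 * K * s)%:E)%E) /\
   (forall A : set R, measurable A -> A `<=` `[- e0, e0] -> (nu A <= K%:E * lebesgue_measure A)%E) /\
   (forall A : set R, measurable A -> A `<=` `[- e0, e0] -> forall f : R -> \bar R,
      measurable_fun setT f -> (forall x, (0 <= f x)%E) ->
      (\int[nu]_(x in A) f x <= K%:E * \int[lebesgue_measure]_(x in A) f x)%E) &
   forall eta : R, 0 < eta -> exists2 t0 : R, 0 < t0 <= e0 &
    (forall A : set R, measurable A -> A `<=` `]0, t0[ ->
      ((r - eta)%:E * lebesgue_measure A <= nu A)%E /\ (nu A <= (r + eta)%:E * lebesgue_measure A)%E) /\
    (forall A : set R, measurable A -> A `<=` `]- t0, 0[ ->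
      ((l - eta)%:E * lebesgue_measure A <= nu A)%E /\ (nu A <= (l + eta)%:E * lebesgue_measure A)%E)].
Proof.
move=> [e0 [rho [e00 mrho nuE [K rhoK] [l [r [l0 r0 rl rr]]]]]].
have rho0 x : x \in `[- e0, e0] -> 0 < rho x by move=> /rhoK/andP[].
have z0 : (0 : R) \in `[- e0, e0] by rewrite in_itv/= oppr_le0 ltW.
have K0 : 0 < K by have /andP[h1 h2] := rhoK _ z0; exact: lt_le_trans h2.
have leK (A : set R) : measurable A -> A `<=` `[- e0, e0] -> (nu A <= K%:E * lebesgue_measure A)%E.
  move=> mA Ae; apply: (density_le mrho nuE rho0) => //; first exact: ltW.
  by move=> x /Ae xe; have /andP[] := rhoK x xe.
exists e0, K, l, r; split => //.
- split; last split => //.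
    move=> c s s0 cs.
    have E : [set x : R | `|x - c| < s] = `]c - s, c + s[%classic.
      by apply/seteqP; split => x /=; rewrite in_itv/= ltr_distl.
    apply: le_trans (leK _ _ _) _.
    + by rewrite E; exact: measurable_itv.
    + rewrite E => x /=; rewrite !in_itv/= => /andP[h1 h2].
      have := ler_norm c; have := ler_norm (- c); rewrite normrN => h3 h4.
      by apply/andP; split; lra.
    rewrite E lebesgue_measure_itv/= lte_fin; case: ifPn => _; last first.
      by rewrite mule0 lee_fin mulr_ge0// mulr_ge0// ltW.
    by rewrite -EFinD -EFinM lee_fin; lra.
  move=> A mA Ae f mf f0.
  rewrite (@ge0_integral_density R nu A rho f)//; last 4 first.
  + exact: measurable_funS mrho.
  + by move=> x /Ae/rho0/ltW.
  + by move=> B mB BA; apply: nuE => //; exact: subset_trans Ae.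
  + exact: measurable_funTS.
  rewrite -ge0_integralZl//; last 2 first.
  + exact: measurable_funTS.
  + by rewrite lee_fin ltW.
  apply: ge0_le_integral => //.
  + by move=> x /Ae/rho0/ltW h; rewrite mule_ge0.
  + apply: emeasurable_funM; first exact: measurable_funTS.
    by apply/measurable_EFinP; exact: measurable_funS mrho.
  + by apply: measurable_funeM; exact: measurable_funTS.
  + by move=> x /Ae/rhoK/andP[_ h]; rewrite muleC lee_wpmul2r.
move=> eta eta0.
(* b stands for [r - eta] or [l - eta], which may be negative; the bound is then trivial. *)
have ge_any (A : set R) b : measurable A -> A `<=` `[- e0, e0] ->
    (forall x, A x -> b <= rho x) -> (b%:E * lebesgue_measure A <= nu A)%E.
  move=> mA Ae hb; have [b0|b0] := leP 0 b; first exact: (density_ge mrho nuE).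
  by apply: (@le_trans _ _ 0%E) => //; apply: mule_le0_ge0 => //; rewrite lee_fin ltW.
have [t1 t10 ht1] : exists2 t, 0 < t & forall x, 0 < x -> x < t -> `|r - rho x| < eta.
  have /cvgrPdist_lt/(_ eta eta0) := rr; case=> t /= t0 ht.
  exists t => // x x0 xt; apply: ht => //=; by rewrite sub0r normrN gtr0_norm.
have [t2 t20 ht2] : exists2 t, 0 < t & forall x, x < 0 -> - t < x -> `|l - rho x| < eta.
  have /cvgrPdist_lt/(_ eta eta0) := rl; case=> t /= t0 ht.
  exists t => // x x0 xt; apply: ht => //=; by rewrite sub0r normrN ltr0_norm// ltrNl.
pose t0 := Num.min e0 (Num.min t1 t2).
have [te [tt1 tt2]] : t0 <= e0 /\ t0 <= t1 /\ t0 <= t2 by rewrite /t0 !ge_min !lexx !orbT.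
have t00 : 0 < t0 by rewrite !lt_min e00 t10 t20.
exists t0; first by rewrite t00 te.
split => A mA At.
  have Ae : A `<=` `[- e0, e0].
    by move=> x /At; rewrite /= !in_itv/= => /andP[? ?]; apply/andP; split; lra.
  have hx x : A x -> r - eta <= rho x <= r + eta.
    move=> /At; rewrite /= in_itv/= => /andP[x0 xt].
    have := ht1 x x0 (lt_le_trans xt tt1); rewrite ltr_distl => /andP[? ?].
    by apply/andP; split; lra.
  split; first by apply: ge_any => // x /hx/andP[].
  apply: (density_le mrho nuE rho0) => //; first by rewrite addr_ge0 ?ltW.
  by move=> x /hx/andP[].
have Ae : A `<=` `[- e0, e0].
  by move=> x /At; rewrite /= !in_itv/= => /andP[? ?]; apply/andP; split; lra.
have hx x : A x -> l - eta <= rho x <= l + eta.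
  move=> /At; rewrite /= in_itv/= => /andP[xt x0].
  have xt' : - t2 < x by apply: le_lt_trans xt; rewrite lerN2.
  have := ht2 x x0 xt'; rewrite ltr_distl => /andP[? ?].
  by apply/andP; split; lra.
split; first by apply: ge_any => // x /hx/andP[].
apply: (density_le mrho nuE rho0) => //; first by rewrite addr_ge0 ?ltW.
by move=> x /hx/andP[].
Qed.

Lemma ball_prob_cvg (R : realType) (nu : probability (measurableTypeR R) R) :
  nu [set 0] = 0%E -> assumption_C nu ->
  exists kappa : R, 0 < kappa /\
    fine (nu [set x : R | `|x| < s]%R) / s @[s --> 0^'+] --> kappa.
Proof.
move=> nu0 /density_near [e0 [K [l [r [e00 K0 [l0 r0] _ H]]]]].
exists (l + r); split; first by rewrite addr_gt0.
apply/cvgrPdist_le => eps eps0.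
have eps20 : 0 < eps / 2 by rewrite divr_gt0.
have [t0 /andP[t00 te] [Hr Hl]] := H _ eps20.
exists t0 => //= s /=; rewrite sub0r normrN => st s0.
rewrite gtr0_norm// in st.
have E : [set x : R | `|x| < s] = `]-s, 0[%classic `|` ([set 0] `|` `]0, s[%classic).
  apply/seteqP; split => x /=; rewrite !in_itv/= ltr_norml.
    by case: (ltgtP x 0) => [x0|x0|->] /andP[? ?]; [left|right; right|right; left] => //; apply/andP.
  by move=> [/andP[? ?]|[->|/andP[? ?]]]; apply/andP; split; lra.
have mN : measurable (`]-s, 0[%classic : set R) by exact: measurable_itv.
have mP : measurable (`]0, s[%classic : set R) by exact: measurable_itv.
have nuS : nu [set x : R | (`|x| < s)%R] = (nu `](-s)%R, 0%R[%classic + nu `]0%R, s[%classic)%E.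
  rewrite E measureU//; last 2 first.
  - by apply: measurableU.
  - apply/seteqP; split => x //=; rewrite !in_itv/= => -[/andP[_ x0] [x00|/andP[x00 _]]].
      by rewrite x00 ltxx in x0.
    by have := lt_trans x0 x00; rewrite ltxx.
  congr (_ + _)%E; rewrite measureU//; last first.
    by apply/seteqP; split => x //=; rewrite in_itv/= => -[-> ]; rewrite ltxx.
  by rewrite -[RHS]add0e; congr (_ + _)%E; exact: nu0.
have [hr1 hr2] : ((r - eps / 2)%:E * lebesgue_measure (`]0%R, s[%classic : set R) <= nu `]0%R, s[%classic)%E /\
   (nu `]0%R, s[%classic <= (r + eps / 2)%:E * lebesgue_measure (`]0%R, s[%classic : set R))%E.
  by apply: Hr => // x /=; rewrite !in_itv/= => /andP[-> /lt_trans->].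
have [hl1 hl2] : ((l - eps / 2)%:E * lebesgue_measure (`](-s)%R, 0%R[%classic : set R) <= nu `](-s)%R, 0%R[%classic)%E /\
   (nu `](-s)%R, 0%R[%classic <= (l + eps / 2)%:E * lebesgue_measure (`](-s)%R, 0%R[%classic : set R))%E.
  apply: Hl => // x /=; rewrite !in_itv/= => /andP[? ->]; rewrite andbT; lra.
have f1 : nu `](-s)%R, 0%R[%classic \is a fin_num by exact: fin_num_measure.
have f2 : nu `]0%R, s[%classic \is a fin_num by exact: fin_num_measure.
rewrite nuS fineD//.
move: hr1 hr2 hl1 hl2; rewrite !lebesgue_measure_itv/= !lte_fin oppr_lt0 s0.
rewrite -(fineK f1) -(fineK f2) -!EFinD -!EFinM !lee_fin subr0 sub0r opprK => h1 h2 h3 h4 /=.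
set u := fine _ + fine _.
rewrite ler_distl; apply/andP; split.
  rewrite lerBlDr ler_pdivrMr//; rewrite /u; nra.
rewrite -lerBlDr ler_pdivlMr//; rewrite /u; nra.
Qed.

(** * The probability that a signal falls in a strip around 0 *)

Lemma measurable_ball_strip (R : realType) (a s : R) :
  measurable [set v : measurableTypeR R * measurableTypeR R | `|v.1 + a * v.2| < s].
Proof.
have mf : measurable_fun [set: measurableTypeR R * measurableTypeR R] (fun v => v.1 + a * v.2 : R).
  by apply: (@measurable_funD _ _ R) => //; apply: measurable_funM.
rewrite (_ : mkset _ = (fun v : measurableTypeR R * measurableTypeR R => v.1 + a * v.2 : R) @^-1` `]-s, s[).
  by rewrite -[X in measurable X]setTI; apply: mf => //; exact: measurableT.
by apply/seteqP; split => v; rewrite /= in_itv/= ltr_norml.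
Qed.

Lemma measurable_abs_ge (R : realType) (c : R) : measurable [set z : R | c <= `|z|].
Proof.
rewrite (_ : mkset _ = `[c, +oo[%classic `|` `]-oo, - c]%classic).
  by apply: measurableU; exact: measurable_itv.
by apply/seteqP; split => v; rewrite /= !in_itv/= andbT ler_normr lerNr => /orP.
Qed.

Lemma measurable_abs_lt (R : realType) (c : R) : measurable [set z : R | `|z| < c].
Proof.
rewrite (_ : mkset _ = ~` [set z : R | c <= `|z|]); first by apply: measurableC; exact: measurable_abs_ge.
by apply/seteqP; split => v /=; rewrite ltNge => /negP.
Qed.

Lemma product_prob_swapE (R : realType) (nu g : probability (measurableTypeR R) R)
   (D : set (measurableTypeR R * measurableTypeR R)) : measurable D ->
  (nu \x g)%E D = (\int[g]_z nu (ysection D z))%E.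
Proof.
move=> mD; apply: (@product_measure_unique _ _ _ _ R nu g (nu \x^ g)%E) => //.
by move=> A B mA mB; exact: product_measure2E.
Qed.

(* For moderate values of the noise z the strip is contained in a slightly wider
   strip around 0, for larger ones nu has a bounded density on the z-section,
   and for huge ones the tail of the noise suffices. *)
Lemma strip_prob_le (R : realType) (nu g : probability (measurableTypeR R) R)
    (a s e0 K theta : R) :
  0 < a -> 0 < s -> s <= e0 / 2 -> 0 <= K -> 0 <= theta ->
  (forall c s, 0 <= s -> `|c| + s <= e0 ->
     (nu [set x : R | `|x - c| < s]%R <= (2 * K * s)%:E)%E) ->
  fine ((nu \x g)%E [set v | `|v.1 + a * v.2| < s]%R) <=
   fine (nu [set x : R | `|x| < (1 + theta) * s]%R) +
   2 * K * s * fine (g [set z : R | theta * s / a <= `|z|]%R) +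
   fine (g [set z : R | e0 / (2 * a) <= `|z|]%R).
Proof.
move=> a0 s0 se K0 th0 nuK.
pose D1 : set (measurableTypeR R * measurableTypeR R) := [set x : R | `|x| < (1 + theta) * s] `*` setT.
pose D3 : set (measurableTypeR R * measurableTypeR R) := setT `*` [set z : R | e0 / (2 * a) <= `|z|].
pose B := [set z : R | theta * s / a <= `|z|] `\` [set z : R | e0 / (2 * a) <= `|z|].
pose D2 : set (measurableTypeR R * measurableTypeR R) :=
   [set v | `|v.1 + a * v.2| < s] `&` (setT `*` B).
have mB : measurable B by apply: measurableD; exact: measurable_abs_ge.
have mD1 : measurable D1 by apply: measurableX => //; exact: measurable_abs_lt.
have mD3 : measurable D3 by apply: measurableX => //; exact: measurable_abs_ge.
have mD2 : measurable D2.
  by apply: measurableI; [exact: measurable_ball_strip|exact: measurableX].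
have e1 : (nu \x g)%E D1 = nu [set x : R | (`|x| < (1 + theta) * s)%R].
  transitivity (nu [set x : R | (`|x| < (1 + theta) * s)%R] * g setT)%E.
    by apply: product_measure1E => //; exact: measurable_abs_lt.
  by rewrite probability_setT mule1.
have e3 : (nu \x g)%E D3 = g [set z : R | (e0 / (2 * a) <= `|z|)%R].
  transitivity (nu setT * g [set z : R | (e0 / (2 * a) <= `|z|)%R])%E.
    by apply: product_measure1E => //; exact: measurable_abs_ge.
  by rewrite probability_setT mul1e.
have e2 : ((nu \x g)%E D2 <= (2 * K * s)%:E * g [set z : R | (theta * s / a <= `|z|)%R])%E.
  rewrite product_prob_swapE//.
  apply: (@le_trans _ _ (\int[g]_z ((2 * K * s)%:E * (\1_[set z : R | (theta * s / a <= `|z|)%R] z)%:E))%E).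
    apply: ge0_le_integral => //.
    - exact: measurable_fun_ysection.
    - apply: measurable_funeM; apply/measurable_EFinP; apply: measurable_indic; exact: measurable_abs_ge.
    move=> z _; rewrite indicE.
    have [zB|zB] := pselect (B z); last first.
      rewrite (_ : ysection D2 z = set0) ?measure0.
        by rewrite mule_ge0// lee_fin mulr_ge0// ?mulr_ge0// ltW.
      by apply/seteqP; split => x //; rewrite /ysection /= inE => -[_ [_ /zB]].
    move: zB => [/= z1 /negP]; rewrite -ltNge => z2.
    rewrite mem_set//= mule1.
    (* The z-section of the strip is an interval of radius s around - a z. It lies in the window of
       the density because a |z| and s are both at most e0 / 2. *)
    apply: le_trans (nuK (- (a * z)) s (ltW s0) _).
      apply: le_measure; rewrite ?inE.
      + exact: measurable_ysection.
      + rewrite (_ : mkset _ = `]- (a * z) - s, - (a * z) + s[%classic); first exact: measurable_itv.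
        by apply/seteqP; split => x /=; rewrite in_itv/= ltr_distl.
      + by move=> x; rewrite /ysection /= inE => -[/= h _]; rewrite opprK.
    rewrite normrN normrM (gtr0_norm a0).
    have : a * `|z| <= e0 / 2.
      by move: z2; rewrite ltr_pdivlMr ?mulr_gt0//; lra.
    lra.
  have mi : measurable_fun setT (fun z : measurableTypeR R => (\1_[set z : R | (theta * s / a <= `|z|)%R] z : R)%:E).
    by apply/measurable_EFinP; apply: measurable_indic; exact: measurable_abs_ge.
  have k0 : (0 <= (2 * K * s)%:E)%E by rewrite lee_fin mulr_ge0// ?mulr_ge0// ltW.
  rewrite ge0_integralZl//.
  by rewrite integral_indic ?setIT//; exact: measurable_abs_ge.
have sub : [set v : measurableTypeR R * measurableTypeR R | `|v.1 + a * v.2| < s] `<=` (D1 `|` D2) `|` D3.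
  move=> v /= vs.
  have [h3|h3] := leP (e0 / (2 * a)) `|v.2|; first by right.
  have [h2|h2] := leP (theta * s / a) `|v.2|.
    by left; right; split => //=; split => //; split => //=; apply/negP; rewrite -ltNge.
  left; left; split => //=.
  have -> : v.1 = (v.1 + a * v.2) - a * v.2 by rewrite addrK.
  apply: le_lt_trans (ler_normB _ _) _; rewrite mulrDl mul1r ltr_leD//.
  by rewrite normrM (gtr0_norm a0) -ler_pdivlMl// mulrC ltW.
have mS := measurable_ball_strip a s.
have fin X : measurable X -> (nu \x g)%E X \is a fin_num.
  by move=> mX; rewrite (@signal_probE R nu g).
have := @le_measure _ _ _ (nu \x g)%E _ _ _ _ sub.
rewrite !inE => /(_ mS (measurableU _ _ (measurableU _ _ mD1 mD2) mD3)) h.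
have h' : ((nu \x g)%E [set v | (`|v.1 + a * v.2| < s)%R] <=
   nu [set x : R | (`|x| < (1 + theta) * s)%R] +
   (2 * K * s)%:E * g [set z : R | (theta * s / a <= `|z|)%R] + g [set z : R | (e0 / (2 * a) <= `|z|)%R])%E.
  have mD12 : measurable (D1 `|` D2) by exact: measurableU.
  have u1 : ((nu \x g)%E (D1 `|` D2 `|` D3) <= (nu \x g)%E (D1 `|` D2) + (nu \x g)%E D3)%E.
    exact: (@measureU2 _ _ _ (nu \x g)%E _ _ mD12 mD3).
  have u2 : ((nu \x g)%E (D1 `|` D2) <= (nu \x g)%E D1 + (nu \x g)%E D2)%E.
    exact: (@measureU2 _ _ _ (nu \x g)%E _ _ mD1 mD2).
  apply: le_trans h _; apply: le_trans u1 _; apply: leeD; last by rewrite -e3.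
  by apply: le_trans u2 _; apply: leeD => //; rewrite -e1.
have m1 := measurable_abs_ge (theta * s / a).
have m2 := measurable_abs_ge (e0 / (2 * a)).
have m3 := measurable_abs_lt ((1 + theta) * s).
have f1 : g [set z : R | (theta * s / a <= `|z|)%R] \is a fin_num by exact: fin_num_measure.
have f2 : g [set z : R | (e0 / (2 * a) <= `|z|)%R] \is a fin_num by exact: fin_num_measure.
have f3 : nu [set x : R | (`|x| < (1 + theta) * s)%R] \is a fin_num by exact: fin_num_measure.
by rewrite -lee_fin !EFinD EFinM !fineK//; exact: fin.
Qed.

(** If the noise moves the coefficient by less than theta s, a coefficient of modulus below (1 -
    theta) s stays in the strip; the two constraints are independent. *)
Lemma strip_prob_ge (R : realType) (nu g : probability (measurableTypeR R) R)
    (a s theta : R) :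
  0 < a -> 
  fine (nu [set x : R | `|x| < (1 - theta) * s]%R) *
    (1 - fine (g [set z : R | theta * s / a <= `|z|]%R)) <=
  fine ((nu \x g)%E [set v | `|v.1 + a * v.2| < s]%R).
Proof.
move=> a0.
pose D : set (measurableTypeR R * measurableTypeR R) :=
  [set x : R | `|x| < (1 - theta) * s] `*` ~` [set z : R | theta * s / a <= `|z|].
have mge := measurable_abs_ge (theta * s / a).
have mlt := measurable_abs_lt ((1 - theta) * s).
have mD : measurable D by apply: measurableX => //; exact: measurableC.
have E : (nu \x g)%E D = (nu [set x : R | (`|x| < (1 - theta) * s)%R] *
   (1 - g [set z : R | (theta * s / a <= `|z|)%R]))%E.
  rewrite -probability_setC//.
  by apply: product_measure1E => //; exact: measurableC.
have fg : g [set z : R | (theta * s / a <= `|z|)%R] \is a fin_num by exact: fin_num_measure.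
have fnu : nu [set x : R | (`|x| < (1 - theta) * s)%R] \is a fin_num by exact: fin_num_measure.
rewrite -[leLHS]/(fine (fine (nu [set x : R | `|x| < (1 - theta) * s]) *
    (1 - fine (g [set z : R | theta * s / a <= `|z|])))%:E).
rewrite EFinM EFinB !fineK// -E.
apply: (@le_signal_prob R nu g) => //; first exact: measurable_ball_strip.
move=> v /= [h1 /negP]; rewrite -ltNge => h2.
apply: le_lt_trans (ler_normD _ _) _.
rewrite normrM (gtr0_norm a0).
have : a * `|v.2| < theta * s by rewrite -ltr_pdivlMl// mulrC.
by move: h1; rewrite /=; lra.
Qed.

Lemma normal_prob_abs_tail (R : realType) (sigma c : R) : 0 < sigma -> sigma <= c ->
  fine (normal_prob 0 sigma [set z : R | c <= `|z|]) <= 2 * (sigma / c) ^+ 2.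
Proof.
move=> s0 sc; have c0 : 0 < c by apply: lt_le_trans sc.
pose x := (c / sigma) ^+ 2.
have x1 : 1 <= x by rewrite exprn_ege1// ler_pdivlMr// mul1r.
have x0 : 0 < x by apply: lt_le_trans x1.
have E : [set z : R | c <= `|z|] = [set z | x <= z ^+ 2 / sigma ^+ 2].
  apply/seteqP; split => z /=; rewrite /x expr_div_n ler_pM2r ?invr_gt0 ?exprn_gt0//;
    by rewrite -(real_normK (num_real z)) ler_pXn2r ?nnegrE// ltW.
have := normal_prob_sq_tail s0 x0; rewrite -E => h.
have fin : normal_prob 0 sigma [set z : R | c <= `|z|] \is a fin_num.
  by apply: fin_num_measure; exact: measurable_abs_ge.
apply: (@le_trans _ _ (expR (- x / 2) / Num.sqrt x)).
  by rewrite -lee_fin fineK.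
have sx : 1 <= Num.sqrt x by rewrite -[leLHS]sqrtr1 ler_wsqrtr.
apply: (@le_trans _ _ (expR (- x / 2))).
  by rewrite ler_pdivrMr ?(lt_le_trans ltr01)// ler_peMr// expR_ge0.
have -> : (sigma / c) ^+ 2 = x^-1 by rewrite /x -exprVn invf_div.
rewrite -[leLHS]invrK -expRN -[2 * _]invrK; rewrite lef_pV2 ?posrE ?expR_gt0 ?invr_gt0 ?mulr_gt0 ?invr_gt0//.
rewrite invfM invrK.
by have := expR_ge1Dx (- (- x / 2)); lra.
Qed.

Lemma cvg_at_right0_comp (R : realType) (f : R -> R) (k : R) (u : nat -> R) :
  f x @[x --> 0^'+] --> k -> u m @[m --> \oo] --> 0 -> (\forall m \near \oo, 0 < u m) ->
  f (u m) @[m --> \oo] --> k.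
Proof.
move=> fk u0 up; apply/cvgrPdist_le => e e0.
have /cvgrPdist_le/(_ e e0) [d /= d0 hd] := fk.
have /cvgrPdist_lt/(_ d d0) hu := u0.
near=> m; apply: hd; last by near: m.
by rewrite /=; near: m.
Unshelve. all: by end_near. Qed.

Lemma cvg_to_eq (R : realType) (u : nat -> R) (a b : R) :
  u m @[m --> \oo] --> a -> a = b -> u m @[m --> \oo] --> b.
Proof. by move=> h <-. Qed.

Lemma cvg_invr_sqrt (R : realType) (t : nat -> R) :
  t m @[m --> \oo] --> +oo -> (Num.sqrt (t m))^-1 @[m --> \oo] --> 0.
Proof.
move=> ty; apply/cvgrPdist_le => e e0.
move/cvgryPge : ty => ty.
near=> m.
rewrite sub0r normrN ger0_norm ?invr_ge0 ?sqrtr_ge0//.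
have h : e^-1 ^+ 2 <= t m by near: m; exact: ty.
rewrite -[leRHS]invrK lef_pV2 ?posrE ?invr_gt0 ?sqrtr_gt0//.
  have -> : e^-1 = Num.sqrt (e^-1 ^+ 2) by rewrite sqrtr_sqr gtr0_norm ?invr_gt0.
  exact: ler_wsqrtr.
by apply: lt_le_trans h; rewrite exprn_gt0// invr_gt0.
Unshelve. all: by end_near. Qed.

Lemma cvgVy0 (R : realType) (t : nat -> R) :
  t m @[m --> \oo] --> +oo -> (t m)^-1 @[m --> \oo] --> 0.
Proof.
move=> ty; apply/gtr0_cvgV0 => //.
by move/cvgryPgt : ty; apply.
Qed.

Lemma strip_prob_cvg (R : realType) (nu : probability (measurableTypeR R) R) (sigma kappa : R)
   (n : nat -> nat) (t : nat -> R) :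
  0 < sigma -> assumption_C nu ->
  fine (nu [set x : R | `|x| < s]%R) / s @[s --> 0^'+] --> kappa ->
  n m @[m --> \oo] --> \oo -> t m @[m --> \oo] --> +oo ->
  t m / Num.sqrt (n m)%:R @[m --> \oo] --> 0 ->
  fine ((nu \x normal_prob 0 sigma)%E
     [set v | `|v.1 + (Num.sqrt (n m)%:R)^-1 * v.2| < sigma * (t m / Num.sqrt (n m)%:R)]%R)
   / (sigma * (t m / Num.sqrt (n m)%:R)) @[m --> \oo] --> kappa.
Proof.
move=> s0 /density_near [e0 [K [_ [_ [e00 K0 _ [nuK _] _]]]]] kap ny ty tn.
pose a m : R := (Num.sqrt (n m)%:R)^-1.
pose s m := sigma * (t m / Num.sqrt (n m)%:R).
(* theta = t^(-1/2) tends to 0, so the ball bounds are sharp, yet theta s / a = sigma sqrt t tends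
   to infinity, so the noise rarely exceeds it. T1 bounds that tail, and T2 the tail of huge noise
   divided by s. *)
pose th m := (Num.sqrt (t m))^-1.
pose T1 m := 2 * (t m)^-1.
pose T2 m := 2 * (2 / e0) ^+ 2 * sigma * a m * (t m)^-1.
pose B x := fine (nu [set y : R | `|y| < x]%R) / x.
have th0 : th m @[m --> \oo] --> 0 by exact: cvg_invr_sqrt.
have s_0 : s m @[m --> \oo] --> 0.
  by apply: (cvg_to_eq (a := sigma * 0)); [apply: cvgM => //; exact: cvg_cst|rewrite mulr0].
have nyR : (n m)%:R @[m --> \oo] --> (+oo : set_system R) by apply/cvgrnyP.
have a_0 : a m @[m --> \oo] --> 0 by exact: cvg_invr_sqrt.
have n_gt0 : \forall m \near \oo, 0 < (n m)%:R :> R by move/cvgryPgt : nyR; apply.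
have t_ge4 : \forall m \near \oo, 4 <= t m by move/cvgryPge : ty; apply.
have th_half : \forall m \near \oo, th m < 2^-1.
  have /cvgrPdist_lt/(_ 2^-1) := th0; rewrite invr_gt0 => /(_ _)/= h.
  near=> m; have : `|0 - th m| < 2^-1 by near: m; exact: h.
  by rewrite sub0r normrN; apply: le_lt_trans; exact: ler_norm.
have s_small : \forall m \near \oo, s m < e0 / 2.
  have /cvgrPdist_lt/(_ (e0 / 2)) := s_0; rewrite divr_gt0// => /(_ isT) h.
  near=> m; have : `|0 - s m| < e0 / 2 by near: m; exact: h.
  by rewrite sub0r normrN; apply: le_lt_trans; exact: ler_norm.
have a_small : \forall m \near \oo, a m < e0 / (2 * sigma).
  have /cvgrPdist_lt/(_ (e0 / (2 * sigma))) := a_0; rewrite divr_gt0// ?mulr_gt0// => /(_ isT) h.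
  near=> m; have : `|0 - a m| < e0 / (2 * sigma) by near: m; exact: h.
  by rewrite sub0r normrN; apply: le_lt_trans; exact: ler_norm.
have s_gt0 : \forall m \near \oo, 0 < s m.
  near=> m; rewrite mulr_gt0// divr_gt0//; last by rewrite sqrtr_gt0; near: m.
  by apply: (@lt_le_trans _ _ 4) => //; near: m.
have T1_0 : T1 m @[m --> \oo] --> 0.
  by apply: (cvg_to_eq (a := 2 * 0)); [apply: cvgM; [exact: cvg_cst|exact: cvgVy0]|rewrite mulr0].
have T2_0 : T2 m @[m --> \oo] --> 0.
  apply: (cvg_to_eq (a := 2 * (2 / e0) ^+ 2 * sigma * 0 * 0)); last by rewrite mulr0.
  by apply: cvgM; [apply: cvgM => //; exact: cvg_cst|exact: cvgVy0].
have lowC : B ((1 - th m) * s m) * (1 - th m) * (1 - T1 m) @[m --> \oo] --> kappa.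
  apply: (cvg_to_eq (a := kappa * (1 - 0) * (1 - 0))); last by rewrite subr0 !mulr1.
  apply: cvgM; last by apply: cvgB => //; exact: cvg_cst.
  apply: cvgM; last by apply: cvgB => //; exact: cvg_cst.
  apply: (cvg_at_right0_comp kap).
    apply: (cvg_to_eq (a := (1 - 0) * 0)); last by rewrite mulr0.
    apply: cvgM => //.
    by apply: cvgB => //; exact: cvg_cst.
  near=> m; rewrite mulr_gt0//; last by near: m.
  rewrite subr_gt0; apply: (@lt_trans _ _ 2^-1); last by rewrite invf_lt1// ltr1n.
  by near: m.
have upC : B ((1 + th m) * s m) * (1 + th m) + 2 * K * T1 m + T2 m @[m --> \oo] --> kappa.
  apply: (cvg_to_eq (a := kappa * (1 + 0) + 2 * K * 0 + 0)); last by rewrite !addr0 mulr0 mulr1 addr0.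
  apply: cvgD => //; apply: cvgD; last by apply: cvgM => //; exact: cvg_cst.
  apply: cvgM; last by apply: cvgD => //; exact: cvg_cst.
  apply: (cvg_at_right0_comp kap).
    apply: (cvg_to_eq (a := (1 + 0) * 0)); last by rewrite mulr0.
    apply: cvgM => //.
    by apply: cvgD => //; exact: cvg_cst.
  near=> m; rewrite mulr_gt0//; last by near: m.
  by rewrite addr_gt0// invr_gt0 sqrtr_gt0; apply: (@lt_le_trans _ _ 4) => //; near: m.
apply: (squeeze_cvgr _ lowC upC).
near=> m.
have n0 : 0 < (n m)%:R :> R by near: m.
have t4 : 4 <= t m by near: m.
have t0 : 0 < t m by apply: lt_le_trans t4.
have sm0 : 0 < s m by near: m.
have sme : s m < e0 / 2 by near: m.
have thm : th m < 2^-1 by near: m.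
have am : a m < e0 / (2 * sigma) by near: m.
have sn0 : 0 < Num.sqrt (n m)%:R :> R by rewrite sqrtr_gt0.
have am0 : 0 < a m by rewrite invr_gt0.
have st0 : 0 < Num.sqrt (t m) by rewrite sqrtr_gt0.
have thm0 : 0 < th m by rewrite invr_gt0.
have ths : th m * s m / a m = sigma * Num.sqrt (t m).
  have tq : t m = Num.sqrt (t m) ^+ 2 by rewrite sqr_sqrtr ?ltW.
  rewrite /th /s /a invrK; move: tq st0; set q := Num.sqrt (t m) => tq q0; rewrite tq; field.
  by rewrite !gt_eqF.
pose g1 := fine (normal_prob 0 sigma [set z : R | th m * s m / a m <= `|z|]).
pose g2 := fine (normal_prob 0 sigma [set z : R | e0 / (2 * a m) <= `|z|]).
have g1T : g1 <= T1 m.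
  apply: le_trans (normal_prob_abs_tail s0 _) _; rewrite ths.
    have q1 : 1 <= Num.sqrt (t m) by rewrite -(@sqrtr1 R) ler_wsqrtr//; lra.
    by rewrite -{1}(mulr1 sigma) ler_wpM2l// ltW.
  have tq : t m = Num.sqrt (t m) ^+ 2 by rewrite sqr_sqrtr ?ltW.
  rewrite /T1 le_eqVlt; apply/orP; left; apply/eqP.
  move: tq st0; set q := Num.sqrt (t m) => tq q0; rewrite tq; field.
  by rewrite !gt_eqF.
have g2T : g2 / s m <= T2 m.
  rewrite ler_pdivrMr//; apply: le_trans (normal_prob_abs_tail s0 _) _.
    move: am; rewrite ltr_pdivlMr ?mulr_gt0// => am.
    by rewrite ler_pdivlMr ?mulr_gt0//; lra.
  rewrite le_eqVlt; apply/orP; left; apply/eqP.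
  rewrite /T2 /s /a; field.
  by rewrite !gt_eqF.
rewrite -/(a m) -/(s m); apply/andP; split.
  rewrite ler_pdivlMr//.
  apply: le_trans (strip_prob_ge nu (normal_prob 0 sigma) (s m) (th m) am0).
  rewrite /B.
  have h1 : 0 < (1 - th m) * s m by rewrite mulr_gt0// subr_gt0; lra.
  rewrite [leLHS](_ : _ = fine (nu [set x : R | `|x| < (1 - th m) * s m]%R) * (1 - T1 m)); last first.
    by field; move: h1; rewrite pmulr_lgt0// => h1; rewrite !gt_eqF.
  by rewrite ler_wpM2l ?fine_ge0// lerD2l lerN2.
rewrite ler_pdivrMr//.
have nuK' : forall c s, 0 <= s -> `|c| + s <= e0 -> (nu [set x : R | `|x - c| < s]%R <= (2 * K * s)%:E)%E.
  by move=> c' s'; exact: nuK.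
have := strip_prob_le (normal_prob 0 sigma) am0 sm0 (ltW sme) (ltW K0) (ltW thm0) nuK'.
move/le_trans; apply.
rewrite -/g1 -/g2 !mulrDl; apply: lerD; last by rewrite -ler_pdivrMr.
apply: lerD.
  rewrite /B le_eqVlt; apply/orP; left; apply/eqP; field.
  by rewrite lt0r_neq0// addr_gt0// mulr_gt0.
have KsT : K * s m * g1 <= K * s m * T1 m by rewrite ler_wpM2l// ltW// mulr_gt0.
by lra.
Unshelve. all: by end_near. Qed.

(** * Asymptotics of the thresholds *)

Lemma ln_le_linear (R : realType) (e x : R) : 0 < e -> 0 < x -> ln x <= e * x - ln e.
Proof.
move=> e0 x0; rewrite lerBrDl -lnM ?posrE//.
have ex0 := mulr_gt0 e0 x0.
have : ln (1 + (e * x - 1)) <= e * x - 1 by apply: le_ln1Dx; lra.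
rewrite subrKC; lra.
Qed.

Lemma cvg_sqrt0 (R : realType) (u : nat -> R) :
  u m @[m --> \oo] --> 0 -> Num.sqrt (u m) @[m --> \oo] --> 0.
Proof.
move=> u0; apply/cvgrPdist_le => e e0.
move/cvgrPdist_le : u0 => /(_ (e ^+ 2)); rewrite exprn_gt0// => /(_ isT) h.
near=> m; have : `|0 - u m| <= e ^+ 2 by near: m; exact: h.
rewrite !sub0r !normrN (ger0_norm (sqrtr_ge0 _)) => um.
rewrite -(ger0_norm (ltW e0)) -(sqrtr_sqr e) ler_wsqrtr//.
by apply: le_trans um; exact: ler_norm.
Unshelve. all: by end_near. Qed.

(** At the pair (beta_i, zeta_i) this is n bhat_i^2 / sigma^2, the drop of RSS / sigma^2 when
    regressor i enters. *)
Definition stat (R : realType) (sigma : R) (n : nat) (v : R * R) : R :=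
  n%:R * (v.1 + (Num.sqrt n%:R)^-1 * v.2) ^+ 2 / sigma ^+ 2.

Lemma measurable_stat (R : realType) (sigma : R) n :
  measurable_fun [set: measurableTypeR R * measurableTypeR R] (stat sigma n).
Proof.
apply: measurable_funM => //; apply: measurable_funM => //.
apply: measurable_funX.
by apply: (@measurable_funD _ _ R) => //; apply: measurable_funM.
Qed.

Lemma stat_ltE (R : realType) (sigma : R) n (v : R * R) (x : R) : 0 < sigma -> (0 < n)%N -> 0 <= x ->
  (stat sigma n v < x ^+ 2) = (`|v.1 + (Num.sqrt n%:R)^-1 * v.2| < sigma * (x / Num.sqrt n%:R)).
Proof.
move=> s0 n0 x0; rewrite /stat; set y := v.1 + _.
have n0R : 0 < n%:R :> R by rewrite ltr0n.
have q0 : 0 < Num.sqrt n%:R :> R by rewrite sqrtr_gt0.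
have -> : n%:R * y ^+ 2 / sigma ^+ 2 = (Num.sqrt n%:R * `|y| / sigma) ^+ 2.
  by rewrite !exprMn exprVn sqr_sqrtr ?ltW// real_normK ?num_real.
rewrite ltr_pXn2r ?nnegrE//; last by rewrite divr_ge0 ?(ltW s0)// mulr_ge0// ltW.
by rewrite ltr_pdivrMr// mulrA ltr_pdivlMr// (mulrC sigma) (mulrC (`|y|)).
Qed.

Definition signal_below (R : realType) (nu : probability (measurableTypeR R) R) (sigma : R)
    (n : nat) (T : R) : R :=
  signal_prob nu (normal_prob 0 sigma) [set v | stat sigma n v < T].

Lemma measurable_stat_lt (R : realType) (sigma : R) n (T : R) :
  measurable ([set v | stat sigma n v < T] : set (measurableTypeR R * measurableTypeR R)).
Proof.
rewrite (_ : mkset _ = (stat sigma n : measurableTypeR R * measurableTypeR R -> R) @^-1` `]-oo, T[).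
  rewrite -[X in measurable X]setTI; apply: measurable_stat => //; exact: measurableT.
by apply/seteqP; split => v; rewrite /= in_itv.
Qed.

Section levels.
Variables (R : realType) (n : nat -> nat) (p : nat -> R).
Hypotheses (p01 : forall m, 0 < p m < 1) (ltmn : forall m, (m < n m)%N)
  (ny : n m @[m --> \oo] --> \oo).

Let p0 m : 0 < p m. Proof. by have /andP[] := p01 m. Qed.
Let n0 m : 0 < (n m)%:R :> R. Proof. by rewrite ltr0n; apply: leq_trans (ltmn m). Qed.

Definition level m : R := ln ((n m)%:R / p m ^+ 2).

Lemma levelE m : level m = ln (n m)%:R - 2 * ln (p m).
Proof. by rewrite /level ln_div ?posrE ?exprn_gt0// lnXn// mulr_natl. Qed.

Lemma ln_p_lt0 m : ln (p m) < 0.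
Proof. by rewrite ln_lt0. Qed.

Lemma ln_n_le_level m : ln (n m)%:R <= level m.
Proof. by rewrite levelE; have := ln_p_lt0 m; lra. Qed.

Lemma n_cvgy : (n m)%:R @[m --> \oo] --> (+oo : set_system R).
Proof. exact/cvgrnyP. Qed.

Lemma near_n_ge (C : R) : \forall m \near \oo, C <= (n m)%:R.
Proof. by have /cvgryPge := n_cvgy; apply. Qed.

Lemma near_ln_n_ge (C : R) : \forall m \near \oo, C <= ln (n m)%:R.
Proof.
near=> m; rewrite -[C]expRK ler_ln ?posrE ?expR_gt0//; near: m; exact: near_n_ge.
Unshelve. all: by end_near. Qed.

Lemma near_level_ge (C : R) : \forall m \near \oo, C <= level m.
Proof.
near=> m; apply: le_trans (ln_n_le_level m); near: m; exact: near_ln_n_ge.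
Unshelve. all: by end_near. Qed.

Lemma level_cvgy : level m @[m --> \oo] --> +oo.
Proof. by apply/cvgryPge => C; exact: near_level_ge. Qed.

Lemma sqrt_level_cvgy : Num.sqrt (level m) @[m --> \oo] --> +oo.
Proof.
apply/cvgryPge => C; near=> m.
apply: (@le_trans _ _ `|C|); first exact: ler_norm.
rewrite -sqrtr_sqr ler_wsqrtr//; near: m; exact: near_level_ge.
Unshelve. all: by end_near. Qed.

Section signals.
Variables (c : R).
Hypotheses (c0 : 0 < c) (mp_ge : \forall m \near \oo, c <= m%:R * p m).

(** m < n turns m p >= c into n p >= c, so 1 / p is at most of order n and L at most of order ln
    n. *)
Lemma level_le : \forall m \near \oo, level m <= 3 * ln (n m)%:R - 2 * ln c.
Proof.
near=> m; have h : c <= m%:R * p m by near: m.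
rewrite levelE.
have h2 : c <= (n m)%:R * p m.
  by apply: le_trans h _; rewrite ler_wpM2r ?ltW// ltr_nat.
have : ln c <= ln (n m)%:R + ln (p m).
  by rewrite -lnM ?posrE// ler_ln ?posrE// mulr_gt0.
lra.
Unshelve. all: by end_near. Qed.

Lemma level_div_n_cvg0 : level m / (n m)%:R @[m --> \oo] --> 0.
Proof.
apply/cvgrPdist_le => e e0.
have e6 : 0 < e / 6 by rewrite divr_gt0.
near=> m; rewrite sub0r normrN ger0_norm; last first.
  by rewrite divr_ge0 ?(ltW (n0 m))//; near: m; exact: near_level_ge.
have h1 : level m <= 3 * ln (n m)%:R - 2 * ln c by near: m; exact: level_le.
have h2 := ln_le_linear e6 (n0 m).
have h3 : (- 3 * ln (e / 6) - 2 * ln c) / (e / 2) <= (n m)%:R by near: m; exact: near_n_ge.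
rewrite ler_pdivrMr//; rewrite ler_pdivrMr ?divr_gt0// in h3; lra.
Unshelve. all: by end_near. Qed.

Lemma sqrt_level_div_cvg0 : Num.sqrt (level m) / Num.sqrt (n m)%:R @[m --> \oo] --> 0.
Proof.
have := cvg_sqrt0 level_div_n_cvg0; apply: cvg_trans; apply: near_eq_cvg; near=> m.
rewrite sqrtrM; last by near: m; exact: near_level_ge.
by rewrite sqrtrV// ltW.
Unshelve. all: by end_near. Qed.

Variables (nu : probability (measurableTypeR R) R) (sigma kappa : R).
Hypotheses (sigma_gt0 : 0 < sigma) (hC : assumption_C nu) (kappa_gt0 : 0 < kappa)
  (nuk : fine (nu [set x : R | `|x| < s]%R) / s @[s --> 0^'+] --> kappa).

(** The threshold q^2 L is a strip of half-width q sigma sqrt(L / n), so the limit is linear in q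
    and thresholds equivalent to L miss equivalent numbers of signals. *)
Lemma signal_below_cvg (q : R) : 0 < q ->
  signal_below nu sigma (n m) (q ^+ 2 * level m) /
    (kappa * sigma * Num.sqrt (level m) / Num.sqrt (n m)%:R) @[m --> \oo] --> q.
Proof.
move=> q0; pose t m := q * Num.sqrt (level m).
have ty : t m @[m --> \oo] --> +oo.
  apply/cvgryPge => A; have /cvgryPge/(_ (A / q)) := sqrt_level_cvgy.
  by apply: filterS => m; rewrite ler_pdivrMr// mulrC.
have tn : t m / Num.sqrt (n m)%:R @[m --> \oo] --> 0.
  apply: (cvg_to_eq (a := q * 0)); last by rewrite mulr0.
  have : q * (Num.sqrt (level m) / Num.sqrt (n m)%:R) @[m --> \oo] --> q * 0.
    by apply: cvgM; [exact: cvg_cst|exact: sqrt_level_div_cvg0].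
  by apply: cvg_trans; apply: near_eq_cvg; near=> m; rewrite /t mulrA.
have h := strip_prob_cvg sigma_gt0 hC nuk ny ty tn.
have : fine ((nu \x normal_prob 0 sigma)%E
     [set v | `|v.1 + (Num.sqrt (n m)%:R)^-1 * v.2| < sigma * (t m / Num.sqrt (n m)%:R)]%R)
   / (sigma * (t m / Num.sqrt (n m)%:R)) * (q / kappa) @[m --> \oo] --> kappa * (q / kappa).
  by apply: cvgM => //; exact: cvg_cst.
move/cvg_to_eq => /(_ q); rewrite mulrCA divff ?gt_eqF// mulr1 => /(_ erefl).
apply: cvg_trans; apply: near_eq_cvg; near=> m.
have L0 : 0 < level m by apply: (@lt_le_trans _ _ 1) => //; near: m; exact: near_level_ge.
have -> : [set v : R * R | `|v.1 + (Num.sqrt (n m)%:R)^-1 * v.2| < sigma * (t m / Num.sqrt (n m)%:R)]%R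
  = [set v | stat sigma (n m) v < q ^+ 2 * level m].
  have -> : q ^+ 2 * level m = t m ^+ 2 by rewrite /t exprMn sqr_sqrtr ?ltW.
  apply/seteqP; split => v /=; rewrite stat_ltE ?mulr_ge0 ?sqrtr_ge0 ?ltW//; exact: leq_trans (ltmn m).
rewrite -/(signal_prob _ _ _) -/(signal_below _ _ _ _) /t; field.
by rewrite !gt_eqF// ?sqrtr_gt0.
Unshelve. all: by end_near. Qed.

End signals.
End levels.

(** The estimates come for each fixed q below or above 1; q is sent to 1 afterwards. *)
Lemma cvg1_sandwich (R : realType) (u : nat -> R) :
  (forall q, 0 < q < 1 -> forall e, 0 < e -> \forall m \near \oo, q - e <= u m) ->
  (forall q, 1 < q -> forall e, 0 < e -> \forall m \near \oo, u m <= q + e) ->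
  u m @[m --> \oo] --> (1 : R).
Proof.
move=> hl hu; apply/cvgrPdist_le => e e0.
pose e1 := Num.min (e / 2) (1 / 2).
have e10 : 0 < e1 by rewrite lt_min !divr_gt0.
have e1e : e1 <= e / 2 by rewrite ge_min lexx.
have e12 : e1 <= 1 / 2 by rewrite ge_min lexx orbT.
have hl1 : 0 < 1 - e1 < 1 by apply/andP; split; lra.
have hu1 : 1 < 1 + e1 by lra.
near=> m.
have h1 : 1 - e1 - e1 <= u m by near: m; exact: hl.
have h2 : u m <= 1 + e1 + e1 by near: m; exact: hu.
by rewrite ler_norml; apply/andP; split; lra.
Unshelve. all: by end_near. Qed.

Lemma expR_half_ln (R : realType) (x : R) : 0 < x -> expR (ln x / 2) = Num.sqrt x.
Proof.
move=> x0; rewrite -[in RHS](lnK x0) (_ : expR (ln x) = expR (ln x / 2) ^+ 2).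
  by rewrite sqrtr_sqr ger0_norm// expR_ge0.
by rewrite -expRM_natl; congr expR; field.
Qed.

Lemma near_le_of_cvg (R : realType) (u : nat -> R) (a b : R) :
  u m @[m --> \oo] --> a -> a < b -> \forall m \near \oo, u m <= b.
Proof.
move=> /cvgrPdist_le ua ab; have h := ua (b - a); rewrite subr_gt0 in h.
near=> m; have : `|a - u m| <= b - a by near: m; exact: h.
by rewrite distrC ler_norml => /andP[_]; lra.
Unshelve. all: by end_near. Qed.

Lemma near_ge_of_cvg (R : realType) (u : nat -> R) (a b : R) :
  u m @[m --> \oo] --> a -> b < a -> \forall m \near \oo, b <= u m.
Proof.
move=> /cvgrPdist_le ua ab; have h := ua (a - b); rewrite subr_gt0 in h.
near=> m; have : `|a - u m| <= a - b by near: m; exact: h.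
by rewrite ler_norml => /andP[_]; lra.
Unshelve. all: by end_near. Qed.

(** * Thresholds of the rules as functions of the model size *)

Section numeric.
Variables (R : realType) (n : nat -> nat) (p : nat -> R).
Hypotheses (p01 : forall m, 0 < p m < 1) (ltmn : forall m, (m < n m)%N)
  (ny : n m @[m --> \oo] --> \oo).
Variables (c : R).
Hypotheses (c0 : 0 < c) (mp_ge : \forall m \near \oo, c <= m%:R * p m).
Local Notation L := (level n p).

Let p0 m : 0 < p m. Proof. by have /andP[] := p01 m. Qed.
Let n0 m : (0 < n m)%N. Proof. exact: leq_trans (ltmn m). Qed.
Let n0R m : 0 < (n m)%:R :> R. Proof. by rewrite ltr0n. Qed.
Let sn0 m : 0 < Num.sqrt (n m)%:R :> R. Proof. by rewrite sqrtr_gt0. Qed.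

Lemma near_index_gt0 : \forall m \near \oo, (0 < m)%N.
Proof. by exists 1%N. Qed.

(** The k-th level equals L at k = m p and drifts away only logarithmically in k / (m p). *)
Lemma log_level_levelE m k : (0 < m)%N -> (0 < k)%N ->
  log_level R (n m) m k = L m + 2 * (ln (m%:R * p m) - ln k%:R).
Proof.
move=> m0 k0; rewrite log_levelE// levelE// lnM ?posrE ?exprn_gt0 ?ltr0n// lnXn ?ltr0n//.
by rewrite lnM ?posrE ?ltr0n//; ring.
Qed.

Section rule_levels.
Variable C : R.

(** Together with [rule_up] a common envelope for the three criteria: mBIC1 subtracts the logarithm
    of the level, and C absorbs the constant d and the 2 lost by mBIC3. *)
Definition rule_lo m k : R := log_level R (n m) m k - ln (log_level R (n m) m k) - C.
Definition rule_up m k : R := log_level R (n m) m k + C.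

Lemma rule_lo_mono : \forall m \near \oo, forall k k', (0 < k <= k')%N -> (k' <= m)%N ->
  rule_lo m k' <= rule_lo m k.
Proof.
near=> m => k k' /andP[k0 kk'] k'm; have m0 := leq_trans (leq_trans k0 kk') k'm.
rewrite lerD2r; apply: le_x_sub_ln; last by apply: le_log_level; rewrite ?k0.
apply: (@le_trans _ _ (ln (n m)%:R)); last by apply: log_level_ge; rewrite ?k'm ?(leq_trans k0 kk').
near: m; exact: near_ln_n_ge.
Unshelve. all: by end_near. Qed.

Lemma rule_up_mono m k : (0 < k <= m)%N -> rule_up m k <= rule_up m 1%N.
Proof.
move=> /andP[k0 km]; rewrite lerD2r; apply: le_log_level => //.
exact: leq_trans km.
Qed.

Variables (sigma : R).
Hypotheses (sigma_gt0 : 0 < sigma).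

(** For the k-th level l, exp(- l / 2) = k / (m sqrt n), which gives the linearity in k that the
    step-up bound asks for. The factor sqrt l from subtracting ln l is cancelled by the 1 / sqrt x
    of the Gaussian tail. *)
Lemma rule_null_tail : \forall m \near \oo, forall k, (0 < k <= m)%N ->
  (normal_prob 0 sigma [set z | (rule_lo m k <= stat sigma (n m) (0%R, z))%R] <=
    (2 * expR (C / 2) / Num.sqrt (n m)%:R * k%:R / m%:R)%:E)%E.
Proof.
near=> m => k /andP[k0 km]; have m0 := leq_trans k0 km.
set l := log_level R (n m) m k.
have l_ge : ln (n m)%:R <= l by apply: log_level_ge; rewrite ?k0.
have lC : 2 * (C - ln (1 / 4)) <= l.
  by apply: le_trans l_ge; near: m; exact: near_ln_n_ge.
have l1 : 1 <= l by apply: le_trans l_ge; near: m; exact: near_ln_n_ge.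
have l0 : 0 < l by apply: lt_le_trans l1.
have lln : ln l <= 1 / 4 * l - ln (1 / 4) by apply: ln_le_linear => //; rewrite divr_gt0.
have lo_ge : l / 4 <= rule_lo m k by rewrite /rule_lo -/l; lra.
have lo0 : 0 < rule_lo m k by lra.
have -> : [set z | (rule_lo m k <= stat sigma (n m) (0%R, z))%R] = [set z | rule_lo m k <= z ^+ 2 / sigma ^+ 2].
  have statE z : stat sigma (n m) (0, z) = z ^+ 2 / sigma ^+ 2.
    rewrite /stat/= add0r exprMn exprVn sqr_sqrtr; last exact: ltW (n0R m).
    by rewrite mulVKf// lt0r_neq0.
  by apply/seteqP; split => z /=; rewrite statE.
apply: le_trans (normal_prob_sq_tail sigma_gt0 lo0) _; rewrite lee_fin.
have lE : l = ln ((n m)%:R * m%:R ^+ 2 / k%:R ^+ 2) by [].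
have kR : 0 < k%:R :> R by rewrite ltr0n.
have mR : 0 < m%:R :> R by rewrite ltr0n.
have eE : expR (- rule_lo m k / 2) = expR (C / 2) * Num.sqrt l * (k%:R / (Num.sqrt (n m)%:R * m%:R)).
  have -> : - rule_lo m k / 2 = C / 2 + ln l / 2 - l / 2 by rewrite /rule_lo -/l; lra.
  rewrite expRB expRD expR_half_ln//; congr (_ * _).
  rewrite lE expR_half_ln ?divr_gt0 ?mulr_gt0 ?exprn_gt0//.
  rewrite -mulrA sqrtrM ?ltW// -expr_div_n sqrtr_sqr ger0_norm ?divr_ge0 ?ltW//.
  by rewrite mulrA invf_div.
rewrite eE ler_pdivrMr ?sqrtr_gt0//.
have sl : Num.sqrt l <= 2 * Num.sqrt (rule_lo m k).
  have -> : 2 = Num.sqrt (2 ^+ 2 : R) by rewrite sqrtr_sqr ger0_norm.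
  rewrite -sqrtrM ?exprn_ge0// ler_wsqrtr//; lra.
have h0 : 0 <= expR (C / 2) * (k%:R / (Num.sqrt (n m)%:R * m%:R)).
  by rewrite mulr_ge0 ?expR_ge0// divr_ge0 ?mulr_ge0 ?ltW.
have := ler_wpM2r h0 sl; set z := Num.sqrt (rule_lo m k).
have -> : 2 * expR (C / 2) / Num.sqrt (n m)%:R * k%:R / m%:R * z =
  2 * z * (expR (C / 2) * (k%:R / (Num.sqrt (n m)%:R * m%:R))).
  by field; rewrite !gt_eqF.
by apply: le_trans; rewrite le_eqVlt; apply/orP; left; apply/eqP; ring.
Unshelve. all: by end_near. Qed.

(** (1 + m p) L is the cut in Markov's inequality for the step-up number; up to there the level
    falls below L by at most 2 ln L and a constant. *)
Lemma rule_lo_ge q : 0 < q < 1 -> \forall m \near \oo,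
  forall k, (0 < k <= m)%N -> k%:R <= (1 + m%:R * p m) * L m ->
    q ^+ 2 * L m <= rule_lo m k.
Proof.
(* ln L occurs three times, twice in the level and once subtracted, at a cost of 3 e L; the
   constants collected in A cost another 3 e L. Together this is (1 - q^2) L. *)
move=> /andP[q0 q1]; pose e := (1 - q ^+ 2) / 6.
have e0 : 0 < e by rewrite divr_gt0// subr_gt0 exprn_ilt1// ltW.
have e1 : 0 < 1 - 2 * e by rewrite /e; have : 0 < q ^+ 2 by [rewrite exprn_gt0]; lra.
pose A := 2 * ln (1 + c^-1) + C - 3 * ln e.
near=> m => k /andP[k0 km] kK; have m0 := leq_trans k0 km.
have mp0 : 0 < m%:R * p m by rewrite mulr_gt0// ltr0n.
have mpc : c <= m%:R * p m by near: m.
have L1 : 1 <= L m by near: m; exact: near_level_ge.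
have LA : (2 * ln (1 + c^-1) - 2 * ln e + 1) / (1 - 2 * e) <= L m by near: m; exact: near_level_ge.
rewrite ler_pdivrMr// in LA.
have LA2 : A / (3 * e) <= L m by near: m; exact: near_level_ge.
have e3 : 0 < 3 * e by rewrite pmulr_rgt0.
rewrite (ler_pdivrMr _ _ e3) in LA2.
have L0 : 0 < L m by apply: lt_le_trans L1.
have lnL := ln_le_linear e0 L0.
have kR : 0 < k%:R :> R by rewrite ltr0n.
have lnk : ln k%:R <= ln (1 + c^-1) + ln (m%:R * p m) + ln (L m).
  have ic : 0 < 1 + c^-1 by rewrite addr_gt0// invr_gt0.
  have icm := mulr_gt0 ic mp0; have icmL := mulr_gt0 icm L0.
  rewrite -(lnM (x := 1 + c^-1)) ?posrE// -lnM ?posrE// ler_ln ?posrE//.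
  apply: le_trans kK _; apply: ler_wpM2r; first exact: ltW.
  rewrite mulrDl mul1r addrC lerD2l.
  by rewrite mulrC ler_pdivlMr ?mul1r.
have x1 : 1 <= L m - 2 * ln (1 + c^-1) - 2 * ln (L m) by lra.
have xl : L m - 2 * ln (1 + c^-1) - 2 * ln (L m) <= log_level R (n m) m k.
  rewrite log_level_levelE//; lra.
have := le_x_sub_ln x1 xl; rewrite /rule_lo.
have : ln (L m - 2 * ln (1 + c^-1) - 2 * ln (L m)) <= ln (L m).
  rewrite ler_ln ?posrE//; last by lra.
  have : 0 <= ln (L m) by rewrite ln_ge0.
  have : 0 <= ln (1 + c^-1) by rewrite ln_ge0// lerDl invr_ge0 ltW.
  lra.
rewrite /A /e in LA2 lnL *; lra.
Unshelve. all: by end_near. Qed.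

(** Applied with k = 1 and B a bound on m p when m p stays bounded, and with k > m p / 8 when m p
    tends to infinity. *)
Lemma rule_up_lt (B q : R) : 1 < q -> \forall m \near \oo,
  forall k, (0 < k)%N -> m%:R * p m <= B * k%:R -> rule_up m k < q ^+ 2 * L m.
Proof.
move=> q1; have q2 : 0 < q ^+ 2 - 1 by rewrite subr_gt0 exprn_egt1.
near=> m => k k0 mpk.
have m0 : (0 < m)%N by near: m; exact: near_index_gt0.
have mp0 : 0 < m%:R * p m by rewrite mulr_gt0// ltr0n.
have kR : 0 < k%:R :> R by rewrite ltr0n.
have B0 : 0 < B by rewrite -(pmulr_lgt0 _ kR); exact: lt_le_trans mpk.
have h : (2 * ln B + C + 1) / (q ^+ 2 - 1) <= L m by near: m; exact: near_level_ge.
have lnB : ln (m%:R * p m) <= ln B + ln k%:R.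
  by rewrite -lnM ?posrE// ler_ln ?posrE// mulr_gt0.
rewrite /rule_up log_level_levelE//; rewrite ler_pdivrMr// in h; lra.
Unshelve. all: by end_near. Qed.

(** m < n bounds the level at k = 1 by 3 ln n <= 3 L; the factor 4 leaves room for C, and as a
    square it fits the form q^2 L. *)
Lemma rule_up1_lt : \forall m \near \oo, rule_up m 1%N < 2 ^+ 2 * L m.
Proof.
near=> m.
have m0 : (0 < m)%N by near: m; exact: near_index_gt0.
rewrite /rule_up log_levelE// ln1 mulr0 subr0 lnM ?posrE ?exprn_gt0 ?ltr0n// lnXn ?ltr0n//.
have h1 : ln m%:R <= ln (n m)%:R :> R by rewrite ler_ln ?posrE ?ltr0n// ler_nat ltnW.
have h2 := ln_n_le_level p01 ltmn m.
have h3 : C + 1 <= L m by near: m; exact: near_level_ge.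
lra.
Unshelve. all: by end_near. Qed.

End rule_levels.

(** * Comparison with the order D of the risk *)

Variables (nu : probability (measurableTypeR R) R) (sigma kappa : R).
Hypotheses (sigma_gt0 : 0 < sigma) (hC : assumption_C nu) (kappa_gt0 : 0 < kappa)
  (nuk : fine (nu [set x : R | `|x| < s]%R) / s @[s --> 0^'+] --> kappa).
Local Notation h m T := (signal_below nu sigma (n m) T).

Definition risk_order m : R :=
  m%:R * p m * (kappa * sigma * Num.sqrt (L m) / Num.sqrt (n m)%:R).

Lemma risk_order_gt0 : \forall m \near \oo, 0 < risk_order m.
Proof.
near=> m; rewrite !mulr_gt0// ?invr_gt0// ?sqrtr_gt0 ?ltr0n//.
  by near: m; exact: near_index_gt0.
apply: (@lt_le_trans _ _ 1) => //; near: m; exact: near_level_ge.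
Unshelve. all: by end_near. Qed.

(** m p >= c makes 1 + m p of order m p, so relative to D a factor 1 / sqrt L remains, which tends
    to 0. *)
Lemma false_positives_negligible (C : R) (x : nat -> R) : 0 <= C ->
  (\forall m \near \oo, 0 <= x m <= C * (1 + m%:R * p m) / Num.sqrt (n m)%:R) ->
  x m / risk_order m @[m --> \oo] --> 0.
Proof.
move=> C0 hx; pose B := C * (1 + c^-1) / (kappa * sigma).
have hB : B / Num.sqrt (L m) @[m --> \oo] --> 0.
  apply: (cvg_to_eq (a := B * 0)); last by rewrite mulr0.
  by apply: cvgM; [exact: cvg_cst|apply: cvg_invr_sqrt; exact: level_cvgy].
apply: (@squeeze_cvgr _ _ _ _ (fun=> 0) _ _ _ _ (cvg_cst 0) hB).
near=> m.
have D0 : 0 < risk_order m by near: m; exact: risk_order_gt0.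
have /andP[x0 xC] : 0 <= x m <= C * (1 + m%:R * p m) / Num.sqrt (n m)%:R by near: m.
have m0 : (0 < m)%N by near: m; exact: near_index_gt0.
have mp0 : 0 < m%:R * p m by rewrite mulr_gt0// ltr0n.
have mpc : c <= m%:R * p m by near: m.
have L0 : 0 < L m by apply: (@lt_le_trans _ _ 1) => //; near: m; exact: near_level_ge.
have sL0 : 0 < Num.sqrt (L m) by rewrite sqrtr_gt0.
rewrite divr_ge0 ?(ltW D0)//= ler_pdivrMr//.
apply: le_trans xC _; rewrite ler_pdivrMr//.
have -> : B / Num.sqrt (L m) * risk_order m * Num.sqrt (n m)%:R = C * ((1 + c^-1) * (m%:R * p m)).
  by rewrite /B /risk_order; field; rewrite !gt_eqF.
rewrite ler_wpM2l// mulrDl mul1r addrC lerD2l.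
by rewrite mulrC ler_pdivlMr ?mul1r.
Unshelve. all: by end_near. Qed.

(** Shared by the rules and the oracle. The factor 1 - 2 / L allows for a large step-up number, and
    the term with e for the event that too few regressors are selected, where the threshold may
    reach 4 L. *)
Lemma false_negatives_cvg (x e : nat -> R) :
  (forall q, 0 < q < 1 -> \forall m \near \oo,
    m%:R * p m * (h m (q ^+ 2 * L m) * (1 - 2 / L m)) <= x m) ->
  e m @[m --> \oo] --> 0 ->
  (forall q, 1 < q -> \forall m \near \oo,
    x m <= m%:R * p m * (h m (q ^+ 2 * L m) + e m * h m (2 ^+ 2 * L m))) ->
  x m / risk_order m @[m --> \oo] --> (1 : R).
Proof.
move=> xl e_0 xu.
have scaleE (a b u v : R) : v != 0 -> a / v * b * (u * v) = u * (a * b) by move=> v0; field.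
have scaleE2 (a b e' u v : R) : v != 0 -> (a / v + e' * (b / v)) * (u * v) = u * (a + e' * b).
  by move=> v0; field.
pose g m := kappa * sigma * Num.sqrt (L m) / Num.sqrt (n m)%:R.
have H q : 0 < q -> h m (q ^+ 2 * L m) / g m @[m --> \oo] --> q.
  by move=> q0; exact: (signal_below_cvg p01 ltmn ny c0 mp_ge sigma_gt0 hC kappa_gt0 nuk q0).
have iL : (L m)^-1 @[m --> \oo] --> 0 by apply: cvgVy0; exact: level_cvgy.
apply: cvg1_sandwich => q.
  move=> q01; have /andP[q0 _] := q01; move=> eps eps0.
  have hq : h m (q ^+ 2 * L m) / g m * (1 - 2 * (L m)^-1) @[m --> \oo] --> q.
    apply: (cvg_to_eq (a := q * (1 - 2 * 0))); last by rewrite mulr0 subr0 mulr1.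
    by apply: cvgM; [exact: H|apply: cvgB; [exact: cvg_cst|apply: cvgM => //; exact: cvg_cst]].
  have qe : q - eps < q by lra.
  near=> m; apply: (@le_trans _ _ (h m (q ^+ 2 * L m) / g m * (1 - 2 * (L m)^-1))).
    by near: m; exact: near_ge_of_cvg hq qe.
  have D0 : 0 < risk_order m by near: m; exact: risk_order_gt0.
  rewrite ler_pdivlMr//.
  have m0 : (0 < m)%N by near: m; exact: near_index_gt0.
  have mp0 : 0 < m%:R * p m by rewrite mulr_gt0// ltr0n.
  have g0 : 0 < g m by move: D0; rewrite /risk_order pmulr_rgt0.
  apply: (@le_trans _ _ (m%:R * p m * (h m (q ^+ 2 * L m) * (1 - 2 / L m)))); last by near: m; exact: xl.
  by rewrite /risk_order -/(g m) scaleE// gt_eqF.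
move=> q1 eps eps0; have q0 : 0 < q by apply: lt_trans q1.
have hq : h m (q ^+ 2 * L m) / g m + e m * (h m (2 ^+ 2 * L m) / g m) @[m --> \oo] --> q.
  apply: (cvg_to_eq (a := q + 0 * 2)); last by rewrite mul0r addr0.
  by apply: cvgD; [exact: H|apply: cvgM => //; exact: H].
have qe : q < q + eps by lra.
near=> m; apply: (@le_trans _ _ (h m (q ^+ 2 * L m) / g m + e m * (h m (2 ^+ 2 * L m) / g m))); last first.
  by near: m; exact: near_le_of_cvg hq qe.
have D0 : 0 < risk_order m by near: m; exact: risk_order_gt0.
rewrite ler_pdivrMr//.
have m0 : (0 < m)%N by near: m; exact: near_index_gt0.
have mp0 : 0 < m%:R * p m by rewrite mulr_gt0// ltr0n.
have g0 : 0 < g m by move: D0; rewrite /risk_order pmulr_rgt0.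
apply: (@le_trans _ _ (m%:R * p m * (h m (q ^+ 2 * L m) + e m * h m (2 ^+ 2 * L m)))).
  by near: m; exact: xu.
by rewrite /risk_order -/(g m) scaleE2// gt_eqF.
Unshelve. all: by end_near. Qed.

(** So a signal exceeds even the largest threshold with probability at least 1/2. *)
Lemma signal_below4_small : \forall m \near \oo, h m (2 ^+ 2 * L m) <= 2^-1.
Proof.
pose g m := kappa * sigma * Num.sqrt (L m) / Num.sqrt (n m)%:R.
have two0 : 0 < 2 :> R by [].
have := signal_below_cvg p01 ltmn ny c0 mp_ge sigma_gt0 hC kappa_gt0 nuk two0.
rewrite -/(g _) => H.
have g_0 : g m @[m --> \oo] --> 0.
  apply: (cvg_to_eq (a := kappa * sigma * 0)); last by rewrite mulr0.
  have : kappa * sigma * (Num.sqrt (L m) / Num.sqrt (n m)%:R) @[m --> \oo] --> kappa * sigma * 0.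
    by apply: cvgM; [exact: cvg_cst|exact: sqrt_level_div_cvg0 mp_ge].
  by apply: cvg_trans; apply: near_eq_cvg; near=> m; rewrite /g mulrA.
have : h m (2 ^+ 2 * L m) / g m * g m @[m --> \oo] --> (2 * 0 : R) by exact: cvgM.
rewrite mulr0 => hg.
have h2 : 0 < 2^-1 :> R by rewrite invr_gt0.
near=> m.
have -> : h m (2 ^+ 2 * L m) = h m (2 ^+ 2 * L m) / g m * g m.
  rewrite divfK// gt_eqF// /g !mulr_gt0// ?invr_gt0// sqrtr_gt0.
  by apply: (@lt_le_trans _ _ 1) => //; near: m; exact: near_level_ge.
near: m; exact: near_le_of_cvg hg h2.
Unshelve. all: by end_near. Qed.

End numeric.

(** * The Bayes oracle *)

Section tilted.
Variables (R : realType) (nu : probability (measurableTypeR R) R).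

(* Up to the scale r = sqrt n / sigma, u is the coefficient and (-1)^b x is the
   threshold: b tells the lower threshold of the oracle from the upper one. *)
Definition tilt (b : bool) (r x u : R) : R := expR ((-1) ^+ b * x * (r * u) - (r * u) ^+ 2 / 2).

Definition tilted_mass b r x : \bar R := (\int[nu]_u (tilt b r x u)%:E)%E.

(** Completing the square: a Gaussian bump in u of width 1 / r, centred at (-1)^b x / r and of
    height exp(x^2 / 2). *)
Lemma tiltE b r x u : tilt b r x u =
  expR (x ^+ 2 / 2) * expR (- ((-1) ^+ b * (r * u) - x) ^+ 2 / 2).
Proof.
rewrite -expRD /tilt; congr expR.
have s2 : ((-1) ^+ b) ^+ 2 = 1 :> R by rewrite sqrr_sign.
set s : R := (-1) ^+ b in s2 *.
have -> : (r * u) ^+ 2 = (s * (r * u)) ^+ 2 by rewrite [RHS]exprMn s2 mul1r.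
by rewrite (_ : s * x * (r * u) = x * (s * (r * u))); [field|ring].
Qed.

Lemma tilt_ge0 b r x u : 0 <= tilt b r x u.
Proof. exact: expR_ge0. Qed.

Lemma measurable_tilt b r x : measurable_fun [set: measurableTypeR R] (tilt b r x).
Proof.
apply: measurableT_comp => //; apply: measurable_funB => //.
  by apply: measurable_funM => //; apply: measurable_funM.
by apply: measurable_funM => //; apply: measurable_funX; apply: measurable_funM.
Qed.

Lemma tilt_le b r x u : tilt b r x u <= expR (x ^+ 2 / 2).
Proof.
rewrite tiltE ler_piMr ?expR_ge0// -expR0 ler_expR.
by rewrite mulNr oppr_le0 divr_ge0// sqr_ge0.
Qed.

Lemma integrable_tilt b r x : nu.-integrable setT (EFin \o tilt b r x).
Proof.
apply: (@le_integrable _ _ _ nu setT measurableT _ (EFin \o cst (expR (x ^+ 2 / 2)))) => //.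
- by apply/measurable_EFinP; exact: measurable_tilt.
- move=> u _ /=; rewrite lee_fin !ger0_norm ?expR_ge0 ?tilt_ge0//; exact: tilt_le.
- exact: finite_measure_integrable_cst.
Qed.

Lemma tilted_mass_fin b r x : tilted_mass b r x \is a fin_num.
Proof. exact: integrable_fin_num (integrable_tilt b r x). Qed.

Lemma continuous_tilted_mass b r : continuous (fun x => fine (tilted_mass b r x) : R).
Proof.
move=> x.
have xI : x \in (`]x - 1, x + 1[%classic : set R).
  by rewrite inE/= in_itv/=; apply/andP; split; lra.
apply: (@continuity_under_integral R _ _ nu (tilt b r) setT measurableT (x - 1) (x + 1)
   _ _ (fun=> expR ((`|x| + 1) ^+ 2 / 2)) _ _ x xI).
- by move=> y _; exact: integrable_tilt.
- apply: aeW => u _ y _; apply: continuous_comp; last exact: continuous_expR.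
  apply: cvgB; last exact: cvg_cst.
  apply: cvgM; last exact: cvg_cst.
  by apply: cvgM; [exact: cvg_cst|exact: cvg_id].
- exact: finite_measure_integrable_cst.
- move=> y /=; rewrite in_itv/= => /andP[y1 y2]; apply: aeW => u _.
  rewrite ger0_norm ?tilt_ge0//; apply: le_trans (tilt_le _ _ _ _) _.
  rewrite ler_expR ler_pM2r ?invr_gt0// -real_normK ?num_real// ler_pXn2r ?nnegrE ?addr_ge0//.
  have := ler_norm x; have := ler_norm (- x); rewrite normrN ler_norml => h1 h2.
  by apply/andP; split; lra.
Qed.

Hypothesis hC : assumption_C nu.

(** Inside the window of the density, the bound K and the Gaussian integral give the order exp(x^2 /
    2) / r. Outside it, x is at most a quarter of r times the window radius, so the exponent is at
    most - z^2 with z half of that product, and exp(- z^2) <= 1 / z. *)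
Lemma tilted_mass_le : exists e0 C : R, [/\ 0 < e0, 0 < C &
  forall b r x, 0 < r -> 0 <= x -> x <= r * e0 ->
    (tilted_mass b r x <= (C * expR (x ^+ 2 / 2) / r)%:E)%E].
Proof.
have [e0 [K [_ [_ [e00 K0 _ [_ [_ nuK]] _]]]]] := density_near hC.
exists (e0 / 4), (K * Num.sqrt (pi *+ 2) + 2 / e0); split; first by rewrite divr_gt0.
  by rewrite addr_gt0// ?divr_gt0// mulr_gt0// sqrtr_gt0 mulrn_wgt0// pi_gt0.
move=> b r x r0 x0 xr; set s : R := (-1) ^+ b.
have s2 : s ^+ 2 = 1 by rewrite sqrr_sign.
pose I0 : set (measurableTypeR R) := `[- e0, e0]%classic.
have mI : measurable I0 by exact: measurable_itv.
have mt (D : set (measurableTypeR R)) : measurable_fun D (EFin \o tilt b r x).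
  by apply/measurable_EFinP; apply: measurable_funTS; exact: measurable_tilt.
rewrite /tilted_mass -(setvU I0) ge0_integral_setU//=; last 3 first.
- exact: measurableC.
- by move=> u _; rewrite lee_fin tilt_ge0.
- by apply/eqP; exact: setICl.
have -> : (K * Num.sqrt (pi *+ 2) + 2 / e0) * expR (x ^+ 2 / 2) / r =
  K * Num.sqrt (pi *+ 2) * expR (x ^+ 2 / 2) / r + 2 / e0 * expR (x ^+ 2 / 2) / r by ring.
rewrite addeC.
rewrite EFinD; apply: leeD.
  pose e := r^-1; have e_gt0 : 0 < e by rewrite invr_gt0.
  have en0 : e != 0 by rewrite gt_eqF.
  have tiltN u : tilt b r x u = expR (x ^+ 2 / 2) * (Num.sqrt (pi *+ 2) / r) * normal_pdf (s * x * e) e u.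
    rewrite tiltE (_ : normal_pdf _ _ u = normal_peak e * normal_fun (s * x * e) e u); last by rewrite normal_pdfE.
    rewrite -(mulrA (expR _)); congr (_ * _).
    have -> : normal_peak e = (e * Num.sqrt (pi *+ 2))^-1.
      by rewrite /normal_peak -mulrnAr sqrtrM ?sqr_ge0// sqrtr_sqr ger0_norm ?(ltW e_gt0).
    have q0 : 0 < Num.sqrt (pi *+ 2) :> R by rewrite sqrtr_gt0 mulrn_wgt0// pi_gt0.
    set q := Num.sqrt (pi *+ 2) in q0 *.
    rewrite (_ : normal_fun _ _ _ = expR (- ((-1) ^+ b * (r * u) - x) ^+ 2 / 2)); last first.
      rewrite /normal_fun; congr expR; rewrite -/s.
      have -> : s * (r * u) - x = s * (r * (u - s * x * e)).
        rewrite mulrBr mulrBr (_ : s * (r * (s * x * e)) = s ^+ 2 * x * (r * e)); last by ring.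
        by rewrite s2 mul1r /e divff ?mulr1// gt_eqF.
      rewrite [in RHS]exprMn s2 mul1r exprMn /e exprVn; field.
      by rewrite gt_eqF.
    by rewrite /e; field; rewrite !gt_eqF.
  apply: (@le_trans _ _ (K%:E * \int[lebesgue_measure]_(u in I0) (tilt b r x u)%:E)%E).
    apply: nuK => //; last by move=> u; rewrite lee_fin tilt_ge0.
    exact: (mt setT).
  apply: (@le_trans _ _ (K%:E * \int[lebesgue_measure]_u (tilt b r x u)%:E)%E).
    apply: lee_wpmul2l; first by rewrite lee_fin ltW.
    apply: ge0_subset_integral => //.
    by move=> u _; rewrite lee_fin tilt_ge0.
  under eq_integral do rewrite tiltN EFinM.
  rewrite ge0_integralZl//; last 3 first.
  - by apply/measurable_EFinP; exact: measurable_normal_pdf.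
  - by move=> u _; rewrite lee_fin normal_pdf_ge0.
  - by rewrite lee_fin mulr_ge0 ?expR_ge0// divr_ge0 ?sqrtr_ge0 ?(ltW r0).
  rewrite integral_normal_pdf mule1 -EFinM lee_fin le_eqVlt; apply/orP; left; apply/eqP; ring.
have z0 : 0 < r * e0 / 2 by rewrite divr_gt0// mulr_gt0.
have ez : expR (- (r * e0 / 2) ^+ 2) <= (r * e0 / 2)^-1.
  rewrite expRN lef_pV2 ?posrE ?expR_gt0//; apply: le_trans (expR_ge1Dx _).
  by have := sqr_ge0 (r * e0 / 2 - 1); rewrite sqrrB1; set z := r * e0 / 2 in z0 *; lra.
apply: (@le_trans _ _ (\int[nu]_(u in ~` I0) (r * e0 / 2)^-1%:E)%E).
  apply: ge0_le_integral => //.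
  - exact: measurableC.
  - by move=> u _; rewrite lee_fin tilt_ge0.
  move=> u Iu; rewrite lee_fin; apply: le_trans ez; rewrite ler_expR -/s.
  have ue : e0 <= `|u|.
    rewrite leNgt; apply/negP => /ltW; rewrite ler_norml => h; apply: Iu.
    by rewrite /I0/= in_itv.
  have w2 : (r * u) ^+ 2 = (r * `|u|) ^+ 2 by rewrite !exprMn real_normK ?num_real.
  have sxu : s * x * (r * u) <= x * (r * `|u|).
    rewrite mulrAC mulrC ler_wpM2l// mulrCA ler_wpM2l ?(ltW r0)//.
    apply: le_trans (ler_norm _) _; rewrite normrM (_ : `|s| = 1) ?mul1r//.
    by rewrite /s normr_sign.
  rewrite w2; have rw : r * e0 <= r * `|u| by rewrite ler_wpM2l// ltW.
  have xz : x <= r * e0 / 4 by move: xr; rewrite mulrA.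
  set w := r * `|u| in sxu rw *; set z := r * e0 in rw z0 xz *.
  have xw : x * w <= w / 4 * w by rewrite ler_wpM2r//; [rewrite mulr_ge0// ltW|lra].
  have zw : z ^+ 2 <= w ^+ 2 by rewrite ler_pXn2r ?nnegrE//; lra.
  lra.
rewrite integral_cst/=; last exact: measurableC.
apply: (@le_trans _ _ ((r * e0 / 2)^-1%:E * 1)%E).
  apply: lee_wpmul2l; first by rewrite lee_fin invr_ge0 ltW.
  by apply: probability_le1; exact: measurableC.
rewrite mule1 lee_fin invf_div invfM mulrA mulrAC ler_wpM2r ?invr_ge0 ?(ltW r0)//.
rewrite ler_peMr ?divr_ge0 ?(ltW e00)//.
by rewrite -expR0 ler_expR divr_ge0// sqr_ge0.
Qed.

(** On the side given by b, the interval of radius 1 / r at distance y / r from 0 has mass of order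
    1 / r, and at x = y the integrand there is at least exp(-1/2) exp(y^2 / 2). As y >= 1 it does
    not cross 0, so larger x only increase the integrand: all x >= y are covered at once, which
    confines every solution of the threshold equation. *)
Lemma tilted_mass_ge : exists t0 C : R, [/\ 0 < t0, 0 < C &
  forall b r y x, 0 < r -> 1 <= y -> y + 1 < r * t0 -> y <= x ->
    ((C * expR (y ^+ 2 / 2) / r)%:E <= tilted_mass b r x)%E].
Proof.
have [e0 [K [l [rr [e00 K0 [l0 rr0] _ dens]]]]] := density_near hC.
have [k [k0 kl kr]] : exists k, [/\ 0 < k, k <= l - k & k <= rr - k].
  exists (Num.min l rr / 2); have h1 : Num.min l rr <= l by rewrite ge_min lexx.
  have h2 : Num.min l rr <= rr by rewrite ge_min lexx orbT.
  by split; [rewrite divr_gt0// lt_min l0|lra|lra].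
have [t0 /andP[t00 _] [densr densl]] := dens _ k0.
exists t0, (k * 2 * expR (- 1 / 2)); split => //; first by rewrite !mulr_gt0 ?expR_gt0.
move=> b r y x r0 y1 yr yx.
pose A : set (measurableTypeR R) := if b then `](- (y + 1) / r), (- (y - 1) / r)[%classic
   else `]((y - 1) / r), ((y + 1) / r)[%classic.
have mA : measurable A by rewrite /A; case: ifP => _; exact: measurable_itv.
have nuA : ((k * (2 / r))%:E <= nu A)%E.
  rewrite /A; case: ifP => _.
    have h : `](- (y + 1) / r), (- (y - 1) / r)[ `<=` (`]- t0, 0[ : set R).
      move=> u /=; rewrite !in_itv/= => /andP[u1 u2]; apply/andP; split.
        by apply: le_lt_trans u1; rewrite ler_pdivlMr//; lra.
      by apply: lt_le_trans u2 _; rewrite ler_pdivrMr//; lra.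
    have [+ _] := densl _ (measurable_itv _) h; apply: le_trans.
    rewrite lebesgue_measure_itv/= lte_fin ltr_pM2r ?invr_gt0// ifT; last by lra.
    rewrite -EFinD -EFinM lee_fin [X in _ <= _ * X](_ : _ = 2 / r); last by field; rewrite gt_eqF.
    by rewrite ler_wpM2r// divr_ge0// ltW.
  have h : `]((y - 1) / r), ((y + 1) / r)[ `<=` (`]0, t0[ : set R).
    move=> u /=; rewrite !in_itv/= => /andP[u1 u2]; apply/andP; split.
      by apply: le_lt_trans u1; rewrite ler_pdivlMr//; lra.
    by apply: lt_le_trans u2 _; rewrite ler_pdivrMr//; lra.
  have [+ _] := densr _ (measurable_itv _) h; apply: le_trans.
  rewrite lebesgue_measure_itv/= lte_fin ltr_pM2r ?invr_gt0// ifT; last by lra.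
  rewrite -EFinD -EFinM lee_fin [X in _ <= _ * X](_ : _ = 2 / r); last by field; rewrite gt_eqF.
  by rewrite ler_wpM2r// divr_ge0// ltW.
have tA u : A u -> expR (- 1 / 2) * expR (y ^+ 2 / 2) <= tilt b r x u.
  move=> Au; set v : R := (-1) ^+ b * (r * u).
  have [v1 v2] : y - 1 < v /\ v < y + 1.
    move: Au; rewrite /A /v; case: ifP => _; rewrite /= in_itv/= ?expr1 ?expr0 => /andP[].
      rewrite ltr_pdivrMr// ltr_pdivlMr//; split; lra.
    rewrite ltr_pdivrMr// ltr_pdivlMr//; split; lra.
  have v2E : (r * u) ^+ 2 = v ^+ 2 by rewrite /v [RHS]exprMn sqrr_sign mul1r.
  rewrite -expRD ler_expR /tilt -mulrA mulrCA -/v v2E.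
  have h1 : 0 <= v * (x - y) by rewrite mulr_ge0//; lra.
  have h2 : 0 <= (1 - (v - y)) * (1 + (v - y)) by rewrite mulr_ge0//; lra.
  lra.
apply: (@le_trans _ _ (\int[nu]_(u in A) (expR (- 1 / 2) * expR (y ^+ 2 / 2))%:E)%E).
  rewrite integral_cst//.
  apply: (@le_trans _ _ ((expR (- 1 / 2) * expR (y ^+ 2 / 2))%:E * (k * (2 / r))%:E)%E).
    by rewrite -EFinM lee_fin le_eqVlt; apply/orP; left; apply/eqP; ring.
  by apply: lee_wpmul2l => //; rewrite lee_fin mulr_ge0 ?expR_ge0.
apply: (@le_trans _ _ (\int[nu]_(u in A) (tilt b r x u)%:E)%E).
  apply: ge0_le_integral => //.
  by apply/measurable_EFinP; apply: measurable_funTS; exact: measurable_tilt.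
apply: ge0_subset_integral => //.
  by apply/measurable_EFinP; exact: measurable_tilt.
by move=> u _; rewrite lee_fin tilt_ge0.
Qed.

End tilted.

(** In units of 1 / r both thresholds solve the same equation, the sign (-1)^b reflecting the lower
    one. *)
Lemma oracle_thresholdE (R : realType) (sigma : R) (nu : probability (measurableTypeR R) R)
    (n : nat) (p d0 dA : R) (b : bool) (a : R) :
  0 < sigma -> (0 < n)%N -> 0 < p -> 0 < dA ->
  oracle_threshold sigma nu n p d0 dA a <->
  tilted_mass nu b (Num.sqrt n%:R / sigma) ((-1) ^+ b * (Num.sqrt n%:R / sigma * a)) =
    ((1 - p) * d0 / (p * dA))%:E.
Proof.
move=> s0 n0 p0 dA0; rewrite /oracle_threshold/=.
have pdA : 0 < p * dA by rewrite mulr_gt0.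
have -> : (\int[nu]_u (expR (n%:R * (a * (u / sigma ^+ 2) - u ^+ 2 / (2 * sigma ^+ 2))))%:E)%E =
   tilted_mass nu b (Num.sqrt n%:R / sigma) ((-1) ^+ b * (Num.sqrt n%:R / sigma * a)).
  apply: eq_integral => u _; congr (expR _)%:E.
  rewrite (mulrA ((-1) ^+ b)) -expr2 sqrr_sign mul1r.
  move: (sqr_sqrtr (ler0n R n)); set q := Num.sqrt n%:R => qE; rewrite -qE.
  by field; exact: lt0r_neq0.
have := tilted_mass_fin nu b (Num.sqrt n%:R / sigma) ((-1) ^+ b * (Num.sqrt n%:R / sigma * a)).
case: (tilted_mass _ _ _ _) => [y _| |]//; rewrite -EFinM; split => -[E]; congr EFin.
  by rewrite E mulrAC divff ?mul1r// gt_eqF.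
by rewrite E mulrCA divff ?mulr1// gt_eqF.
Qed.

Lemma tilted_root (R : realType) (nu : probability (measurableTypeR R) R) b r (y0 y1 Y : R) :
  y0 <= y1 -> (tilted_mass nu b r y0 <= Y%:E)%E -> (Y%:E <= tilted_mass nu b r y1)%E ->
  exists2 x, y0 <= x <= y1 & tilted_mass nu b r x = Y%:E.
Proof.
move=> y01 h0 h1; pose f x := fine (tilted_mass nu b r x).
have fE x : tilted_mass nu b r x = (f x)%:E by rewrite fineK// tilted_mass_fin.
move: h0 h1; rewrite !fE !lee_fin => h0 h1.
have [] := @IVT R f y0 y1 Y y01 (continuous_subspaceT (@continuous_tilted_mass R nu b r)).
  by rewrite ge_min h0 le_max h1 orbT.
by move=> x; rewrite in_itv/= => xI fx; exists x => //; rewrite fE fx.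
Qed.

Lemma ln_scaled_expR (R : realType) (a x b : R) : 0 < a -> 0 < b ->
  ln (a * expR x / b) = ln a + x - ln b.
Proof.
move=> a0 b0; rewrite ln_div ?posrE ?mulr_gt0 ?expR_gt0//.
by rewrite lnM ?posrE ?expR_gt0// expRK.
Qed.

(** * Location of the oracle thresholds *)

Section oracle_cuts.
Variables (R : realType) (sigma : R) (nu : probability (measurableTypeR R) R)
  (n : nat -> nat) (p delta0 deltaA : nat -> R).
Hypotheses (sigma_gt0 : 0 < sigma) (p01 : forall m, 0 < p m < 1)
  (delta0_gt0 : forall m, 0 < delta0 m) (deltaA_gt0 : forall m, 0 < deltaA m)
  (ltmn : forall m, (m < n m)%N)
  (hB : assumption_B n p (fun m => delta0 m / deltaA m)) (hC : assumption_C nu).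
Variables (c : R).
Hypotheses (c0 : 0 < c) (mp_ge : \forall m \near \oo, c <= m%:R * p m).
Local Notation L := (level n p).
Let r m := Num.sqrt (n m)%:R / sigma.

Let ny : n m @[m --> \oo] --> \oo. Proof. by case: hB. Qed.
Let p0 m : 0 < p m. Proof. by have /andP[] := p01 m. Qed.
Let q0 m : 0 < 1 - p m. Proof. by have /andP[_] := p01 m; rewrite subr_gt0. Qed.
Let n0 m : (0 < n m)%N. Proof. exact: leq_trans (ltmn m). Qed.
Let n0R m : 0 < (n m)%:R :> R. Proof. by rewrite ltr0n. Qed.
Let sn0 m : 0 < Num.sqrt (n m)%:R :> R. Proof. by rewrite sqrtr_gt0. Qed.
Let r0 m : 0 < r m. Proof. by rewrite divr_gt0. Qed.

(** The product f delta of the prior odds against a signal and the loss ratio. *)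
Definition odds m : R := (1 - p m) * delta0 m / (p m * deltaA m).

Lemma odds_gt0 m : 0 < odds m.
Proof. by rewrite divr_gt0// mulr_gt0. Qed.

(** 2 ln(odds) + ln n = L + 2 ln(1 - p) + 2 ln delta, and both corrections are o(L) by Assumption
    (B). *)
Lemma ln_odds_near eta : 0 < eta -> \forall m \near \oo,
  (1 - eta) * L m <= 2 * ln (odds m) + ln (n m)%:R <= (1 + eta) * L m.
Proof.
move=> eta0; have [_ pc dl _] := hB.
have e2 : 0 < eta / 2 by rewrite divr_gt0.
have hd : \forall m \near \oo, `|ln (delta0 m / deltaA m)| <= eta / 2 * `|ln (p m)|.
  by have /eqoP := dl; apply.
have ph : \forall m \near \oo, p m <= 1 / 2 by apply: near_le_of_cvg pc _; rewrite divr_gt0.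
near=> m; have h1 : `|ln (delta0 m / deltaA m)| <= eta / 2 * `|ln (p m)| by near: m.
have lp : ln (p m) < 0 by rewrite ln_lt0.
rewrite (ltr0_norm lp) ler_norml in h1.
have h2 : ln (1 / 2) <= ln (1 - p m).
  by rewrite ler_ln ?posrE ?divr_gt0//; have : p m <= 1 / 2 by [near: m]; lra.
have h3 : ln (1 - p m) <= 0 by rewrite ln_le0//; have := p0 m; lra.
have ln0 : 0 <= ln (n m)%:R :> R by rewrite ln_ge0// ler1n.
have lE : L m = ln (n m)%:R - 2 * ln (p m) by exact: levelE.
have oE : ln (odds m) = ln (1 - p m) - ln (p m) + ln (delta0 m / deltaA m).
  by rewrite /odds -mulf_div (@lnM R ((1 - p m) / p m)) ?posrE ?divr_gt0// (@ln_div R (1 - p m)) ?posrE.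
rewrite oE; have h4 : - 2 * ln (1 / 2) / (eta / 2) <= ln (n m)%:R by near: m; exact: near_ln_n_ge.
rewrite (ler_pdivrMr _ _ e2) in h4.
have h8 : eta * ln (p m) <= 0 by rewrite pmulr_rle0// ltW.
have h5 : 0 <= eta / 2 * ln (n m)%:R by rewrite mulr_ge0// ltW.
case/andP: h1 => h6 h7.
rewrite lE; apply/andP; split; lra.
Unshelve. all: by end_near. Qed.

(** sqrt L = o(sqrt n), so thresholds of order sqrt L stay in the window where the mass bounds
    hold. *)
Lemma sqrt_level_lt (A t : R) : 0 <= A -> 0 < t -> \forall m \near \oo,
  A * Num.sqrt (L m) + 1 < r m * t.
Proof.
move=> A0 t0; have h := sqrt_level_div_cvg0 p01 ltmn ny c0 mp_ge.
have e0 : 0 < t / (sigma * (A + 2)) by rewrite divr_gt0// mulr_gt0//; lra.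
near=> m.
have L1 : 1 <= L m by near: m; exact: near_level_ge.
have s1 : 1 <= Num.sqrt (L m) by rewrite -(@sqrtr1 R) ler_wsqrtr.
have : Num.sqrt (L m) / Num.sqrt (n m)%:R <= t / (sigma * (A + 2)) by near: m; exact: near_le_of_cvg h e0.
rewrite ler_pdivrMr// => hs.
apply: (@lt_le_trans _ _ ((A + 2) * Num.sqrt (L m))); first by lra.
rewrite mulrC -ler_pdivlMr; last by lra.
apply: le_trans hs _; rewrite /r le_eqVlt; apply/orP; left; apply/eqP; field.
by rewrite !lt0r_neq0//; lra.
Unshelve. all: by end_near. Qed.

Let ln_r m : ln (r m) = ln (n m)%:R / 2 - ln sigma.
Proof.
rewrite /r ln_div ?posrE//; congr (_ - _).
have {2}-> : (n m)%:R = Num.sqrt (n m)%:R ^+ 2 :> R by rewrite sqr_sqrtr ?ltW.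
by rewrite lnXn// mulr2n; lra.
Qed.

(** Up to constants the logarithm of the mass is at most (x^2 - ln n) / 2, while ln(odds) is (L - ln
    n) / 2 up to o(L). So sqrt L is the critical size of x, and q < 1 leaves a margin of order L. *)
Lemma tilted_mass_lt_odds q : 0 < q < 1 -> \forall m \near \oo, forall b x,
  0 <= x -> x <= q * Num.sqrt (L m) -> (tilted_mass nu b (r m) x < (odds m)%:E)%E.
Proof.
move=> /andP[q_0 q1]; have [e0 [C [e00 C0 hle]]] := tilted_mass_le hC.
pose eta := (1 - q ^+ 2) / 2.
have q21 : q ^+ 2 < 1 by rewrite exprn_ilt1// ltW.
have eta0 : 0 < eta by rewrite /eta; lra.
near=> m => b x x0 xq.
have L1 : 1 <= L m by near: m; exact: near_level_ge.
have xr : x <= r m * e0.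
  apply: le_trans xq _; have : q * Num.sqrt (L m) + 1 < r m * e0 by near: m; apply: sqrt_level_lt => //; exact: ltW.
  lra.
apply: le_lt_trans (hle b (r m) x (r0 m) x0 xr) _; rewrite lte_fin.
rewrite -ltr_ln ?posrE ?odds_gt0 ?divr_gt0 ?mulr_gt0 ?expR_gt0//.
rewrite ln_scaled_expR// ln_r.
have x2 : x ^+ 2 <= q ^+ 2 * L m.
  rewrite -[L m]sqr_sqrtr; last lra.
  by rewrite -exprMn ler_pXn2r ?nnegrE// mulr_ge0// ?sqrtr_ge0// ltW.
have /andP[h1 _] : (1 - eta) * L m <= 2 * ln (odds m) + ln (n m)%:R <= (1 + eta) * L m.
  by near: m; exact: ln_odds_near.
have h2 : (2 * ln C + 2 * ln sigma + 1) / eta <= L m by near: m; exact: near_level_ge.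
rewrite ler_pdivrMr// in h2.
have h3 : (1 - eta) * L m = q ^+ 2 * L m + L m * eta by rewrite /eta; lra.
lra.
Unshelve. all: by end_near. Qed.

Lemma odds_lt_tilted_mass q : 1 < q -> \forall m \near \oo, forall b x,
  q * Num.sqrt (L m) <= x -> ((odds m)%:E < tilted_mass nu b (r m) x)%E.
Proof.
move=> q1; have [t0 [C [t00 C0 hge]]] := tilted_mass_ge hC.
have q_0 : 0 < q by apply: lt_trans q1.
have q21 : 1 < q ^+ 2 by rewrite exprn_egt1.
pose eta := (q ^+ 2 - 1) / 2.
have eta0 : 0 < eta by rewrite /eta; lra.
near=> m => b x xq.
have L1 : 1 <= L m by near: m; exact: near_level_ge.
have s1 : 1 <= Num.sqrt (L m) by rewrite -(@sqrtr1 R) ler_wsqrtr.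
have y1 : 1 <= q * Num.sqrt (L m) by rewrite -[leLHS]mulr1 ler_pM// ltW.
have yr : q * Num.sqrt (L m) + 1 < r m * t0 by near: m; apply: sqrt_level_lt => //; exact: ltW.
apply: lt_le_trans (hge b (r m) (q * Num.sqrt (L m)) x (r0 m) y1 yr xq); rewrite lte_fin.
rewrite -ltr_ln ?posrE ?odds_gt0 ?divr_gt0 ?mulr_gt0 ?expR_gt0//.
rewrite ln_scaled_expR// ln_r.
rewrite exprMn sqr_sqrtr; last lra.
have /andP[_ h1] : (1 - eta) * L m <= 2 * ln (odds m) + ln (n m)%:R <= (1 + eta) * L m.
  by near: m; exact: ln_odds_near.
have h2 : (- 2 * ln C - 2 * ln sigma + 1) / eta <= L m by near: m; exact: near_level_ge.
rewrite ler_pdivrMr// in h2.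
have h3 : (1 + eta) * L m = q ^+ 2 * L m - L m * eta by rewrite /eta; lra.
lra.
Unshelve. all: by end_near. Qed.

(** Reflecting the lower threshold makes both cuts positive, so that one argument with the sign b
    covers them. *)
Definition oracle_cut (b : bool) m : R :=
  if b then - oracle_lower sigma nu (n m) (p m) (delta0 m) (deltaA m)
  else oracle_upper sigma nu (n m) (p m) (delta0 m) (deltaA m).

(** The intermediate value theorem between sqrt L / 2 and 2 sqrt L yields a solution of each sign,
    so [get] returns a solution and not its default value. *)
Lemma oracle_cutP : \forall m \near \oo, forall b,
  0 < oracle_cut b m /\ tilted_mass nu b (r m) (r m * oracle_cut b m) = (odds m)%:E.
Proof.
near=> m => b.
have [x x0 xE] : exists2 x, 0 < x & tilted_mass nu b (r m) x = (odds m)%:E.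
  have L1 : 1 <= L m by near: m; exact: near_level_ge.
  have s0 : 0 < Num.sqrt (L m) by rewrite sqrtr_gt0; lra.
  have h1 : (tilted_mass nu b (r m) (1 / 2 * Num.sqrt (L m)) < (odds m)%:E)%E.
    have h : forall b x, 0 <= x -> x <= 1 / 2 * Num.sqrt (L m) -> (tilted_mass nu b (r m) x < (odds m)%:E)%E.
      by near: m; apply: tilted_mass_lt_odds; apply/andP; split; lra.
    by apply: h => //; rewrite mulr_ge0 ?divr_ge0// ltW.
  have h2 : ((odds m)%:E < tilted_mass nu b (r m) (2 * Num.sqrt (L m)))%E.
    have h : forall b x, 2 * Num.sqrt (L m) <= x -> ((odds m)%:E < tilted_mass nu b (r m) x)%E.
      by near: m; apply: odds_lt_tilted_mass; lra.
    exact: h.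
  have h12 : 1 / 2 * Num.sqrt (L m) <= 2 * Num.sqrt (L m) by lra.
  have [x /andP[x1 _] xE] := tilted_root h12 (ltW h1) (ltW h2).
  by exists x => //; lra.
have thE (b : bool) a := oracle_thresholdE nu (delta0 m) b a sigma_gt0 (n0 m) (p0 m) (deltaA_gt0 m).
have xr : r m * (x / r m) = x by rewrite mulrCA divff ?mulr1// gt_eqF.
have xr0 : 0 < x / r m by rewrite divr_gt0.
rewrite /oracle_cut; case: b x xE x0 xr xr0 => x xE x0 xr xr0.
  have [|lt0 /(thE true)] := @getPex R
     [set a | a < 0 /\ oracle_threshold sigma nu (n m) (p m) (delta0 m) (deltaA m) a].
    exists (- (x / r m)); split; first by rewrite oppr_lt0.
    by apply/(thE true); rewrite -/(r m) mulrN xr expr1 mulN1r opprK.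
  by rewrite oppr_gt0; split => //; rewrite mulrN -mulN1r -(expr1 (-1)).
have [|lt0 /(thE false)] := @getPex R
   [set a | 0 < a /\ oracle_threshold sigma nu (n m) (p m) (delta0 m) (deltaA m) a].
  exists (x / r m); split => //.
  by apply/(thE false); rewrite -/(r m) xr expr0 mul1r.
by rewrite expr0 mul1r.
Unshelve. all: by end_near. Qed.

Lemma oracle_cut_gt q : 0 < q < 1 -> \forall m \near \oo, forall b,
  q * Num.sqrt (L m) < r m * oracle_cut b m.
Proof.
move=> q01; near=> m => b.
have [x0 xE] : 0 < oracle_cut b m /\ tilted_mass nu b (r m) (r m * oracle_cut b m) = (odds m)%:E.
  by move: b; near: m; exact: oracle_cutP.
rewrite ltNge; apply/negP => h.
have : (tilted_mass nu b (r m) (r m * oracle_cut b m) < (odds m)%:E)%E.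
  have x0' : 0 <= r m * oracle_cut b m by rewrite mulr_ge0// ltW.
  by move: b (r m * _) x0' h {x0 xE}; near: m; exact: tilted_mass_lt_odds.
by rewrite xE ltxx.
Unshelve. all: by end_near. Qed.

Lemma oracle_cut_lt q : 1 < q -> \forall m \near \oo, forall b,
  r m * oracle_cut b m < q * Num.sqrt (L m).
Proof.
move=> q1; near=> m => b.
have [x0 xE] : 0 < oracle_cut b m /\ tilted_mass nu b (r m) (r m * oracle_cut b m) = (odds m)%:E.
  by move: b; near: m; exact: oracle_cutP.
rewrite ltNge; apply/negP => h.
have : ((odds m)%:E < tilted_mass nu b (r m) (r m * oracle_cut b m))%E.
  by move: b (r m * _) h {x0 xE}; near: m; exact: odds_lt_tilted_mass.
by rewrite xE ltxx.
Unshelve. all: by end_near. Qed.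

(** At the cut x the odds equal the tilted mass, which is at most a constant times exp(x^2 / 2) /
    sqrt n; the Gaussian factor cancels the exponential exactly. *)
Lemma odds_tail : exists2 C : R, 0 < C & \forall m \near \oo, forall b,
  odds m * expR (- (r m * oracle_cut b m) ^+ 2 / 2) <= C / Num.sqrt (n m)%:R.
Proof.
have [e0 [C [e00 C0 hle]]] := tilted_mass_le hC.
exists (C * sigma); first by rewrite mulr_gt0.
near=> m => b.
have [x0 xE] : 0 < oracle_cut b m /\ tilted_mass nu b (r m) (r m * oracle_cut b m) = (odds m)%:E.
  by move: b; near: m; exact: oracle_cutP.
have xl : r m * oracle_cut b m < 2 * Num.sqrt (L m).
  by move: b {x0 xE}; near: m; apply: oracle_cut_lt; rewrite ltr1n.
have xr : r m * oracle_cut b m <= r m * e0.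
  have : 2 * Num.sqrt (L m) + 1 < r m * e0 by near: m; exact: sqrt_level_lt.
  lra.
have x0' : 0 <= r m * oracle_cut b m by rewrite mulr_ge0// ltW.
have := hle b (r m) _ (r0 m) x0' xr; rewrite xE lee_fin.
set x := r m * _ => h.
have eE : expR (- x ^+ 2 / 2) = (expR (x ^+ 2 / 2))^-1 by rewrite -expRN mulNr.
rewrite eE ler_pdivrMr ?expR_gt0//; apply: le_trans h _.
rewrite /r le_eqVlt; apply/orP; left; apply/eqP; field.
by rewrite !lt0r_neq0.
Unshelve. all: by end_near. Qed.

End oracle_cuts.

(** * Asymptotics of the two risks *)

Section rule_sequences.
Variables (R : realType) (sigma : R) (nu : probability (measurableTypeR R) R)
  (n : nat -> nat) (p : nat -> R).
Hypotheses (sigma_gt0 : 0 < sigma) (nu_0 : nu [set 0] = 0%E) (p01 : forall m, 0 < p m < 1)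
  (ltmn : forall m, (m < n m)%N) (ny : n m @[m --> \oo] --> \oo)
  (hC : assumption_C nu).
Variables (c kappa : R).
Hypotheses (c0 : 0 < c) (mp_ge : \forall m \near \oo, c <= m%:R * p m)
  (kappa_gt0 : 0 < kappa)
  (nuk : fine (nu [set x : R | `|x| < s]%R) / s @[s --> 0^'+] --> kappa).
Local Notation L := (level n p).
Local Notation D := (risk_order n p sigma kappa).
Local Notation h m x := (signal_below nu sigma (n m) x).

Variables (d : nat -> measure_display) (T : forall m, measurableType (d m))
  (P : forall m, probability (T m) R)
  (V : forall m, 'I_m -> T m -> measurableTypeR R * measurableTypeR R)
  (J : nat -> {measure set (measurableTypeR R * measurableTypeR R) -> \bar R}).
Arguments V : clear implicits.
Hypotheses (JE : forall m B, measurable B ->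
    J m B = ((1 - p m)%:E * normal_prob 0 sigma [set z | B (0%R, z)]
      + (p m)%:E * (nu \x normal_prob 0 sigma) B)%E)
  (indepV : forall m, indep_laws (P m) (V m) (fun=> J m)).

Let p0 m : 0 < p m. Proof. by have /andP[] := p01 m. Qed.
Let n0 m : (0 < n m)%N. Proof. exact: leq_trans (ltmn m). Qed.
Let n0R m : 0 < (n m)%:R :> R. Proof. by rewrite ltr0n. Qed.
Let sn0 m : 0 < Num.sqrt (n m)%:R :> R. Proof. by rewrite sqrtr_gt0. Qed.

Definition false_positives (S : forall m, T m -> {set 'I_m}) m : R :=
  \sum_i fine (P m (false_positive (V m) (S m) i)).
Definition false_negatives (S : forall m, T m -> {set 'I_m}) m : R :=
  \sum_i fine (P m (false_negative (V m) (S m) i)).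

Lemma false_positives_ge0 S m : 0 <= false_positives S m.
Proof. by apply: sumr_ge0 => i _; exact: fine_ge0. Qed.

Section thresholding.
Variables (S : forall m, T m -> {set 'I_m}) (C : R).
Arguments S : clear implicits.
Hypotheses (mS : forall m M, measurable [set w | S m w = M])
  (S_in : \forall m \near \oo, forall w i, i \in S m w ->
     rule_lo n C m #|S m w| <= stat sigma (n m) (V m i w))
  (S_out : \forall m \near \oo, forall w i, i \notin S m w ->
     stat sigma (n m) (V m i w) <= rule_up n C m #|S m w|.+1).

Let alpha m : R := 2 * expR (C / 2) / Num.sqrt (n m)%:R.

Let alpha_small : \forall m \near \oo, 0 <= alpha m <= 4^-1.
Proof.
have h : alpha m @[m --> \oo] --> 0.
  apply: (cvg_to_eq (a := 2 * expR (C / 2) * 0)); last by rewrite mulr0.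
  by apply: cvgM; [exact: cvg_cst|apply: cvg_invr_sqrt; exact: n_cvgy].
have h4 : 0 < 4^-1 :> R by rewrite invr_gt0.
near=> m; apply/andP; split; last by near: m; exact: near_le_of_cvg h h4.
by rewrite divr_ge0 ?mulr_ge0 ?expR_ge0 ?sqrtr_ge0.
Unshelve. all: by end_near. Qed.

Lemma rule_false_positives : \forall m \near \oo,
  0 <= false_positives S m <= 4 * expR (C / 2) * (1 + m%:R * p m) / Num.sqrt (n m)%:R.
Proof.
near=> m; rewrite false_positives_ge0/=.
have m0 : (0 < m)%N by near: m; exact: near_index_gt0.
have a4 : 0 <= alpha m <= 4^-1 by near: m.
have hin : forall w i, i \in S m w -> rule_lo n C m #|S m w| <= stat sigma (n m) (V m i w) by near: m.
have hmono : forall k k', (0 < k <= k')%N -> (k' <= m)%N -> rule_lo n C m k' <= rule_lo n C m k.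
  by near: m; exact: rule_lo_mono.
have htail : forall k, (0 < k <= m)%N ->
  (normal_prob 0 sigma [set z | (rule_lo n C m k <= stat sigma (n m) (0%R, z))%R] <=
    (alpha m * k%:R / m%:R)%:E)%E by near: m; exact: rule_null_tail.
apply: (@le_trans _ _ (\sum_(i < m) (alpha m / m%:R * (2 * (1 + m%:R * p m))))).
  apply: ler_sum => i _.
  exact: (false_positive_le (p01 m) nu_0 (@JE m) (indepV m) (measurable_stat sigma (n m)) (@mS m) hin 0 hmono a4 htail i).
rewrite sumr_const card_ord -mulr_natl /alpha le_eqVlt; apply/orP; left; apply/eqP; field.
by rewrite !lt0r_neq0// ltr0n.
Unshelve. all: by end_near. Qed.

Lemma rule_false_negatives_ge q : 0 < q < 1 -> \forall m \near \oo,
  m%:R * p m * (h m (q ^+ 2 * L m) * (1 - 2 / L m)) <= false_negatives S m.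
Proof.
move=> q01; near=> m.
have m0 : (0 < m)%N by near: m; exact: near_index_gt0.
have a4 : 0 <= alpha m <= 4^-1 by near: m.
have hin : forall w i, i \in S m w -> rule_lo n C m #|S m w| <= stat sigma (n m) (V m i w) by near: m.
have hmono : forall k k', (0 < k <= k')%N -> (k' <= m)%N -> rule_lo n C m k' <= rule_lo n C m k.
  by near: m; exact: rule_lo_mono.
have htail : forall k, (0 < k <= m)%N ->
  (normal_prob 0 sigma [set z | (rule_lo n C m k <= stat sigma (n m) (0%R, z))%R] <=
    (alpha m * k%:R / m%:R)%:E)%E by near: m; exact: rule_null_tail.
have hlo : forall k, (0 < k <= m)%N -> k%:R <= (1 + m%:R * p m) * L m -> q ^+ 2 * L m <= rule_lo n C m k.
  by near: m; exact: (rule_lo_ge _ _ _ c0).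
have L1 : 1 <= L m by near: m; exact: near_level_ge.
have mp0 : 0 < 1 + m%:R * p m by rewrite addr_gt0// mulr_gt0// ltr0n.
(* This K is L / 2 times the bound 2 (1 + m p) on the mean step-up number, whence the factor 1 - 2 /
   L. *)
have K0 : 0 < (1 + m%:R * p m) * L m by rewrite mulr_gt0//; lra.
have fn i := false_negative_ge (p01 m) nu_0 (@JE m) (indepV m) (measurable_stat sigma (n m)) (@mS m) hin hmono a4 htail i K0 hlo.
apply: le_trans (ler_sum _ (fun i _ => fn i)).
rewrite sumr_const card_ord -[leRHS]mulr_natl -/(signal_below _ _ _ _) le_eqVlt; apply/orP; left; apply/eqP.
field; by rewrite !lt0r_neq0//; lra.
Unshelve. all: by end_near. Qed.

Let stat_le_lt m x y : x < y ->
  signal_prob nu (normal_prob 0 sigma) [set v | stat sigma (n m) v <= x] <= h m y.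
Proof.
move=> xy; apply: le_signal_prob; last by move=> v /= /le_lt_trans; apply.
  rewrite (_ : mkset _ = ~` [set v | x < stat sigma (n m) v]); last first.
    by apply/seteqP; split => v /=; rewrite leNgt => /negP.
  apply: measurableC.
  rewrite (_ : mkset _ = (stat sigma (n m) : measurableTypeR R * measurableTypeR R -> R) @^-1` `]x, +oo[).
    rewrite -[X in measurable X]setTI; apply: measurable_stat => //; exact: measurableT.
  by apply/seteqP; split => v; rewrite /= in_itv/= andbT.
exact: measurable_stat_lt.
Qed.

Lemma rule_false_negatives_bounded (B : R) : (\forall m \near \oo, m%:R * p m <= B) ->
  false_negatives S m / D m @[m --> \oo] --> (1 : R).
Proof.
move=> mpB; apply: (false_negatives_cvg p01 ltmn ny c0 mp_ge sigma_gt0 hC kappa_gt0 nuk (e := fun=> 0)).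
- exact: rule_false_negatives_ge.
- exact: cvg_cst.
move=> q q1; near=> m; rewrite mul0r addr0.
have mpB' : m%:R * p m <= B * 1%:R by rewrite mulr1; near: m.
have hup : rule_up n C m 1%N < q ^+ 2 * L m.
  have hu : forall k, (0 < k)%N -> m%:R * p m <= B * k%:R -> rule_up n C m k < q ^+ 2 * L m.
    by near: m; exact: rule_up_lt.
  exact: hu.
have hout : forall w i, i \notin S m w -> stat sigma (n m) (V m i w) <= rule_up n C m #|S m w|.+1 by near: m.
have fn i := false_negative_le_up1 nu_0 (@JE m) (indepV m) (measurable_stat sigma (n m)) (@mS m) hout i
   (@rule_up_mono R n ltmn C m).
apply: (@le_trans _ _ (\sum_(i < m) (p m * h m (q ^+ 2 * L m)))).
  apply: ler_sum => i _; apply: le_trans (fn i) _.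
  by apply: ler_wpM2l; [exact: ltW|exact: stat_le_lt].
by rewrite sumr_const card_ord -[leLHS]mulr_natl mulrA.
Unshelve. all: by end_near. Qed.

Lemma rule_false_negatives_dense : m%:R * p m @[m --> \oo] --> (+oo : set_system R) ->
  false_negatives S m / D m @[m --> \oo] --> (1 : R).
Proof.
(* Let z = m p / 8 and y its integer part. The chance that fewer than y other signals exceed the
   largest threshold is at most 2^y (1 - p / 4)^(m - 1) <= exp(z) exp(- 2 z + 1/4) <= 2 / z, which
   is [e m]. *)
move=> mpy; pose e m : R := 2 / (m%:R * p m / 8).
have mpy' : m%:R * p m / 8 @[m --> \oo] --> (+oo : set_system R).
  apply/cvgryPge => A; move/cvgryPge : mpy => /(_ (A * 8)).
  by apply: filterS => m; rewrite ler_pdivlMr.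
have e_0 : e m @[m --> \oo] --> 0.
  apply: (cvg_to_eq (a := 2 * 0)); last by rewrite mulr0.
  by apply: cvgM; [exact: cvg_cst|exact: cvgVy0].
apply: (false_negatives_cvg p01 ltmn ny c0 mp_ge sigma_gt0 hC kappa_gt0 nuk (e := e)) => //.
  exact: rule_false_negatives_ge.
move=> q q1; near=> m.
have m0 : (0 < m)%N by near: m; exact: near_index_gt0.
have mp0 : 0 < m%:R * p m by rewrite mulr_gt0// ltr0n.
have hup : forall k, (0 < k)%N -> m%:R * p m <= 8 * k%:R -> rule_up n C m k < q ^+ 2 * L m.
  by near: m; exact: rule_up_lt.
have hout : forall w i, i \notin S m w -> stat sigma (n m) (V m i w) <= rule_up n C m #|S m w|.+1 by near: m.
pose y := Num.truncn (m%:R * p m / 8).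
have y_le : y%:R <= m%:R * p m / 8 by rewrite truncn_le divr_ge0// ltW.
pose T0 := rule_up n C m y.+1.
have T0q : T0 < q ^+ 2 * L m.
  by apply: hup => //; have := truncnS_gt (m%:R * p m / 8); rewrite -/y ltr_pdivrMr//; lra.
have upy k : (y < k <= m)%N -> rule_up n C m k <= T0.
  by move=> /andP[yk km]; rewrite lerD2r; apply: le_log_level.
have fn i := false_negative_le_dense nu_0 (@JE m) (indepV m) (measurable_stat sigma (n m)) (@mS m) hout i
   (@rule_up_mono R n ltmn C m) upy.
apply: (@le_trans _ _ (\sum_(i < m) (p m * (h m (q ^+ 2 * L m) + e m * h m (2 ^+ 2 * L m))))); last first.
  by rewrite sumr_const card_ord -[leLHS]mulr_natl mulrA.
apply: ler_sum => i _; apply: le_trans (fn i) _; rewrite [leRHS]mulrDr.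
have up4 : rule_up n C m 1%N < 2 ^+ 2 * L m by near: m; exact: rule_up1_lt.
have h4 : h m (2 ^+ 2 * L m) <= 2^-1 by near: m; exact: (signal_below4_small _ _ _ c0 mp_ge _ hC kappa_gt0 nuk).
set u := signal_prob _ _ [set v | stat sigma (n m) v <= rule_up n C m 1%N].
have u0 : 0 <= u by exact: signal_prob_ge0.
have uh : u <= h m (2 ^+ 2 * L m) by exact: stat_le_lt.
apply: lerD; first by apply: ler_wpM2l; [exact: ltW|exact: stat_le_lt].
rewrite -mulrA; apply: ler_wpM2l; first exact: ltW.
rewrite [leRHS]mulrC.
have pu0 : 0 <= 1 - 2^-1 * (p m * (1 - u)).
  have /andP[_ p1] := p01 m; have : p m * (1 - u) <= 1 * 1 by apply: ler_pM; rewrite ?(ltW (p0 m))//; lra.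
  lra.
apply: ler_pM => //; first by rewrite mulr_ge0// exprn_ge0.
have base : 1 - 2^-1 * (p m * (1 - u)) <= expR (- p m / 4).
  apply: le_trans (expR_ge1Dx _); rewrite lerD2l.
  have : 2^-1 <= 1 - u by lra.
  have := p0 m; nra.
set z := m%:R * p m / 8 in y_le *.
have z0 : 0 < z by rewrite divr_gt0.
have two_y : 2 ^+ y <= expR z.
  apply: (@le_trans _ _ (expR 1 ^+ y)).
    by apply: lerXn2r; rewrite ?nnegrE ?expR_ge0//; have := expR_ge1Dx (1 : R); lra.
  by rewrite -expRM_natl mulr1 ler_expR.
have base_m : (1 - 2^-1 * (p m * (1 - u))) ^+ m.-1 <= expR (- (2 * z) + 1 / 4).
  apply: (@le_trans _ _ (expR (- p m / 4) ^+ m.-1)).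
    by apply: lerXn2r; rewrite ?nnegrE ?expR_ge0.
  rewrite -expRM_natl ler_expR -subn1 natrB// /z.
  by have /andP[_ p1] := p01 m; lra.
apply: (@le_trans _ _ (expR z * expR (- (2 * z) + 1 / 4))).
  by apply: ler_pM => //; exact: exprn_ge0.
rewrite -expRD (_ : z + _ = - z + 1 / 4); last by ring.
rewrite expRD /e -/z mulrC; apply: ler_pM; rewrite ?expR_ge0//.
  have h1 := expR_ge1Dx (- (1 / 4) : R).
  rewrite -[leLHS]invrK -expRN -[leRHS]invrK lef_pV2 ?posrE ?expR_gt0 ?invr_gt0//.
  by apply: le_trans h1; lra.
rewrite expRN lef_pV2 ?posrE ?expR_gt0//; have := expR_ge1Dx z; lra.
Unshelve. all: by end_near. Qed.

Lemma rule_false_negatives (s : \bar R) : (0 < s)%E ->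
  (m%:R * p m)%:E @[m --> \oo] --> s ->
  false_negatives S m / D m @[m --> \oo] --> (1 : R).
Proof.
case: s => [s| |] // s0 mps.
  apply: (@rule_false_negatives_bounded (s + 1)).
  have mps' : m%:R * p m @[m --> \oo] --> s by exact: (fine_cvg mps).
  by apply: near_le_of_cvg mps' _; rewrite ltrDl.
apply: rule_false_negatives_dense.
by apply/cvgeryP.
Qed.

End thresholding.
End rule_sequences.

Lemma measurable_rule_members d (T : measurableType d) m (S : T -> {set 'I_m}) :
  (forall i, measurable [set w | i \in S w]) -> forall M, measurable [set w | S w = M].
Proof.
move=> mS M; rewrite (_ : mkset _ = [set w | forall i, (i \in S w) = (i \in M)]).
  have := @measurable_forall_fin _ _ _ (fun i => [set w | (i \in S w) = (i \in M)]) xpredT.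
  rewrite (_ : [set w | _] = [set w | forall i, (i \in S w) = (i \in M)]).
    by apply => i _; exact: measurable_bool_eq.
  by apply/seteqP; split => w /= h i //; exact: h.
by apply/seteqP; split => w /=; [move=> ->|move=> h; apply/setP].
Qed.

(** * The risk of the oracle *)

Section oracle_sequences.
Variables (R : realType) (sigma : R) (nu : probability (measurableTypeR R) R)
  (n : nat -> nat) (p delta0 deltaA : nat -> R).
Hypotheses (sigma_gt0 : 0 < sigma) (nu_0 : nu [set 0] = 0%E) (p01 : forall m, 0 < p m < 1)
  (delta0_gt0 : forall m, 0 < delta0 m) (deltaA_gt0 : forall m, 0 < deltaA m)
  (ltmn : forall m, (m < n m)%N)
  (hB : assumption_B n p (fun m => delta0 m / deltaA m)) (hC : assumption_C nu).
Variables (c kappa : R).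
Hypotheses (c0 : 0 < c) (mp_ge : \forall m \near \oo, c <= m%:R * p m)
  (kappa_gt0 : 0 < kappa)
  (nuk : fine (nu [set x : R | `|x| < s]%R) / s @[s --> 0^'+] --> kappa).
Local Notation L := (level n p).
Local Notation D := (risk_order n p sigma kappa).
Local Notation h m x := (signal_below nu sigma (n m) x).
Local Notation U2 := (measurableTypeR R * measurableTypeR R)%type.

Variables (d : nat -> measure_display) (T : forall m, measurableType (d m))
  (P : forall m, probability (T m) R)
  (V : forall m, 'I_m -> T m -> measurableTypeR R * measurableTypeR R)
  (J : nat -> {measure set (measurableTypeR R * measurableTypeR R) -> \bar R}).
Arguments V : clear implicits.
Hypotheses (JE : forall m B, measurable B ->
    J m B = ((1 - p m)%:E * normal_prob 0 sigma [set z | B (0%R, z)]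
      + (p m)%:E * (nu \x normal_prob 0 sigma) B)%E)
  (indepV : forall m, indep_laws (P m) (V m) (fun=> J m)).

Let p0 m : 0 < p m. Proof. by have /andP[] := p01 m. Qed.
Let n0 m : (0 < n m)%N. Proof. exact: leq_trans (ltmn m). Qed.
Let n0R m : 0 < (n m)%:R :> R. Proof. by rewrite ltr0n. Qed.
Let sn0 m : 0 < Num.sqrt (n m)%:R :> R. Proof. by rewrite sqrtr_gt0. Qed.
Let ny : n m @[m --> \oo] --> \oo. Proof. by case: hB. Qed.
Let r m := Num.sqrt (n m)%:R / sigma.
Let r0 m : 0 < r m. Proof. by rewrite divr_gt0. Qed.

Local Notation lower m := (oracle_lower sigma nu (n m) (p m) (delta0 m) (deltaA m)).
Local Notation upper m := (oracle_upper sigma nu (n m) (p m) (delta0 m) (deltaA m)).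
Local Notation cut b m := (oracle_cut sigma nu n p delta0 deltaA b m).

Definition accept m : set U2 :=
  [set v | (lower m < v.1 + (Num.sqrt (n m)%:R)^-1 * v.2) &&
           (v.1 + (Num.sqrt (n m)%:R)^-1 * v.2 < upper m)].

Definition oracle_rule m (w : T m) : {set 'I_m} :=
  [set i | ~~ ((lower m < (V m i w).1 + (Num.sqrt (n m)%:R)^-1 * (V m i w).2) &&
           ((V m i w).1 + (Num.sqrt (n m)%:R)^-1 * (V m i w).2 < upper m))]%SET.

Lemma measurable_accept m : measurable (accept m).
Proof.
have mf : measurable_fun [set: U2] (fun v => v.1 + (Num.sqrt (n m)%:R)^-1 * v.2 : R).
  by apply: (@measurable_funD _ _ R) => //; apply: measurable_funM.
rewrite (_ : accept m = (fun v : U2 => v.1 + (Num.sqrt (n m)%:R)^-1 * v.2 : R) @^-1` `](lower m), (upper m)[).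
  by rewrite -[X in measurable X]setTI; apply: mf => //; exact: measurableT.
by apply/seteqP; split => v; rewrite /accept /= in_itv/=.
Qed.

Let in_oracle m w i : reflect (~ accept m (V m i w)) (i \in oracle_rule w).
Proof. by rewrite finset.inE; exact: negP. Qed.

Lemma measurable_oracle_rule m M : measurable [set w : T m | oracle_rule w = M].
Proof.
apply: measurable_rule_members => i.
rewrite (_ : mkset _ = V m i @^-1` ~` accept m).
  by apply: (measurable_pairs_preimage (indepV m)); apply: measurableC; exact: measurable_accept.
by apply/seteqP; split => w /= /in_oracle.
Qed.

Lemma oracle_false_negativeE m i :
  fine (P m (false_negative (V m) (@oracle_rule m) i)) =
  p m * signal_prob nu (normal_prob 0 sigma) (accept m).
Proof.
rewrite (_ : false_negative _ _ _ = V m i @^-1` (accept m `&` [set v | v.1 != 0])).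
  rewrite (pair_law (@JE m) (indepV m)); last first.
    apply: measurableI; first exact: measurable_accept.
    rewrite (_ : mkset _ = [set v : U2 | (~` [set 0]) v.1]); last by apply/seteqP; split => v /= /eqP.
    exact: (measurable_fst_preimage (measurableC (measurable_set1 0))).
  by rewrite (slab_signal nu_0 (@JE m) (measurable_accept m)).
apply/seteqP; split => w /= [h v0]; split => //.
  by apply: contrapT => a; move/negP: h; apply; exact/in_oracle.
by apply/negP => /in_oracle.
Qed.

Lemma oracle_false_positiveE m i :
  P m (false_positive (V m) (@oracle_rule m) i) =
  ((1 - p m)%:E * normal_prob 0 sigma [set z | ~ accept m (0%R, z)])%E.
Proof.
rewrite (_ : false_positive _ _ _ = V m i @^-1` (~` accept m `&` [set v | v.1 = 0])).
  rewrite (pair_law (@JE m) (indepV m)); last first.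
    apply: measurableI; first by apply: measurableC; exact: measurable_accept.
    exact: (measurable_fst_preimage (measurable_set1 0)).
  by rewrite (slab_null nu_0 (@JE m))//; apply: measurableC; exact: measurable_accept.
by apply/seteqP; split => w /= [h v0]; split => //; apply/in_oracle.
Qed.

(** The weight delta0 / deltaA turns the m (1 - p) expected nulls into m p times the odds, and odds
    times tail is O(1 / sqrt n) at the cuts. *)
Lemma oracle_false_positives : exists2 C : R, 0 <= C & \forall m \near \oo,
  0 <= delta0 m / deltaA m * false_positives P V oracle_rule m <=
    C * (1 + m%:R * p m) / Num.sqrt (n m)%:R.
Proof.
have [C C0 hC'] := odds_tail sigma_gt0 p01 delta0_gt0 deltaA_gt0 ltmn hB hC c0 mp_ge.
exists (2 * C); first by rewrite mulr_ge0// ltW.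
near=> m.
have del0 : 0 < delta0 m / deltaA m by rewrite divr_gt0.
rewrite mulr_ge0 ?false_positives_ge0 ?(ltW del0)//=.
have m0 : (0 < m)%N by near: m; exact: near_index_gt0.
have hcut : forall b, 0 < cut b m /\ tilted_mass nu b (r m) (r m * cut b m) = (odds p delta0 deltaA m)%:E.
  by near: m; exact: (oracle_cutP _ _ _ _ _ hB hC c0).
have htail : forall b, odds p delta0 deltaA m * expR (- (r m * cut b m) ^+ 2 / 2) <= C / Num.sqrt (n m)%:R by near: m.
have hge : forall b, 1 / 2 * Num.sqrt (L m) < r m * cut b m.
  by near: m; apply: (oracle_cut_gt _ _ _ _ _ hB hC c0) => //; apply/andP; split; lra.
have L4 : 2 ^+ 2 <= L m by near: m; exact: near_level_ge.
have s2 : 2 <= Num.sqrt (L m) by rewrite -(ger0_norm (ltW (ltr0Sn R 1))) -sqrtr_sqr ler_wsqrtr.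
have x1 b : 1 <= (r m * cut b m) ^+ 2 by rewrite exprn_ege1//; have := hge b; lra.
have g_le b : (normal_prob 0 sigma [set z : R | ((r m * cut b m) ^+ 2 <= z ^+ 2 / sigma ^+ 2)%R] <=
   (expR (- (r m * cut b m) ^+ 2 / 2))%:E)%E.
  have xb0 : 0 < (r m * cut b m) ^+ 2 by apply: lt_le_trans (x1 b).
  apply: le_trans (normal_prob_sq_tail sigma_gt0 xb0) _; rewrite lee_fin.
  rewrite ler_pdivrMr ?sqrtr_gt0// ler_peMr ?expR_ge0//.
  by rewrite -(@sqrtr1 R) ler_wsqrtr.
have m_tail b : measurable [set z : measurableTypeR R | (r m * cut b m) ^+ 2 <= z ^+ 2 / sigma ^+ 2].
  have mf : measurable_fun [set: measurableTypeR R] (fun z => z ^+ 2 / sigma ^+ 2 : R).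
    by apply: measurable_funM => //; exact: measurable_funX.
  rewrite (_ : mkset _ = (fun z : measurableTypeR R => z ^+ 2 / sigma ^+ 2 : R) @^-1` `[(r m * cut b m) ^+ 2, +oo[).
    by rewrite -[X in measurable X]setTI; apply: mf => //; exact: measurableT.
  by apply/seteqP; split => z; rewrite /= in_itv/= andbT.
have fp i : fine (P m (false_positive (V m) (@oracle_rule m) i)) <=
   (1 - p m) * (expR (- (r m * cut false m) ^+ 2 / 2) + expR (- (r m * cut true m) ^+ 2 / 2)).
  have q0 : 0 <= 1 - p m by have /andP[_] := p01 m; lra.
  rewrite -lee_fin fineK; last by apply: fin_num_measure; exact: (measurable_false_positive (indepV m) (@measurable_oracle_rule m)).
  rewrite oracle_false_positiveE EFinM; apply: lee_wpmul2l; first by rewrite lee_fin.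
  rewrite EFinD; apply: le_trans (leeD (g_le false) (g_le true)).
  apply: le_trans (measureU2 _ (m_tail false) (m_tail true)).
  apply: le_measure; rewrite ?inE; [|by apply: measurableU|].
    by apply: (@measurable_section0 R (~` accept m)); apply: measurableC; exact: measurable_accept.
  move=> z /=; rewrite /accept/= add0r => /negP; rewrite negb_and -!leNgt.
  have az b : cut b m <= `|(Num.sqrt (n m)%:R)^-1 * z| -> (r m * cut b m) ^+ 2 <= z ^+ 2 / sigma ^+ 2.
    move=> h; have [cb _] := hcut b.
    rewrite (_ : z ^+ 2 / sigma ^+ 2 = (`|z| / sigma) ^+ 2); last by rewrite expr_div_n real_normK ?num_real.
    have rc0 : 0 <= r m * cut b m by rewrite mulr_ge0// ltW.
    rewrite ler_pXn2r ?nnegrE//; last by rewrite divr_ge0// ltW.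
    rewrite normrM gtr0_norm ?invr_gt0// mulrC ler_pdivlMr// mulrC in h.
    by rewrite /r mulrAC ler_pM2r ?invr_gt0.
  move=> /orP[h|h]; [right; apply: (az true)|left; apply: (az false)]; rewrite /oracle_cut.
    by rewrite -normrN; apply: le_trans (ler_norm _); rewrite lerN2.
  by apply: le_trans (ler_norm _).
apply: (@le_trans _ _ (delta0 m / deltaA m * \sum_(i < m) ((1 - p m) * (expR (- (r m * cut false m) ^+ 2 / 2) + expR (- (r m * cut true m) ^+ 2 / 2))))).
  apply: ler_wpM2l; first exact: ltW.
  by apply: ler_sum => i _; exact: fp.
rewrite sumr_const card_ord -[_ *+ m]mulr_natl.
have oE : odds p delta0 deltaA m * p m = delta0 m / deltaA m * (1 - p m).
  by rewrite /odds; field; rewrite !lt0r_neq0.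
have t1 := htail false; have t2 := htail true.
set E1 := expR _ in t1 *; set E2 := expR (- (r m * cut true m) ^+ 2 / 2) in t2 *.
have -> : delta0 m / deltaA m * (m%:R * ((1 - p m) * (E1 + E2))) =
  m%:R * p m * (odds p delta0 deltaA m * E1 + odds p delta0 deltaA m * E2).
  by transitivity (m%:R * (odds p delta0 deltaA m * p m) * (E1 + E2)); [rewrite oE|]; ring.
apply: (@le_trans _ _ (m%:R * p m * (C / Num.sqrt (n m)%:R + C / Num.sqrt (n m)%:R))).
  by apply: ler_wpM2l; [rewrite mulr_ge0// ltW|exact: lerD].
have Cs : 0 <= C / Num.sqrt (n m)%:R by rewrite divr_ge0// ltW.
rewrite (_ : 2 * C * _ / _ = (1 + m%:R * p m) * (C / Num.sqrt (n m)%:R + C / Num.sqrt (n m)%:R)); last by ring.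
by apply: ler_wpM2r; [exact: addr_ge0|rewrite lerDr].
Unshelve. all: by end_near. Qed.

Let level_sqr q m : 0 <= L m -> q ^+ 2 * L m = (q * Num.sqrt (L m)) ^+ 2.
Proof. by move=> L0; rewrite exprMn sqr_sqrtr. Qed.

(** Eventually the acceptance region contains the strip of half-width q sigma sqrt(L / n) for q < 1
    and is contained in it for q > 1. *)
Lemma oracle_false_negatives : false_negatives P V oracle_rule m / D m @[m --> \oo] --> (1 : R).
Proof.
have FNE m : false_negatives P V oracle_rule m = m%:R * p m * signal_prob nu (normal_prob 0 sigma) (accept m).
  rewrite /false_negatives; under eq_bigr do rewrite oracle_false_negativeE.
  by rewrite sumr_const card_ord -[LHS]mulr_natl mulrA.
apply: (false_negatives_cvg p01 ltmn ny c0 mp_ge sigma_gt0 hC kappa_gt0 nuk (e := fun=> 0)).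
- move=> q q01; have /andP[q_0 q1] := q01; near=> m; rewrite FNE.
  have mp0 : 0 <= m%:R * p m by rewrite mulr_ge0// ltW.
  have L1 : 1 <= L m by near: m; exact: near_level_ge.
  apply: ler_wpM2l => //.
  have h0 : 0 <= h m (q ^+ 2 * L m) by exact: signal_prob_ge0.
  apply: (@le_trans _ _ (h m (q ^+ 2 * L m))).
    rewrite ler_piMr// lerBlDr lerDl divr_ge0//; lra.
  apply: le_signal_prob; [exact: measurable_stat_lt|exact: measurable_accept|].
  have hge : forall b, q * Num.sqrt (L m) < r m * cut b m.
    by near: m; apply: (oracle_cut_gt _ _ _ _ _ hB hC c0).
  move=> v /=; rewrite level_sqr; last lra.
  rewrite stat_ltE//; last by rewrite mulr_ge0 ?sqrtr_ge0// ltW.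
  set x := _ + _ => hx; rewrite /accept/= -/x.
  have xb b : `|x| < cut b m.
    apply: lt_trans hx _; rewrite mulrA ltr_pdivrMr// mulrC -ltr_pdivlMr//.
    by apply: lt_le_trans (hge b) _; rewrite /r; lra.
  have := xb false; have := xb true; rewrite /oracle_cut !ltr_norml opprK => /andP[h1 _] /andP[_ h2].
  by rewrite h1 h2.
- exact: cvg_cst.
move=> q q1; near=> m; rewrite FNE mul0r addr0.
have mp0 : 0 <= m%:R * p m by rewrite mulr_ge0// ltW.
have L1 : 1 <= L m by near: m; exact: near_level_ge.
apply: ler_wpM2l => //.
apply: le_signal_prob; [exact: measurable_accept|exact: measurable_stat_lt|].
have hlt : forall b, r m * cut b m < q * Num.sqrt (L m).
  by near: m; apply: (oracle_cut_lt _ _ _ _ _ hB hC c0).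
move=> v /=; rewrite /accept/= level_sqr; last lra.
rewrite stat_ltE//; last by rewrite mulr_ge0 ?sqrtr_ge0//; lra.
set x := _ + _ => /andP[h1 h2].
have cb b : cut b m < sigma * (q * Num.sqrt (L m) / Num.sqrt (n m)%:R).
  rewrite mulrA ltr_pdivlMr// (mulrC sigma) -ltr_pdivrMr//.
  by apply: le_lt_trans (hlt b); rewrite /r; lra.
rewrite ltr_norml; apply/andP; split.
  by rewrite ltrNl; apply: le_lt_trans (cb true); rewrite /oracle_cut lerN2 ltW.
by apply: lt_trans (cb false); rewrite /oracle_cut.
Unshelve. all: by end_near. Qed.

End oracle_sequences.

(** * The regression model *)

Lemma measure_bigsetU_le d (T : measurableType d) (R : realType)
    (P : {measure set T -> \bar R}) (I : finType) (F : I -> set T) :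
  (forall i, measurable (F i)) ->
  measurable (\big[setU/set0]_i F i) /\ (P (\big[setU/set0]_i F i) <= \sum_i P (F i))%E.
Proof.
move=> mF; apply: (big_ind2 (fun A x => measurable A /\ (P A <= x)%E)).
- by rewrite measure0.
- move=> A x B y [mA Ax] [mB By]; split; first exact: measurableU.
  by apply: le_trans (measureU2 _ mA mB) _; exact: leeD.
- by move=> i _; split.
Qed.

Section decomposition.
Variables (d : measure_display) (T : measurableType d) (R : realType) (P : probability T R)
  (m : nat) (V : 'I_m -> T -> measurableTypeR R * measurableTypeR R) (S truth : T -> {set 'I_m}).
Hypotheses (truthE : forall w i, (i \in truth w) = ((V i w).1 != 0))
  (mfp : forall i, measurable (false_positive V S i))
  (mfn : forall i, measurable (false_negative V S i)).

Let fpE i : [set w | i \in S w :\: truth w] = false_positive V S i.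
Proof.
apply/seteqP; split => w /=; rewrite finset.inE truthE negbK.
  by move=> /andP[/eqP h iS]; split.
by move=> [iS /= /eqP h]; rewrite h.
Qed.

Let fnE i : [set w | i \in truth w :\: S w] = false_negative V S i.
Proof.
by apply/seteqP; split => w /=; rewrite finset.inE truthE => /andP.
Qed.

Lemma risk_decomposition (delta0 deltaA : R) :
  fine (risk P delta0 deltaA truth S) =
  delta0 * (\sum_i fine (P (false_positive V S i))) +
  deltaA * (\sum_i fine (P (false_negative V S i))).
Proof.
rewrite /risk !expectation_card; last 2 first.
- by move=> i; rewrite fnE.
- by move=> i; rewrite fpE.
under eq_bigr do rewrite fpE -(fineK (fin_num_measure P _ (mfp _))).
under [in X in (_ + X)%E]eq_bigr do rewrite fnE -(fineK (fin_num_measure P _ (mfn _))).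
by rewrite !sumEFin -!EFinM -EFinD.
Qed.

(** The true model is selected exactly when no error of either kind occurs; the bound is the union
    bound. *)
Lemma prob_true_model_ge :
  measurable [set w | S w = truth w] /\
  1 - (\sum_i fine (P (false_positive V S i)) + \sum_i fine (P (false_negative V S i)))
    <= fine (P [set w | S w = truth w]).
Proof.
pose F i := false_positive V S i `|` false_negative V S i.
have mF i : measurable (F i) by exact: measurableU.
have [mU PU] := measure_bigsetU_le P mF.
have E : [set w | S w = truth w] = ~` (\big[setU/set0]_i F i).
  apply/seteqP; split => w /=.
    move=> Sw; rewrite -bigcup_seq => -[i _]; rewrite /F -fpE -fnE /= Sw.
    by rewrite !finset.inE andNb => -[].
  move=> h; apply/setP => i; apply/idP/idP => iS; apply/negPn/negP => iN; apply: h.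
    rewrite -bigcup_seq; exists i; first by rewrite /= mem_index_enum.
    by left; rewrite -fpE /= finset.inE iN.
  rewrite -bigcup_seq; exists i; first by rewrite /= mem_index_enum.
  by right; rewrite -fnE /= finset.inE iN.
rewrite E; split; first exact: measurableC.
rewrite -lee_fin fineK; last by apply: fin_num_measure; exact: measurableC.
rewrite probability_setC// EFinB; apply: leeB => //; apply: le_trans PU _.
rewrite -big_split/= -sumEFin; apply: lee_sum => i _.
rewrite EFinD !fineK; [|exact: fin_num_measure..].
exact: measureU2.
Qed.

End decomposition.

Lemma law_exists d (T : measurableType d) (R : realType) (P : probability T R)
    (b : T -> measurableTypeR R) : measurable_fun setT b ->
  exists mu : probability (measurableTypeR R) R, forall A, mu A = P (b @^-1` A).
Proof.
move=> mb; pose Mb := isMeasurableFun.Build _ _ _ _ b mb.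
pose bm : {mfun T >-> measurableTypeR R} := HB.pack b Mb.
by exists (distribution P bm).
Qed.

Section model.
Variables (R : realType) (n m : nat) (sigma p : R) (nu : probability (measurableTypeR R) R)
  (X : 'M[R]_(n, m.+1)) (d : measure_display) (T : measurableType d) (P : probability T R)
  (beta0 : {RV P >-> R}) (beta : 'I_m -> {RV P >-> R}) (eps : 'I_n -> {RV P >-> R}).
Hypotheses (sigma_gt0 : 0 < sigma) (n0 : (0 < n)%N) (p01 : 0 < p < 1)
  (XX : X^T *m X = n%:R%:M)
  (beta_law : forall (i : 'I_m) (A : set R), measurable A ->
     distribution P (beta i) A = spike_slab p nu A)
  (eps_law : forall (j : 'I_n) (A : set R), measurable A ->
     distribution P (eps j) A = normal_prob 0 sigma A)
  (indep : mutually_independent (sum_family beta eps)).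

(* The second component is sqrt n (bhat_i - beta_i). *)
Definition score (i : 'I_m) (w : T) : measurableTypeR R * measurableTypeR R :=
  (beta i w, \sum_j X j (lift ord0 i) / Num.sqrt n%:R * eps j w).

Let sn0 : 0 < Num.sqrt n%:R :> R. Proof. by rewrite sqrtr_gt0 ltr0n. Qed.

Lemma least_squares_score w i :
  least_squares X (response X beta0 beta eps w) (lift ord0 i) ord0 =
  (score i w).1 + (Num.sqrt n%:R)^-1 * (score i w).2.
Proof.
rewrite /response least_squares_response// mxE liftK /=; congr (_ + _).
have {1}-> : n%:R = Num.sqrt n%:R * Num.sqrt n%:R :> R by rewrite -expr2 sqr_sqrtr.
rewrite invfM -mulrA; congr (_ * _); rewrite mulr_sumr; apply: eq_bigr => j _.
by rewrite mxE; ring.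
Qed.

Lemma true_model_score w i : (i \in true_model beta w) = ((score i w).1 != 0).
Proof. by rewrite finset.inE. Qed.

Lemma score_indep : exists J : {measure set (measurableTypeR R * measurableTypeR R) -> \bar R},
  (forall B, measurable B -> J B = ((1 - p)%:E * normal_prob 0 sigma [set z | B (0%R, z)]
      + p%:E * (nu \x normal_prob 0 sigma) B)%E) /\
  indep_laws P score (fun=> J).
Proof.
have p01' : 0 <= p <= 1 by case/andP: p01 => *; apply/andP; split; exact: ltW.
have [J JE] := slab_law_exists nu (normal_prob 0 sigma : probability (measurableTypeR R) R) p01'.
exists J; split => //.
(* Divided by sqrt n the regressor columns are orthonormal, so the transformed noise is again i.i.d.
   normal with the same variance and independent of the coefficients. *)
pose U : 'M[R]_(m, n) := \matrix_(i, j) (X j (lift ord0 i) / Num.sqrt n%:R).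
have oU : orthonormal_rows U.
  move=> i k; have := congr1 (fun A : 'M[R]_m.+1 => A (lift ord0 i) (lift ord0 k)) XX.
  rewrite !mxE (inj_eq lift_inj) => h.
  transitivity (n%:R^-1 * \sum_j X^T (lift ord0 i) j * X j (lift ord0 k)).
    rewrite mulr_sumr; apply: eq_bigr => j _; rewrite !mxE.
    have -> : n%:R^-1 = (Num.sqrt n%:R)^-1 * (Num.sqrt n%:R)^-1 :> R.
      by rewrite -invfM -expr2 sqr_sqrtr.
    by ring.
  by rewrite h mulrnAr mulVf// pnatr_eq0 -lt0n.
have s0 : sigma != 0 by rewrite gt_eqF.
have h1 := indep_laws_mutually_independent eps_law indep.
have mu_ex i : exists mu : probability (measurableTypeR R) R, forall A, mu A = P (beta i @^-1` A).
  exact: (law_exists P (h1.1 (inl i))).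
have [mu muE] := choice mu_ex.
have h1' : indep_laws P (sum_family (fun i => beta i : T -> measurableTypeR R) (fun j => eps j : T -> measurableTypeR R))
    (sum_family mu (fun=> normal_prob 0 sigma)).
  by apply: indep_laws_eq h1 => -[i|j] A mA //=; rewrite muE.
have h2 := indep_laws_pairs (indep_laws_orthonormal s0 oU h1').
have -> : score = (fun i w => (beta i w : measurableTypeR R, \sum_j U i j * eps j w)).
  by apply/funext => i; apply/funext => w; congr (_, _); apply: eq_bigr => j _; rewrite mxE.
apply: indep_laws_eq h2 => i A mA.
by apply: (spike_slab_productE p01' _ JE mA) => B mB; rewrite muE; exact: beta_law.
Qed.

End model.

Unset Implicit Arguments.

(** * Optimality and consistency of a penalized rule *)

Section optimality.
Variables (R : realType) (sigma : R) (nu : probability (measurableTypeR R) R)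
  (n : nat -> nat) (p delta0 deltaA : nat -> R) (X : forall m, 'M[R]_(n m, m.+1))
  (d : nat -> measure_display) (T : forall m, measurableType (d m))
  (P : forall m, probability (T m) R)
  (beta0 : forall m, {RV (P m) >-> R})
  (beta : forall m, 'I_m -> {RV (P m) >-> R})
  (eps : forall m, 'I_(n m) -> {RV (P m) >-> R}).
Hypotheses (sigma_gt0 : 0 < sigma) (nu_0 : nu [set 0] = 0%E)
  (p01 : forall m, 0 < p m < 1)
  (delta0_gt0 : forall m, 0 < delta0 m) (deltaA_gt0 : forall m, 0 < deltaA m)
  (ltmn : forall m, (m < n m)%N)
  (X_orthogonal : forall m, (X m)^T *m X m = (n m)%:R%:M)
  (beta_law : forall m (i : 'I_m) (A : set R), measurable A ->
     distribution (P m) (beta m i) A = spike_slab (p m) nu A)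
  (eps_law : forall m (j : 'I_(n m)) (A : set R), measurable A ->
     distribution (P m) (eps m j) A = normal_prob 0 sigma A)
  (beta_eps_indep : forall m,
     mutually_independent (sum_family (beta m) (eps m)))
  (hB : assumption_B n p (fun m => delta0 m / deltaA m))
  (hC : assumption_C nu).
Variables (s : \bar R).
Hypotheses (s_gt0 : (0 < s)%E) (mp_cvg : (m%:R * p m)%:E @[m --> \oo] --> s).

Let Y m := response (X m) (beta0 m) (beta m) (eps m).
Let truth m := true_model (beta m).
Let V m := score (X m) (beta m) (eps m).
Let Risk (S : forall m, 'cV[R]_(n m) -> {set 'I_m}) m :=
  risk (P m) (delta0 m) (deltaA m) (truth m) (S m \o Y m).
Let oracle m := bayes_oracle sigma nu (p m) (delta0 m) (deltaA m) (X m).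

Let n0 m : (0 < n m)%N. Proof. exact: leq_trans (ltmn m). Qed.
Let n0R m : 0 < (n m)%:R :> R. Proof. by rewrite ltr0n. Qed.
Let sn0 m : 0 < Num.sqrt (n m)%:R :> R. Proof. by rewrite sqrtr_gt0. Qed.
Let p0 m : 0 < p m. Proof. by have /andP[] := p01 m. Qed.
Let ny : n m @[m --> \oo] --> \oo. Proof. by case: hB. Qed.

Lemma mp_bounded_below : exists2 c : R, 0 < c & \forall m \near \oo, c <= m%:R * p m.
Proof.
case: s s_gt0 mp_cvg => [a| |] // a0 mpa.
  exists (a / 2); first by rewrite divr_gt0.
  apply: near_ge_of_cvg (fine_cvg mpa) _; have : 0 < a by []; lra.
exists 1 => //; have /cvgeryP/cvgryPge := mpa; exact.
Qed.

Let J_exists m : {J : {measure set (measurableTypeR R * measurableTypeR R) -> \bar R} |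
  (forall B, measurable B -> J B = ((1 - p m)%:E * normal_prob 0 sigma [set z | B (0%R, z)]
      + (p m)%:E * (nu \x normal_prob 0 sigma) B)%E) /\ indep_laws (P m) (V m) (fun=> J)}.
Proof.
apply: cid.
exact: (score_indep sigma_gt0 (n0 m) (p01 m) (X_orthogonal m) (beta_law m) (eps_law m) (beta_eps_indep m)).
Qed.

Let J m := sval (J_exists m).
Let JE m : forall B, measurable B -> J m B = ((1 - p m)%:E * normal_prob 0 sigma [set z | B (0%R, z)]
      + (p m)%:E * (nu \x normal_prob 0 sigma) B)%E := (svalP (J_exists m)).1.
Let indepV m : indep_laws (P m) (V m) (fun=> J m) := (svalP (J_exists m)).2.

Section rule.
Variables (S : forall m, 'cV[R]_(n m) -> {set 'I_m}) (pen : nat -> nat -> R) (C : R).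
Hypotheses (mS : forall m M, measurable [set w | S m (Y m w) = M])
  (minS : forall m, minimizes (fun y M => RSS (X m) y M / sigma ^+ 2 + pen m #|M|) (S m))
  (pen_incr : forall m k, (0 < k <= m)%N -> 1 <= log_level R (n m) m k ->
     rule_lo n C m k <= pen m k - pen m k.-1 <= rule_up n C m k).

Let S' m := S m \o Y m.

Let statE m w i : (n m)%:R * least_squares (X m) (Y m w) (lift ord0 i) ord0 ^+ 2 / sigma ^+ 2 =
  stat sigma (n m) (V m i w).
Proof. by rewrite least_squares_score. Qed.

Let S_in : \forall m \near \oo, forall w i, i \in S' m w ->
   rule_lo n C m #|S' m w| <= stat sigma (n m) (V m i w).
Proof.
near=> m => w i iS; rewrite -statE.
have S0 : (0 < #|S' m w| <= m)%N.
  by apply/andP; split; [apply/card_gt0P; exists i|apply: leq_trans (max_card _) _; rewrite card_ord].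
apply: le_trans (selected_stat_ge (n0 m) (X_orthogonal m) (minS m) iS).
suff l1 : 1 <= log_level R (n m) m #|S' m w| by have /andP[] := pen_incr _ _ S0 l1.
apply: le_trans (log_level_ge R (n0 m) S0); near: m; exact: near_ln_n_ge.
Unshelve. all: by end_near. Qed.

Let S_out : \forall m \near \oo, forall w i, i \notin S' m w ->
   stat sigma (n m) (V m i w) <= rule_up n C m #|S' m w|.+1.
Proof.
near=> m => w i iS; rewrite -statE.
(* An unselected regressor leaves at most m - 1 selected ones, so the next size still indexes a
   level. *)
have S1 : (0 < #|S' m w|.+1 <= m)%N.
  rewrite /= -[X in (_ < X)%N](card_ord m) -cardsT; apply: proper_card.
  by rewrite finset.properT; apply: contraNneq iS => ->; rewrite finset.inE.
apply: le_trans (unselected_stat_le (n0 m) (X_orthogonal m) (minS m) iS) _.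
suff l1 : 1 <= log_level R (n m) m #|S' m w|.+1 by have /andP[] := pen_incr _ _ S1 l1.
apply: le_trans (log_level_ge R (n0 m) S1); near: m; exact: near_ln_n_ge.
Unshelve. all: by end_near. Qed.

Let mS'p m i : measurable (false_positive (V m) (S' m) i).
Proof. exact: (measurable_false_positive (indepV m) (mS m)). Qed.
Let mS'n m i : measurable (false_negative (V m) (S' m) i).
Proof. exact: (measurable_false_negative (indepV m) (mS m)). Qed.

Let O m := @oracle_rule R sigma nu n p delta0 deltaA d T V m.

Let oracle_eq m : oracle m \o Y m =
  O m.
Proof.
apply/funext => w /=; apply/setP => i.
by rewrite /oracle /bayes_oracle !finset.inE least_squares_score.
Qed.

Let risk_S m : fine (Risk S m) = delta0 m * false_positives P V S' m +
  deltaA m * false_negatives P V S' m.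
Proof.
rewrite /Risk /false_positives /false_negatives.
have tE := true_model_score (X m) (beta m) (eps m).
rewrite (risk_decomposition (P m) tE (mS'p m) (mS'n m)).
by [].
Qed.

Let risk_oracle m : fine (Risk oracle m) =
  delta0 m * false_positives P V O m +
  deltaA m * false_negatives P V O m.
Proof.
rewrite /Risk oracle_eq.
have tE := true_model_score (X m) (beta m) (eps m).
have mO M : measurable [set w | O m w = M].
  exact: (measurable_oracle_rule sigma nu n p delta0 deltaA indepV).
have mp := measurable_false_positive (indepV m) mO.
have mn := measurable_false_negative (indepV m) mO.
rewrite (risk_decomposition (P m) tE mp mn).
by [].
Qed.

(** Divided by deltaA D both risks tend to 1, the contribution of the false negatives. The false
    positives of the rule vanish because delta is bounded; those of the oracle come already weighted
    by delta. *)
Lemma rule_ABOS : ABOS (Risk S) (Risk oracle).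
Proof.
have [c c0 mp_ge] := mp_bounded_below.
have [kappa [kappa0 nuk]] := ball_prob_cvg nu_0 hC.
have [_ _ _ [K hK]] := hB.
pose D := risk_order n p sigma kappa.
have fpS : \forall m \near \oo, 0 <= false_positives P V S' m <=
    4 * expR (C / 2) * (1 + m%:R * p m) / Num.sqrt (n m)%:R.
  exact: (rule_false_positives sigma_gt0 nu_0 p01 ltmn ny JE indepV mS S_in).
have fnS : false_negatives P V S' m / D m @[m --> \oo] --> (1 : R).
  exact: (rule_false_negatives sigma_gt0 nu_0 p01 ltmn ny hC c0 mp_ge kappa0 nuk JE indepV mS S_in S_out s_gt0 mp_cvg).
have [C' C'0 fpO] := oracle_false_positives sigma_gt0 nu_0 p01 delta0_gt0 deltaA_gt0 ltmn hB hC c0 mp_ge JE indepV.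
have fnO : false_negatives P V O m / D m @[m --> \oo] --> (1 : R).
  exact: (oracle_false_negatives sigma_gt0 nu_0 p01 delta0_gt0 deltaA_gt0 ltmn hB hC c0 mp_ge kappa0 nuk JE indepV).
have fpO' := false_positives_negligible p01 ltmn ny c0 mp_ge sigma_gt0 kappa0 C'0 fpO.
have fpS' : \forall m \near \oo, 0 <= delta0 m / deltaA m * false_positives P V S' m <=
    `|K| * (4 * expR (C / 2)) * (1 + m%:R * p m) / Num.sqrt (n m)%:R.
  near=> m; have /andP[h0 h1] : 0 <= false_positives P V S' m <=
    4 * expR (C / 2) * (1 + m%:R * p m) / Num.sqrt (n m)%:R by near: m.
  have del0 : 0 <= delta0 m / deltaA m by rewrite divr_ge0// ltW.
  rewrite mulr_ge0//=.
  have -> : `|K| * (4 * expR (C / 2)) * (1 + m%:R * p m) / Num.sqrt (n m)%:R =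
    `|K| * (4 * expR (C / 2) * (1 + m%:R * p m) / Num.sqrt (n m)%:R) by ring.
  by apply: ler_pM => //; exact: le_trans (hK m) (ler_norm K).
have KC0 : 0 <= `|K| * (4 * expR (C / 2)) by rewrite !mulr_ge0 ?expR_ge0.
have fpS0 := false_positives_negligible p01 ltmn ny c0 mp_ge sigma_gt0 kappa0 KC0 fpS'.
pose x m := delta0 m / deltaA m * false_positives P V S' m / D m + false_negatives P V S' m / D m.
pose y m := delta0 m / deltaA m * false_positives P V O m / D m + false_negatives P V O m / D m.
have x1 : x m @[m --> \oo] --> (1 : R).
  by apply: (cvg_to_eq (a := 0 + 1)); [exact: cvgD|rewrite add0r].
have y1 : y m @[m --> \oo] --> (1 : R).
  by apply: (cvg_to_eq (a := 0 + 1)); [exact: cvgD|rewrite add0r].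
have : x m / y m @[m --> \oo] --> (1 : R).
  apply: (cvg_to_eq (a := 1 / 1)); last by rewrite divr1.
  by apply: cvgM => //; apply: cvgV => //; exact: oner_neq0.
apply: cvg_trans; apply: near_eq_cvg; near=> m.
have D0 : 0 < D m by near: m; exact: (risk_order_gt0 p01 ltmn ny sigma_gt0 kappa0).
have riskE (a b : R) : delta0 m * a + deltaA m * b =
    deltaA m * D m * (delta0 m / deltaA m * a / D m + b / D m).
  by field; rewrite !lt0r_neq0.
by rewrite risk_S risk_oracle !riskE -/(x m) -/(y m) -mulf_div divff ?mul1r// lt0r_neq0// mulr_gt0.
Unshelve. all: by end_near. Qed.

(** The expected number of errors of either kind is O(D), and D tends to 0 because L is of order ln
    n. *)
Lemma rule_consistent :
  m%:R * p m * Num.sqrt (ln (n m)%:R / (n m)%:R) @[m --> \oo] --> (0 : R) ->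
  consistent P truth (fun m => S m \o Y m).
Proof.
move=> mpn.
have [c c0 mp_ge] := mp_bounded_below.
have [kappa [kappa0 nuk]] := ball_prob_cvg nu_0 hC.
pose D := risk_order n p sigma kappa.
have fpS : \forall m \near \oo, 0 <= false_positives P V S' m <=
    4 * expR (C / 2) * (1 + m%:R * p m) / Num.sqrt (n m)%:R.
  exact: (rule_false_positives sigma_gt0 nu_0 p01 ltmn ny JE indepV mS S_in).
have fnS : false_negatives P V S' m / D m @[m --> \oo] --> (1 : R).
  exact: (rule_false_negatives sigma_gt0 nu_0 p01 ltmn ny hC c0 mp_ge kappa0 nuk JE indepV mS S_in S_out s_gt0 mp_cvg).
have C40 : 0 <= 4 * expR (C / 2) by rewrite mulr_ge0 ?expR_ge0.
have fpS0 := false_positives_negligible p01 ltmn ny c0 mp_ge sigma_gt0 kappa0 C40 fpS.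
have D_0 : D m @[m --> \oo] --> 0.
  (* The factor 2 is sqrt 4, from L <= 3 ln n - 2 ln c <= 4 ln n eventually. *)
  pose B m := 2 * kappa * sigma * (m%:R * p m * Num.sqrt (ln (n m)%:R / (n m)%:R)).
  have B0 : B m @[m --> \oo] --> 0.
    by apply: (cvg_to_eq (a := 2 * kappa * sigma * 0)); [apply: cvgM => //; exact: cvg_cst|rewrite mulr0].
  apply: (@squeeze_cvgr _ _ _ _ (fun=> 0) _ _ _ _ (cvg_cst 0) B0).
  near=> m; apply/andP; split.
    by apply: ltW; near: m; exact: (risk_order_gt0 p01 ltmn ny sigma_gt0 kappa0).
  have l1 : level n p m <= 3 * ln (n m)%:R - 2 * ln c by near: m; exact: (level_le p01 ltmn c0 mp_ge).
  have l2 : - 2 * ln c <= ln (n m)%:R by near: m; exact: near_ln_n_ge.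
  have l3 : 0 <= ln (n m)%:R :> R by rewrite ln_ge0// ler1n.
  have l4 : Num.sqrt (level n p m) <= 2 * Num.sqrt (ln (n m)%:R).
    have -> : 2 = Num.sqrt (2 ^+ 2 : R) by rewrite sqrtr_sqr ger0_norm.
    by rewrite -sqrtrM ?exprn_ge0// ler_wsqrtr//; lra.
  rewrite /D /risk_order /B sqrtrM// sqrtrV ?(ltW (n0R m))//.
  have h0 : 0 <= m%:R * p m * kappa * sigma / Num.sqrt (n m)%:R.
    by rewrite divr_ge0 ?(ltW (sn0 m))// !mulr_ge0// ltW.
  have h1 := ler_wpM2l h0 l4.
  rewrite (_ : m%:R * p m * (kappa * sigma * _ / _) = m%:R * p m * kappa * sigma / Num.sqrt (n m)%:R * Num.sqrt (level n p m)); last by ring.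
  by apply: le_trans h1 _; rewrite le_eqVlt; apply/orP; left; apply/eqP; ring.
pose E m := false_positives P V S' m / D m * D m + false_negatives P V S' m / D m * D m.
have E0 : 1 - E m @[m --> \oo] --> (1 : R).
  apply: (cvg_to_eq (a := 1 - (0 * 0 + 1 * 0))); last by rewrite !mulr0 addr0 subr0.
  by apply: cvgB; [exact: cvg_cst|apply: cvgD; exact: cvgM].
have dec m := prob_true_model_ge (P m) (true_model_score (X m) (beta m) (eps m)) (mS'p m) (mS'n m).
apply/fine_cvgP; split.
  by near=> m; apply: fin_num_measure; have [] := dec m.
apply: (squeeze_cvgr _ E0 (cvg_cst (1 : R))).
near=> m; apply/andP; split.
  have D0 : 0 < D m by near: m; exact: (risk_order_gt0 p01 ltmn ny sigma_gt0 kappa0).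
  have [_] := dec m; apply: le_trans.
  by rewrite /E !divfK ?gt_eqF.
rewrite -lee_fin fineK; last by apply: fin_num_measure; have [] := dec m.
by apply: probability_le1; have [] := dec m.
Unshelve. all: by end_near. Qed.

End rule.
End optimality.

Lemma pen1_incr_bounds (R : realType) (dd : R) n m k : (0 < n m)%N -> (0 < k <= m)%N ->
  1 <= log_level R (n m) m k ->
  rule_lo n (`|dd| + 2) m k <= pen1 dd (n m) m k - pen1 dd (n m) m k.-1 <= rule_up n (`|dd| + 2) m k.
Proof.
move=> n0 /andP[k0 km] l1; rewrite pen1_incr// ?(leq_trans k0 km)// /rule_lo /rule_up.
have l0 := ln_ge0 l1; have := ler_norm dd; have := ler_norm (- dd); rewrite normrN => h1 h2.
by apply/andP; split; lra.
Qed.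

Lemma pen2_incr_bounds (R : realType) (dd : R) n m k : (0 < n m)%N -> (0 < k <= m)%N ->
  1 <= log_level R (n m) m k ->
  rule_lo n (`|dd| + 2) m k <= pen2 dd (n m) m k - pen2 dd (n m) m k.-1 <= rule_up n (`|dd| + 2) m k.
Proof.
move=> n0 /andP[k0 km] l1; rewrite pen2_incr// ?(leq_trans k0 km)// /rule_lo /rule_up.
have l0 := ln_ge0 l1; have := ler_norm dd; have := ler_norm (- dd); rewrite normrN => h1 h2.
by apply/andP; split; lra.
Qed.

Lemma pen3_incr_bounds (R : realType) (dd : R) n m k : (0 < n m)%N -> (0 < k <= m)%N ->
  1 <= log_level R (n m) m k ->
  rule_lo n (`|dd| + 2) m k <= pen3 dd (n m) m k - pen3 dd (n m) m k.-1 <= rule_up n (`|dd| + 2) m k.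
Proof.
move=> n0 /andP[k0 km] l1; have := pen3_incr dd n0 (leq_trans k0 km) k0; rewrite /rule_lo /rule_up.
have l0 := ln_ge0 l1; have := ler_norm dd; have := ler_norm (- dd); rewrite normrN => h1 h2 /andP[h3 h4].
by apply/andP; split; lra.
Qed.

Theorem theorem3p2 (R : realType)
  (sigma : R) (sigma_gt0 : 0 < sigma)
  (nu : probability (measurableTypeR R) R)
  (nu_0 : nu [set 0] = 0%E)
  (nu_neg : (0 < nu `]-oo, 0%R[%classic)%E)
  (nu_pos : (0 < nu `]0%R, +oo[%classic)%E)
  (n : nat -> nat) (p delta0 deltaA : nat -> R)
  (p_01 : forall m, 0 < p m < 1)
  (delta0_gt0 : forall m, 0 < delta0 m)
  (deltaA_gt0 : forall m, 0 < deltaA m)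
  (X : forall m, 'M[R]_(n m, m.+1))
  (ltmn : forall m, (m < n m)%N)
  (X_intercept : forall m j, X m j ord0 = 1)
  (X_orthogonal : forall m, (X m)^T *m X m = (n m)%:R%:M)
  (* nothing is assumed about the intercept beta0 *)
  (d : nat -> measure_display) (T : forall m, measurableType (d m))
  (P : forall m, probability (T m) R)
  (beta0 : forall m, {RV (P m) >-> R})
  (beta : forall m, 'I_m -> {RV (P m) >-> R})
  (eps : forall m, 'I_(n m) -> {RV (P m) >-> R})
  (beta_law : forall m (i : 'I_m) (A : set R), measurable A ->
     distribution (P m) (beta m i) A = spike_slab (p m) nu A)
  (eps_law : forall m (j : 'I_(n m)) (A : set R), measurable A ->
     distribution (P m) (eps m j) A = normal_prob 0 sigma A)
  (beta_eps_indep : forall m,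
     mutually_independent (sum_family (beta m) (eps m)))
  (hB : assumption_B n p (fun m => delta0 m / deltaA m))
  (hC : assumption_C nu)
  (s : \bar R) (s_gt0 : (0 < s)%E)
  (mp_cvg : (m%:R * p m)%:E @[m --> \oo] --> s)
  (h_denser : denser_case_assumption n p)
  (d1 d2 d3 : R)
  (S1 S2 S3 : forall m, 'cV[R]_(n m) -> {set 'I_m}) :
  let Y m := response (X m) (beta0 m) (beta m) (eps m) in
  let truth m := true_model (beta m) in
  let Risk (S : forall m, 'cV[R]_(n m) -> {set 'I_m}) m :=
    risk (P m) (delta0 m) (deltaA m) (truth m) (S m \o Y m) in
  let RiskB := Risk (fun m =>
    bayes_oracle sigma nu (p m) (delta0 m) (deltaA m) (X m)) in
  let measurable_rule (S : forall m, 'cV[R]_(n m) -> {set 'I_m}) :=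
    forall m M, measurable [set w | S m (Y m w) = M] in
  measurable_rule S1 -> (forall m, minimizes (mbic1 sigma d1 (X m)) (S1 m)) ->
  measurable_rule S2 -> (forall m, minimizes (mbic2 sigma d2 (X m)) (S2 m)) ->
  measurable_rule S3 -> (forall m, minimizes (mbic3 sigma d3 (X m)) (S3 m)) ->
  [/\ ABOS (Risk S1) RiskB, ABOS (Risk S2) RiskB & ABOS (Risk S3) RiskB] /\
  (m%:R * p m * Num.sqrt (ln (n m)%:R / (n m)%:R) @[m --> \oo] --> (0 : R) ->
   [/\ consistent P truth (fun m => S1 m \o Y m),
       consistent P truth (fun m => S2 m \o Y m) &
       consistent P truth (fun m => S3 m \o Y m)]).
Proof.
move=> Y truth Risk RiskB measurable_rule mS1 min1 mS2 min2 mS3 min3.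
have n0 m : (0 < n m)%N by exact: leq_trans (ltmn m).
have min1' m : minimizes (fun y M => RSS (X m) y M / sigma ^+ 2 + pen1 d1 (n m) m #|M|) (S1 m).
  by move=> y M; rewrite -!mbic1E; exact: min1.
have min2' m : minimizes (fun y M => RSS (X m) y M / sigma ^+ 2 + pen2 d2 (n m) m #|M|) (S2 m).
  by move=> y M; rewrite -!mbic2E; exact: min2.
have min3' m : minimizes (fun y M => RSS (X m) y M / sigma ^+ 2 + pen3 d3 (n m) m #|M|) (S3 m).
  by move=> y M; rewrite -!mbic3E; exact: min3.
have i1 m k := @pen1_incr_bounds R d1 n m k (n0 m).
have i2 m k := @pen2_incr_bounds R d2 n m k (n0 m).
have i3 m k := @pen3_incr_bounds R d3 n m k (n0 m).
have optimal S pen C mS minS incr := conj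
  (rule_ABOS _ _ _ _ _ _ _ _ _ _ _ beta0 _ _ sigma_gt0 nu_0 p_01 delta0_gt0 deltaA_gt0 ltmn
    X_orthogonal beta_law eps_law beta_eps_indep hB hC s s_gt0 mp_cvg S pen C mS minS incr)
  (rule_consistent _ _ _ _ _ _ _ _ _ _ _ beta0 _ _ sigma_gt0 nu_0 p_01 ltmn
    X_orthogonal beta_law eps_law beta_eps_indep hB hC s s_gt0 mp_cvg S pen C mS minS incr).
have [abos1 cons1] := optimal S1 _ _ mS1 min1' i1.
have [abos2 cons2] := optimal S2 _ _ mS2 min2' i2.
have [abos3 cons3] := optimal S3 _ _ mS3 min3' i3.
by split; [split|move=> mpn; split; [exact: cons1|exact: cons2|exact: cons3]].
Qed.
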